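(* Let $r>\frac12$ and $T>0$, and let $\Phi$ be a solution of the Dirac-Poisson system (DP) with $\Phi\in L^\infty((0,T);H^{r+1})$ and $\partial_t\Phi\in L^\infty((0,T);H^r)$. Let $\Phi^n$ be the numerical solution produced by the second-order ULI scheme (ULI2-DP) with time step $\tau$. Then there exist constants $\tau_0,C>0$, depending on $\|\Phi\|_{L^\infty((0,T);H^{r+1})}$, $\|\partial_t\Phi\|_{L^\infty((0,T);H^r)}$ and $T$, such that for all $0<\tau\le\tau_0$ and all $n$ with $0\le t_n=n\tau\le T$, $$\|\Phi(t_n)-\Phi^n\|_r\le C\tau^2 .$$ The same statement holds if $\Phi$ is instead a solution of the nonlinear Dirac equation (NDE) with given potential $V$, with the same regularity, and $\Phi^n$ is produced by the second-order ULI scheme (ULI2-ext).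
   Context: Setting. $\mathbb T=\mathbb R/2\pi\mathbb Z$; $\lambda\in\mathbb R$ is a fixed parameter; $\Phi=(\phi_1,\phi_2)^T:[0,\infty)\times\mathbb T\to\mathbb C^2$; $\Phi^*=\overline\Phi^T$; $$\alpha=\begin{pmatrix}0&1\\1&0\end{pmatrix},\quad \beta=\begin{pmatrix}1&0\\0&-1\end{pmatrix},\quad F(\Phi)=\lambda(\Phi^*\beta\Phi)\beta\Phi=\lambda(|\phi_1|^2-|\phi_2|^2)\beta\Phi .$$ (NDE): $i\partial_t\Phi=-i\alpha\partial_x\Phi+\beta\Phi+V\Phi+F(\Phi)$ for $t>0$, $x\in\mathbb T$, $\Phi(0)=\Phi_0$, where $V=V_e(x)$ is a given real-valued smooth function on $\mathbb T$. (DP): the same equation, with $V=V(t,x)$ determined by $-\partial_{xx}V=|\Phi|^2$, $\int_{\mathbb T}V\,dx=0$, i.e. $V=-\partial_{xx}^{-1}|\Phi|^2$, where for $\psi:\mathbb T\to\mathbb C$, $\partial_{xx}^{-1}\psi:=-\sum_{l\ne0}l^{-2}\widehat\psi_l e^{ilx}$ ($\widehat\psi_l$ the Fourier coefficients of $\psi$). Solutions satisfy Duhamel's formula $\Phi(t+s)=e^{-s\alpha\partial_x}\Phi(t)-i\int_0^s e^{-(s-\rho)\alpha\partial_x}[\beta\Phi+V\Phi+F(\Phi)](t+\rho)\,d\rho$. Norms. $\|\cdot\|_r$ is the standard norm of $H^r=H^r(\mathbb T)$; for $\Psi=(\psi_1,\psi_2)^T$, $\|\Psi\|_r=\sqrt{\|\psi_1\|_r^2+\|\psi_2\|_r^2}$.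 Operators. $\varphi_1(z)=\frac{e^z-1}{z}$ (with $\varphi_1(0)=1$); for $s\in\mathbb R$, $\varphi_1(s\partial_x)$ is the Fourier multiplier with symbol $\varphi_1(isl)$, $l\in\mathbb Z$. $\Pi_+=\frac12\begin{pmatrix}1&1\\1&1\end{pmatrix}$, $\Pi_-=\frac12\begin{pmatrix}1&-1\\-1&1\end{pmatrix}$, and $e^{s\alpha\partial_x}=e^{s\partial_x}\Pi_++e^{-s\partial_x}\Pi_-$, where $e^{s\partial_x}$ has Fourier symbol $e^{isl}$. First-order maps. With time step $\tau>0$, $t_n=n\tau$, $\Phi^n=(\phi_1^n,\phi_2^n)^T$, $\phi_\pm^n=\phi_1^n\pm\phi_2^n$, the maps $\Theta_{\mathrm{ext}}(\Phi^n)$ and $\Theta_{\mathrm{DP}}(\Phi^n)$ are both given by $$e^{-\tau\alpha\partial_x}\Phi^n-i e^{-\tau\alpha\partial_x}(I_1^n+I_2^n+I_3^n),$$ with $$I_1^n=\tau[\varphi_1(2\tau\partial_x)\beta\Pi_-+\varphi_1(-2\tau\partial_x)\beta\Pi_+]\Phi^n,$$ $$I_3^n=\frac{\tau\lambda}{4}\begin{pmatrix}a^n+b^n\\ a^n-b^n\end{pmatrix},\quad \begin{aligned}a^n&=\overline{\phi_+^n}\,\varphi_1(2\tau\partial_x)(\phi_-^n)^2+\phi_+^n\,\varphi_1(2\tau\partial_x)|\phi_-^n|^2,\\ b^n&=\phi_-^n\,\varphi_1(-2\tau\partial_x)|\phi_+^n|^2+\overline{\phi_-^n}\,\varphi_1(-2\tau\partial_x)(\phi_+^n)^2,\end{aligned}$$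 and, for $\Theta_{\mathrm{ext}}$, $I_2^n=\tau[(\varphi_1(\tau\partial_x)V)\Pi_++(\varphi_1(-\tau\partial_x)V)\Pi_-]\Phi^n$, while for $\Theta_{\mathrm{DP}}$, $$I_2^n=-\frac{\tau}{4}\begin{pmatrix}c^n+d^n\\ c^n-d^n\end{pmatrix},\quad \begin{aligned}c^n&=\phi_+^n\,\partial_{xx}^{-1}\big[\varphi_1(2\tau\partial_x)|\phi_-^n|^2+|\phi_+^n|^2\big],\\ d^n&=\phi_-^n\,\partial_{xx}^{-1}\big[\varphi_1(-2\tau\partial_x)|\phi_+^n|^2+|\phi_-^n|^2\big].\end{aligned}$$ Second-order schemes. (ULI2-ext): $\Phi^0=\Phi_0$ and, for $n\ge0$, $$\Phi^{n+1}=\Theta_{\mathrm{ext}}(\Phi^n)-\frac{\tau^2}{2}(\beta+V)G^n-\frac{\lambda\tau^2}{2}(|\phi_1^n|^2-|\phi_2^n|^2)\beta G^n+i\lambda\tau^2\,\mathrm{Im}[\phi_1^n\overline{G_1^n}+\overline{\phi_2^n}G_2^n]\,\beta\Phi^n,$$ with $G^n=(G_1^n,G_2^n)^T=\beta\Phi^n+V\Phi^n+F(\Phi^n)$. (ULI2-DP): $\Phi^0=\Phi_0$ and, for $n\ge0$, $$\begin{aligned}\Phi^{n+1}=\ &\Theta_{\mathrm{DP}}(\Phi^n)-\frac{\tau^2}{2}\beta G^n-\frac{\lambda\tau^2}{2}(|\phi_1^n|^2-|\phi_2^n|^2)\beta G^n+i\lambda\tau^2\,\mathrm{Im}[\phi_1^n\overline{G_1^n}+\overline{\phi_2^n}G_2^n]\,\beta\Phi^n\\&+\frac{\tau^2}{2}\big(\partial_{xx}^{-1}|\Phi^n|^2\big)G^n-i\tau^2\big(\partial_{xx}^{-1}\mathrm{Im}[\phi_1^n\overline{G_1^n}-\overline{\phi_2^n}G_2^n]\big)\Phi^n,\end{aligned}$$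 with $G^n=(G_1^n,G_2^n)^T=\beta\Phi^n-(\partial_{xx}^{-1}|\Phi^n|^2)\Phi^n+F(\Phi^n)$. *)

(* Defs.v *)
From HB Require Import structures.
From mathcomp Require Import all_boot all_order all_algebra.
From mathcomp Require Export complex.
From mathcomp Require Import all_classical all_reals all_analysis ess_sup_inf.

Set Implicit Arguments.
Unset Strict Implicit.
Unset Printing Implicit Defensive.

Import Order.TTheory GRing.Theory Num.Theory.
Import numFieldNormedType.Exports.
Local Open Scope classical_set_scope.
Local Open Scope complex_scope.
Local Open Scope ring_scope.

Section ULI.
Variable R : realType.

Local Notation C := R[i].
Local Notation mu := (@lebesgue_measure R).

(* A function on the torus R / 2 pi Z is a 2 pi-periodic function on the line;
   periodicity is part of [in_Hs], [smooth_potential] and [is_solution]. *)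
Local Notation torus_fun := (R -> R[i]).
Local Notation spinor := ('cV[R[i]]_2).
Local Notation spinor_fun := (R -> 'cV[R[i]]_2).

(* The libraries put no topology on R[i]: integrals, derivatives, limits and
   continuity of complex-valued functions of a real variable are taken on real
   and imaginary parts. *)
Definition cint (D : set R) (f : R -> C) : C :=
  (\int[mu]_(x in D) complex.Re (f x))%R +i* (\int[mu]_(x in D) complex.Im (f x))%R.

Definition cderiv (f : R -> C) (x : R) : C :=
  derive1 (fun y => complex.Re (f y)) x +i* derive1 (fun y => complex.Im (f y)) x.

Definition ccontinuous (f : R -> C) : Prop :=
  continuous (fun y => complex.Re (f y)) /\ continuous (fun y => complex.Im (f y)).

(* Sum over Z, as the limit of the symmetric partial sums over |l| <= N. *)
Definition csumZ (a : int -> C) : C :=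
  let S N := \sum_(k < N.*2.+1) a (k%:Z - N%:Z) in
  limn (fun N => complex.Re (S N)) +i* limn (fun N => complex.Im (S N)).

Definition cexp (z : C) : C :=
  (expR (complex.Re z))%:C * (cos (complex.Im z) +i* sin (complex.Im z)).

Definition cpt (Phi : spinor_fun) (j : 'I_2) : torus_fun := fun x => Phi x j 0.

Definition periodic2pi (T : Type) (f : R -> T) : Prop :=
  forall x, f (x + 2 * pi) = f x.

Definition fcoef (f : torus_fun) (l : int) : C :=
  ((2 * pi)^-1)%:C *
  cint `[0, 2 * pi] (fun x => f x * cexp (- ('i * l%:~R * x%:C))).

Definition fmult (m : int -> C) (f : torus_fun) : torus_fun :=
  fun x => csumZ (fun l => m l * fcoef f l * cexp ('i * l%:~R * x%:C)).

(* The H^s norm, with value +oo when the series diverges. *)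
Definition Hnorm (s : R) (f : torus_fun) : \bar R :=
  sqrte (\esum_(l in [set: int])
    ((1 + (l%:~R : R) ^+ 2) `^ s * complex.Re `|fcoef f l| ^+ 2)%:E).

Definition Hnorm2 (s : R) (Psi : spinor_fun) : \bar R :=
  sqrte (Hnorm s (cpt Psi 0%R) ^+ 2 + Hnorm s (cpt Psi 1%R) ^+ 2)%E.

(* H^s for s > 1/2, the only case used: by the embedding of H^s in the
   continuous functions, its elements are identified with their continuous
   representatives. *)
Definition in_Hs (s : R) (f : torus_fun) : Prop :=
  [/\ periodic2pi f, ccontinuous f & (Hnorm s f < +oo)%E].

Definition in_Hs2 (s : R) (Psi : spinor_fun) : Prop :=
  forall j, in_Hs s (cpt Psi j).

Definition simple_Hs (s : R) (S : R -> spinor_fun) : Prop :=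
  exists (N : nat) (A : 'I_N -> set R) (v : 'I_N -> spinor_fun),
    [/\ forall i, measurable (A i), forall i, in_Hs2 s (v i) &
        S = fun t x => \sum_(i < N) (\1_(A i) t)%:C *: v i x].

Definition strongly_measurable (T s : R) (Psi : R -> spinor_fun) : Prop :=
  exists S : nat -> R -> spinor_fun,
    (forall k, simple_Hs s (S k)) /\
    {ae mu, forall t : R, 0 < t < T ->
      (fun k => Hnorm2 s (Psi t - S k t)) @ \oo --> 0%E}.

Definition Linf_norm (T s : R) (Psi : R -> spinor_fun) : \bar R :=
  ess_sup mu (fun t : R => if 0 < t < T then Hnorm2 s (Psi t) else 0%E).

Definition in_Linf (T s : R) (Psi : R -> spinor_fun) : Prop :=
  [/\ strongly_measurable T s Psi,
      {ae mu, forall t : R, 0 < t < T -> in_Hs2 s (Psi t)} &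
      (Linf_norm T s Psi < +oo)%E].

(* [dPhi] is the (weak) time derivative of [Phi] on (0,T), [Phi] being taken as
   its representative that is absolutely continuous on [0,T] with values in H^r,
   r > 1/2. Since point evaluations are continuous on H^r and separate its
   points, the identity between H^r-valued integrals is stated pointwise. *)
Definition time_derivative (T : R) (Phi dPhi : R -> spinor_fun) : Prop :=
  forall s t x (j : 'I_2), 0 <= s -> s <= t -> t <= T ->
    Phi t x j 0 - Phi s x j 0 = cint `[s, t] (fun rho => dPhi rho x j 0).

Definition mx2 (a b c d : C) : 'M[C]_2 :=
  \matrix_(i < 2, j < 2) (nth [::] [:: [:: a; b]; [:: c; d]] i)`_j.

Definition alpha : 'M[C]_2 := mx2 0 1 1 0.
Definition beta : 'M[C]_2 := mx2 1 0 0 (-1).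
Definition Pip : 'M[C]_2 := 2^-1 *: mx2 1 1 1 1.
Definition Pim : 'M[C]_2 := 2^-1 *: mx2 1 (-1) (-1) 1.

Definition sqabs (z : C) : C := `|z| ^+ 2.
Definition density (v : spinor) : C := sqabs (v 0 0) + sqabs (v 1 0).
(* v^* beta v *)
Definition beta_form (v : spinor) : C := sqabs (v 0 0) - sqabs (v 1 0).

Definition dx (Phi : spinor_fun) : spinor_fun :=
  fun x => \col_j cderiv (cpt Phi j) x.

Definition dxx_inv : torus_fun -> torus_fun :=
  fmult (fun l => if l == 0 then 0 else - (l%:~R ^- 2)).

Section Equation.
Variable lambda : R.

Definition Fnl (v : spinor) : spinor := (lambda%:C * beta_form v) *: (beta *m v).

Definition nonlin (V : torus_fun) (Phi : spinor_fun) : spinor_fun :=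
  fun x => beta *m Phi x + V x *: Phi x + Fnl (Phi x).

(* A solution on [0,T] with initial datum [Phi0] and potential [V t x]: the
   equation holds in H^r for almost every time. *)
Definition is_solution (T : R) (V : R -> torus_fun) (Phi0 : spinor_fun)
    (Phi dPhi : R -> spinor_fun) : Prop :=
  [/\ forall t : R, 0 <= t <= T -> periodic2pi (Phi t),
      Phi 0 = Phi0,
      time_derivative T Phi dPhi &
      {ae mu, forall t : R, 0 < t < T -> forall x,
        'i *: dPhi t x =
          - ('i *: (alpha *m dx (Phi t) x)) + nonlin (V t) (Phi t) x}].

Definition V_DP (Phi : spinor_fun) : torus_fun :=
  fun x => - dxx_inv (fun y => density (Phi y)) x.

Definition is_DP_solution (T : R) (Phi0 : spinor_fun)
    (Phi dPhi : R -> spinor_fun) : Prop :=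
  is_solution T (fun t => V_DP (Phi t)) Phi0 Phi dPhi.

Definition smooth_potential (V : R -> R) : Prop :=
  periodic2pi V /\ forall (n : nat) (x : R), derivable (derive1n n V) x 1.

Definition is_NDE_solution (T : R) (V : R -> R) (Phi0 : spinor_fun)
    (Phi dPhi : R -> spinor_fun) : Prop :=
  is_solution T (fun _ x => (V x)%:C) Phi0 Phi dPhi.

Definition phi1 (z : C) : C := if z == 0 then 1 else (cexp z - 1) / z.

Definition phi1_op (s : R) : torus_fun -> torus_fun :=
  fmult (fun l => phi1 ('i * s%:C * l%:~R)).

Definition exp_op (s : R) : torus_fun -> torus_fun :=
  fmult (fun l => cexp ('i * s%:C * l%:~R)).

Definition lift2 (A : torus_fun -> torus_fun) (Phi : spinor_fun) : spinor_fun :=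
  fun x => \col_j A (cpt Phi j) x.

(* exp (s alpha d_x) *)
Definition exp_alpha (s : R) (Phi : spinor_fun) : spinor_fun :=
  fun x => lift2 (exp_op s) (fun y => Pip *m Phi y) x +
           lift2 (exp_op (- s)) (fun y => Pim *m Phi y) x.

Definition vec2 (a b : C) : spinor := \col_(i < 2) [:: a; b]`_i.

Section Step.
Variable tau : R.
Variable Phi : spinor_fun.

Let phip : torus_fun := fun x => Phi x 0 0 + Phi x 1 0.
Let phim : torus_fun := fun x => Phi x 0 0 - Phi x 1 0.

Definition I1 : spinor_fun := fun x =>
  tau%:C *: (lift2 (phi1_op (2 * tau)) (fun y => beta *m Pim *m Phi y) x +
             lift2 (phi1_op (- (2 * tau))) (fun y => beta *m Pip *m Phi y) x).

Definition I2_ext (V : R -> R) : spinor_fun := fun x =>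
  tau%:C *:
    ((phi1_op tau (fun y => (V y)%:C) x *: Pip +
      phi1_op (- tau) (fun y => (V y)%:C) x *: Pim) *m Phi x).

Definition I2_DP : spinor_fun := fun x =>
  let c := phip x *
    dxx_inv (fun y => phi1_op (2 * tau) (fun z => sqabs (phim z)) y +
                      sqabs (phip y)) x in
  let d := phim x *
    dxx_inv (fun y => phi1_op (- (2 * tau)) (fun z => sqabs (phip z)) y +
                      sqabs (phim y)) x in
  - (tau%:C / 4) *: vec2 (c + d) (c - d).

Definition I3 : spinor_fun := fun x =>
  let a := (phip x)^* * phi1_op (2 * tau) (fun y => phim y ^+ 2) x +
           phip x * phi1_op (2 * tau) (fun y => sqabs (phim y)) x in
  let b := phim x * phi1_op (- (2 * tau)) (fun y => sqabs (phip y)) x +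
           (phim x)^* * phi1_op (- (2 * tau)) (fun y => phip y ^+ 2) x in
  ((tau * lambda)%:C / 4) *: vec2 (a + b) (a - b).

Definition Theta (I2 : spinor_fun) : spinor_fun := fun x =>
  exp_alpha (- tau) Phi x -
  'i *: exp_alpha (- tau) (fun y => I1 y + I2 y + I3 y) x.

(* The terms shared by both second-order schemes:
   - lambda tau^2/2 (|phi_1|^2 - |phi_2|^2) beta G
   + i lambda tau^2 Im[phi_1 conj(G_1) + conj(phi_2) G_2] beta Phi. *)
Definition F_correction (G : spinor_fun) : spinor_fun := fun x =>
  - ((lambda * tau ^+ 2 / 2)%:C * beta_form (Phi x)) *: (beta *m G x) +
  ('i * (lambda * tau ^+ 2)%:C *
     (complex.Im (Phi x 0 0 * (G x 0 0)^* + (Phi x 1 0)^* * G x 1 0))%:C)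
    *: (beta *m Phi x).

Definition ULI2_ext_step (V : R -> R) : spinor_fun :=
  let G := nonlin (fun y => (V y)%:C) Phi in
  fun x =>
    Theta (I2_ext V) x
    - (tau ^+ 2 / 2)%:C *: (beta *m G x + (V x)%:C *: G x)
    + F_correction G x.

Definition ULI2_DP_step : spinor_fun :=
  let G := nonlin (V_DP Phi) Phi in
  fun x =>
    Theta I2_DP x
    - (tau ^+ 2 / 2)%:C *: (beta *m G x)
    + F_correction G x
    + ((tau ^+ 2 / 2)%:C * dxx_inv (fun y => density (Phi y)) x) *: G x
    - ('i * (tau ^+ 2)%:C *
        dxx_inv (fun y =>
          (complex.Im (Phi y 0 0 * (G y 0 0)^* - (Phi y 1 0)^* * G y 1 0))%:C) x)
      *: Phi x.

End Step.

Definition ULI2_ext (tau : R) (V : R -> R) (Phi0 : spinor_fun) (n : nat) :=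
  iter n (fun Phi => ULI2_ext_step tau Phi V) Phi0.

Definition ULI2_DP (tau : R) (Phi0 : spinor_fun) (n : nat) :=
  iter n (ULI2_DP_step tau) Phi0.

End Equation.
End ULI.

(* Main.v *)
Require Import Defs.
From mathcomp Require Import all_boot all_order all_algebra.
From mathcomp Require Import all_classical all_reals all_analysis ess_sup_inf.
From mathcomp Require Import ring lra zify.

Set Implicit Arguments.
Unset Strict Implicit.
Unset Printing Implicit Defensive.

Import Order.TTheory GRing.Theory Num.Theory.
Import numFieldNormedType.Exports.
Local Open Scope classical_set_scope.
Local Open Scope complex_scope.
Local Open Scope ring_scope.

(** Put [p = phi_1 + phi_2] and [q = phi_1 - phi_2].  The matrix [alpha] becomes
    diagonal: [p] is transported to the right and [q] to the left, and along its
    characteristic each of them satisfies an ordinary differential equation, with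
    rate [- i N(p, q)] for [p] and [- i N(q, p)] for [q].  For both problems [N]
    is built from [p], [q] and the external potential by sums, products,
    conjugation and Fourier multipliers bounded by one.

    In the frame of [p], freeze both components at the beginning of a step; then
    [q] drifts past [p] at speed 2, and the integral of the rate over the step is
    exact: integrating the translation by [2 s] in [s] produces
    [tau phi1(2 tau d_x)] ([cdiff_phi1_op], [mean_ext_deriv], [mean_DP_deriv]).
    This is the first-order map of the schemes.  During the step the two profiles
    also move, by [- i s N] to leading order ([profile_expand]), which changes the
    rate by its derivative in that direction; the integral of the change is
    [tau^2 / 2] times this derivative, and these are exactly the second-order
    terms of the schemes ([ULI2_ext_stepE], [ULI2_DP_stepE]).  The schemes evaluate
    them without drift, which costs one space derivative and gains one power of
    [tau].  Hence one step from data in [H^(r+1)] has an error [O(tau^3)] in [H^r]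
    ([local_twisted], [local_step]), although the solution has only one time
    derivative in [H^r]: no derivative of the solution in time or space beyond the
    first is ever formed.  Translations are isometries and [H^r] is an algebra, so
    the steps are stable on balls, and Gronwall's argument sums the local errors
    ([global_error]).

    Estimates are proved once for all nonlinearities by induction on a syntax
    ([expr]), and as membership in balls of [H^s] ([Hb]).  The facts about [H^s]
    with [s > 1/2] come from Fourier coefficients: they determine a continuous
    function ([fcoef_eq0]), the Fourier series converges absolutely
    ([Hb_synthE]), [H^s] is an algebra ([HbM]), balls are closed under uniform
    limits ([Hb_closed]), the uniform norm and a stronger ball control a weaker
    norm ([Hb_interp]), and a function of time whose pointwise derivatives lie in
    a ball of [H^r] has increments in the corresponding balls ([Hb_mean_value]).

    The solution is given in a weak form: an increment in time is the integral of
    a function that satisfies the equation for almost every time.  The equation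
    bounds the integrand, so the solution is Lipschitz in time for the uniform
    norm; by closedness of the balls it lies in [H^(r+1)] at every time
    ([solution_Hb]); by interpolation the right-hand side of the equation is
    jointly continuous, so the components are differentiable along their
    characteristics in the classical sense ([solution_characteristics]). *)

(** * Complex-valued functions of a real variable *)

Section ComplexToolkit.
Variable R : realType.
Local Notation C := R[i].
Local Notation Re := complex.Re.
Local Notation Im := complex.Im.
Implicit Types (z w : C) (f g : R -> C).

(** The modulus as a real number; the norm of [R[i]] has its values in [R[i]].
    *)
Definition cmod z : R := Num.sqrt (Re z ^+ 2 + Im z ^+ 2).

Lemma cmodE z : `|z| = (cmod z)%:C.
Proof. by rewrite normc_def. Qed.

Lemma cmod_ge0 z : 0 <= cmod z.
Proof. exact: sqrtr_ge0. Qed.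

Lemma cmod_sqr z : cmod z ^+ 2 = Re z ^+ 2 + Im z ^+ 2.
Proof. by rewrite sqr_sqrtr// addr_ge0 ?sqr_ge0. Qed.

Lemma cmodD z w : cmod (z + w) <= cmod z + cmod w.
Proof. by rewrite -lecR rmorphD/= -!cmodE ler_normD. Qed.

Lemma cmodM z w : cmod (z * w) = cmod z * cmod w.
Proof. by apply: (@complexI R); rewrite rmorphM/= -!cmodE normrM. Qed.

Lemma cmodN z : cmod (- z) = cmod z.
Proof. by apply: (@complexI R); rewrite -!cmodE normrN. Qed.

Lemma cmodB z w : cmod (z - w) <= cmod z + cmod w.
Proof. by rewrite -(cmodN w) cmodD. Qed.

Lemma cmod_distC z w : cmod (z - w) = cmod (w - z).
Proof. by rewrite -cmodN opprB. Qed.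

Lemma cmod_real (x : R) : cmod x%:C = `|x|.
Proof. by rewrite /cmod/= expr0n/= addr0 sqrtr_sqr. Qed.

Lemma cmod0 : cmod 0 = 0.
Proof. by rewrite -(rmorph0 (real_complex R)) cmod_real normr0. Qed.

Lemma cmod1 : cmod 1 = 1.
Proof. by rewrite -(rmorph1 (real_complex R)) cmod_real normr1. Qed.

Lemma cmod_eq0 z : cmod z = 0 -> z = 0.
Proof. by move=> h; apply/normr0_eq0; rewrite cmodE h. Qed.

Lemma conjcE z : z^*%R = z^*%C.
Proof. by []. Qed.

Lemma Re_J z : Re z^*%R = Re z.
Proof. by rewrite conjcE; case: z. Qed.

Lemma Im_J z : Im z^*%R = - Im z.
Proof. by rewrite conjcE; case: z. Qed.

Lemma cmodJ z : cmod z^*%R = cmod z.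
Proof. by rewrite /cmod Re_J Im_J sqrrN. Qed.

Lemma Re_le_cmod z : `|Re z| <= cmod z.
Proof.
by rewrite -[leLHS]sqrtr_sqr; apply: ler_wsqrtr; rewrite lerDl sqr_ge0.
Qed.

Lemma Im_le_cmod z : `|Im z| <= cmod z.
Proof.
by rewrite -[leLHS]sqrtr_sqr; apply: ler_wsqrtr; rewrite lerDr sqr_ge0.
Qed.

Lemma cmod_le z : cmod z <= `|Re z| + `|Im z|.
Proof.
rewrite -(ger0_norm (addr_ge0 (normr_ge0 (Re z)) (normr_ge0 (Im z)))).
rewrite -sqrtr_sqr ler_wsqrtr// sqrrD !real_normK ?num_real//.
by rewrite -addrA lerD2l lerDr mulrn_wge0// mulr_ge0.
Qed.

Lemma Re_D z w : Re (z + w) = Re z + Re w.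
Proof. by case: z w => [? ?] []. Qed.
Lemma Im_D z w : Im (z + w) = Im z + Im w.
Proof. by case: z w => [? ?] []. Qed.
Lemma Re_N z : Re (- z) = - Re z.
Proof. by case: z. Qed.
Lemma Im_N z : Im (- z) = - Im z.
Proof. by case: z. Qed.
Lemma Re_M z w : Re (z * w) = Re z * Re w - Im z * Im w.
Proof. by case: z w => [? ?] []. Qed.
Lemma Im_M z w : Im (z * w) = Re z * Im w + Im z * Re w.
Proof. by case: z w => [? ?] []. Qed.
Lemma Re_real (x : R) : Re x%:C = x. Proof. by []. Qed.
Lemma Im_real (x : R) : Im x%:C = 0. Proof. by []. Qed.

Lemma imagE : ('i%R : C) = 0 +i* 1 :> C.
Proof. by rewrite -(complexiE R). Qed.

Lemma Re_imag : Re ('i%R : C) = 0. Proof. by rewrite imagE. Qed.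
Lemma Im_imag : Im ('i%R : C) = 1. Proof. by rewrite imagE. Qed.

Definition ReImE := (Re_D, Im_D, Re_N, Im_N, Re_M, Im_M, Re_J, Im_J,
  Re_real, Im_real, Re_imag, Im_imag).

Lemma eq_ReIm z w : Re z = Re w -> Im z = Im w -> z = w.
Proof. by case: z w => [a b] [c d] /= -> ->. Qed.

Lemma cmod_i : cmod ('i%R : C) = 1.
Proof. by rewrite imagE /cmod/= expr0n/= add0r expr1n sqrtr1. Qed.

Lemma Re_sum (I : Type) (s : seq I) (P : pred I) (F : I -> C) :
  Re (\sum_(i <- s | P i) F i) = \sum_(i <- s | P i) Re (F i).
Proof. by elim/big_ind2 : _ => // x1 x2 y1 y2 <- <-; rewrite Re_D. Qed.

Lemma cmod_sum (I : Type) (s : seq I) (P : pred I) (F : I -> C) :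
  cmod (\sum_(i <- s | P i) F i) <= \sum_(i <- s | P i) cmod (F i).
Proof.
elim/big_ind2 : _ => //; first by rewrite cmod0.
by move=> x1 x2 y1 y2 h1 h2; rewrite (le_trans (cmodD _ _))// lerD.
Qed.

Lemma ccontinuousP f : ccontinuous f <->
  forall x (eps : R), 0 < eps ->
    exists2 d, 0 < d & forall y, `|y - x| < d -> cmod (f y - f x) < eps.
Proof.
split.
  move=> [cR cI] x e e0; have e20 : 0 < e / 2 by rewrite divr_gt0.
  have /cvgrPdist_lt/(_ _ e20) := cR x; have /cvgrPdist_lt/(_ _ e20) := cI x.
  move=> /nbhs_ballP[d1 /= d10 h1] /nbhs_ballP[d2 /= d20 h2].
  exists (Num.min d1 d2); first by rewrite lt_min d10.
  move=> y; rewrite lt_min => /andP[yd1 yd2].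
  rewrite (le_lt_trans (cmod_le _))// (splitr e) ltrD//.
  - by rewrite !ReImE distrC; apply: h2; rewrite /ball/= distrC.
  - by rewrite !ReImE distrC; apply: h1; rewrite /ball/= distrC.
move=> h; split=> x; apply/cvgrPdist_lt => e e0; have [d d0 hd] := h x e e0;
  apply/nbhs_ballP; exists d => //= y; rewrite /ball/= distrC => /hd;
  apply: le_lt_trans => /=; rewrite distrC.
- by rewrite (le_trans _ (Re_le_cmod _))// !ReImE.
- by rewrite (le_trans _ (Im_le_cmod _))// !ReImE.
Qed.

Lemma ccontD f g : ccontinuous f -> ccontinuous g ->
  ccontinuous (fun x => f x + g x).
Proof.
move=> [f1 f2] [g1 g2]; split=> x.
- under eq_fun do rewrite Re_D. exact: cvgD (f1 x) (g1 x).
- under eq_fun do rewrite Im_D. exact: cvgD (f2 x) (g2 x).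
Qed.

Lemma ccontM f g : ccontinuous f -> ccontinuous g ->
  ccontinuous (fun x => f x * g x).
Proof.
move=> [f1 f2] [g1 g2]; split=> x.
- under eq_fun do rewrite Re_M.
  by apply: cvgB; apply: cvgM; [exact: f1|exact: g1|exact: f2|exact: g2].
- under eq_fun do rewrite Im_M.
  by apply: cvgD; apply: cvgM; [exact: f1|exact: g2|exact: f2|exact: g1].
Qed.

Lemma ccont_cst z : ccontinuous (fun=> z).
Proof. by split=> x; exact: cvg_cst. Qed.

Lemma ccontZ z f : ccontinuous f -> ccontinuous (fun x => z * f x).
Proof. by move=> ?; apply: ccontM => //; exact: ccont_cst. Qed.

Lemma ccontN f : ccontinuous f -> ccontinuous (fun x => - f x).
Proof.
move=> ?; rewrite (_ : (fun x => _) = (fun x => -1 * f x)); first exact: ccontZ.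
by apply/funext => x; rewrite mulN1r.
Qed.

Lemma ccontB f g : ccontinuous f -> ccontinuous g ->
  ccontinuous (fun x => f x - g x).
Proof. by move=> ? ?; apply: ccontD => //; exact: ccontN. Qed.

Lemma ccontJ f : ccontinuous f -> ccontinuous (fun x => (f x)^*%R).
Proof.
move=> [f1 f2]; split=> x.
- under eq_fun do rewrite Re_J. exact: f1.
- under eq_fun do rewrite Im_J. exact: (cvgN (f2 x)).
Qed.

Lemma ccont_sum (I : Type) (s : seq I) (F : I -> R -> C) :
  (forall i, ccontinuous (F i)) -> ccontinuous (fun x => \sum_(i <- s) F i x).
Proof.
move=> cF; elim: s => [|i s ih].
  by under eq_fun do rewrite big_nil; exact: ccont_cst.
by under eq_fun do rewrite big_cons; exact: ccontD.
Qed.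

Lemma ccont_unif f : (forall e : R, 0 < e ->
    exists g, ccontinuous g /\ forall x, cmod (f x - g x) <= e) ->
  ccontinuous f.
Proof.
move=> h; apply/ccontinuousP => x e e0.
have e40 : 0 < e / 4 by rewrite divr_gt0.
have [g [/ccontinuousP cg fg]] := h _ e40.
have [d d0 hd] := cg x _ e40; exists d => // y /hd gyx.
have -> : f y - f x = (f y - g y) + (g y - g x) + (g x - f x) by ring.
rewrite (le_lt_trans (cmodD _ _))//.
have := cmodD (f y - g y) (g y - g x); have := fg y; have := fg x.
rewrite cmod_distC => h1 h2 h3; lra.
Qed.

(** * Fourier modes *)

Definition mode (l : int) (x : R) : C := cos (l%:~R * x) +i* sin (l%:~R * x).

Lemma Re_mode l x : Re (mode l x) = cos (l%:~R * x). Proof. by []. Qed.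
Lemma Im_mode l x : Im (mode l x) = sin (l%:~R * x). Proof. by []. Qed.

Lemma intrC (l : int) : (l%:~R : C) = (l%:~R : R)%:C.
Proof. by rewrite rmorph_int. Qed.

Lemma cexp_imag (t : R) z : Re z = 0 -> Im z = t -> cexp z = cos t +i* sin t.
Proof. by case: z => a b /= -> ->; rewrite /cexp/= expR0 mul1r. Qed.

Lemma cexp_mode l x : cexp ('i%R * l%:~R * x%:C) = mode l x.
Proof.
by apply: cexp_imag; rewrite intrC !ReImE; ring.
Qed.

Lemma modeMx l x y : mode l (x + y) = mode l x * mode l y.
Proof.
apply: eq_ReIm; rewrite !ReImE ?Re_mode ?Im_mode mulrDr ?cosD ?sinD; ring.
Qed.

Lemma modeMl k l x : mode (k + l) x = mode k x * mode l x.
Proof.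
apply: eq_ReIm; rewrite !ReImE ?Re_mode ?Im_mode rmorphD/= mulrDl ?cosD ?sinD; ring.
Qed.

Lemma mode_conj l x : (mode l x)^*%R = mode (- l) x.
Proof.
by apply: eq_ReIm; rewrite ?ReImE ?Re_mode ?Im_mode rmorphN/= mulNr ?cosN ?sinN.
Qed.

Lemma cexp_modeN l x : cexp (- ('i%R * l%:~R * x%:C)) = mode (- l) x.
Proof.
by rewrite -cexp_mode rmorphN/= mulrN mulNr.
Qed.

Lemma mode0 x : mode 0 x = 1.
Proof. by apply: eq_ReIm; rewrite ?Re_mode ?Im_mode mulr0z mul0r ?cos0 ?sin0. Qed.

Lemma mode_at0 l : mode l 0 = 1.
Proof. by apply: eq_ReIm; rewrite ?Re_mode ?Im_mode mulr0 ?cos0 ?sin0. Qed.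

Lemma cmod_mode l x : cmod (mode l x) = 1.
Proof.
by rewrite /cmod Re_mode Im_mode cos2Dsin2 sqrtr1.
Qed.

Lemma cosD2pin (x : R) (n : nat) : cos (x + n%:R * (2 * pi)) = cos x /\ sin (x + n%:R * (2 * pi)) = sin x.
Proof.
elim: n x => [|n ih] x; first by rewrite mul0r addr0.
have -> : x + n.+1%:R * (2 * pi) = (x + n%:R * (2 * pi)) + pi + pi.
  by rewrite -natr1; ring.
by have [h1 h2] := ih x; rewrite !cosDpi !sinDpi !opprK.
Qed.

Lemma mode_period l x : mode l (x + 2 * pi) = mode l x.
Proof.
rewrite modeMx; suff -> : mode l (2 * pi) = 1 by rewrite mulr1.
have natmode n : mode n%:Z (2 * pi) = 1.
  have [h1 h2] := cosD2pin 0 n.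
  by apply: eq_ReIm; rewrite ?Re_mode ?Im_mode -[_ * _]add0r ?h1 ?h2 ?cos0 ?sin0.
by case: l => n //; rewrite NegzE -mode_conj natmode rmorph1.
Qed.

Lemma ccont_mode l : ccontinuous (mode l).
Proof.
split=> x.
- exact: (continuous_comp (@mulrl_continuous R l%:~R x) (@continuous_cos R _)).
- exact: (continuous_comp (@mulrl_continuous R l%:~R x) (@continuous_sin R _)).
Qed.

End ComplexToolkit.

(** * Means over a period and Fourier coefficients *)

Section FourierCoefficients.
Variable R : realType.
Local Notation C := R[i].
Local Notation Re := complex.Re.
Local Notation Im := complex.Im.
Local Notation mu := (@lebesgue_measure R).
Local Notation per := (`[0, 2 * pi]%classic : set R).
Implicit Types (z w : C) (f g : R -> C) (u v : R -> R).

Lemma twopi_gt0 : 0 < 2 * pi :> R.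
Proof. by rewrite mulr_gt0// pi_gt0. Qed.

Lemma cont_integrable u : continuous u -> mu.-integrable per (EFin \o u).
Proof.
move=> cu; apply: continuous_compact_integrable; first exact: segment_compact.
exact: continuous_subspaceT.
Qed.

Lemma mu_per : fine (mu per) = 2 * pi.
Proof. by rewrite lebesgue_measure_itv/= lte_fin twopi_gt0/= subr0. Qed.

Lemma Rint_sup u (K : R) : continuous u -> (forall x, `|u x| <= K) ->
  `|\int[mu]_(x in per) u x| <= K * (2 * pi).
Proof.
move=> cu uK; rewrite (le_trans (le_normr_Rintegral _ (cont_integrable cu)))//.
have -> : K * (2 * pi) = \int[mu]_(x in per) K by rewrite Rintegral_cst// mu_per.
apply: le_Rintegral => //.
- by apply: cont_integrable => x; apply: continuous_comp (cu x) _; exact: norm_continuous.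
- by apply: cont_integrable => x; exact: cvg_cst.
Qed.

Lemma Rint_FTC u (U : R -> R) : continuous u ->
  (forall x : R, is_derive x 1 U (u x)) ->
  \int[mu]_(x in per) u x = U (2 * pi) - U 0.
Proof.
move=> cu dU; rewrite /Rintegral (@continuous_FTC2 _ u U) ?twopi_gt0//.
- exact: continuous_subspaceT.
- have cU x : {for x, continuous U}.
    by apply/differentiable_continuous/derivable1_diffP; have [] := dU x.
  split.
  + by move=> x _; have [] := dU x.
  + exact: cvg_at_right_filter (cU 0).
  + exact: cvg_at_left_filter (cU (2 * pi)).
- by move=> x _; rewrite derive1E derive_val.
Qed.

Definition mean f : C := ((2 * pi)^-1)%:C * cint per f.

Lemma meanE f : mean f = ((2 * pi)^-1)%:C * cint per f.
Proof. by []. Qed.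

Lemma Re_mean f : Re (mean f) = (2 * pi)^-1 * \int[mu]_(x in per) Re (f x).
Proof. by rewrite /mean !ReImE/= mul0r subr0. Qed.

Lemma Im_mean f : Im (mean f) = (2 * pi)^-1 * \int[mu]_(x in per) Im (f x).
Proof. by rewrite /mean !ReImE/= mul0r addr0. Qed.

Lemma meanD f g : ccontinuous f -> ccontinuous g ->
  mean (fun x => f x + g x) = mean f + mean g.
Proof.
move=> [f1 f2] [g1 g2]; apply: eq_ReIm; rewrite ?Re_D ?Im_D !(Re_mean, Im_mean) -mulrDr;
  congr *%R; rewrite -RintegralD//; try exact: cont_integrable.
- by apply: eq_Rintegral => x _; rewrite ReImE.
- by apply: eq_Rintegral => x _; rewrite ReImE.
Qed.

Lemma meanZ z f : ccontinuous f -> mean (fun x => z * f x) = z * mean f.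
Proof.
move=> [f1 f2]; apply: eq_ReIm; rewrite [in RHS](Re_M, Im_M) !(Re_mean, Im_mean).
- rewrite !(mulrCA _ (2 * pi)^-1) -mulrBr; congr *%R.
  rewrite -!RintegralZl//; try exact: cont_integrable.
  rewrite -RintegralB//; last 2 first.
    by apply: cont_integrable => x; apply: cvgM; [exact: cvg_cst|exact: f1].
    by apply: cont_integrable => x; apply: cvgM; [exact: cvg_cst|exact: f2].
  by apply: eq_Rintegral => x _; rewrite ReImE.
- rewrite !(mulrCA _ (2 * pi)^-1) -mulrDr; congr *%R.
  rewrite -!RintegralZl//; try exact: cont_integrable.
  rewrite -RintegralD//; last 2 first.
    by apply: cont_integrable => x; apply: cvgM; [exact: cvg_cst|exact: f2].
    by apply: cont_integrable => x; apply: cvgM; [exact: cvg_cst|exact: f1].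
  by apply: eq_Rintegral => x _; rewrite ReImE.
Qed.

Lemma meanJ f : ccontinuous f -> mean (fun x => (f x)^*%R) = (mean f)^*%R.
Proof.
move=> [f1 f2]; apply: eq_ReIm; rewrite ?Re_J ?Im_J !(Re_mean, Im_mean).
- by congr *%R; apply: eq_Rintegral => x _; rewrite Re_J.
- transitivity ((2 * pi)^-1 * (-1 * \int[mu]_(x in per) Im (f x))); last by ring.
  rewrite -(RintegralZl _ _ (cont_integrable f2))//.
  by congr *%R; apply: eq_Rintegral => x _; rewrite Im_J mulN1r.
Qed.

Lemma mean_sum (I : Type) (s : seq I) (F : I -> R -> C) :
  (forall i, ccontinuous (F i)) ->
  mean (fun x => \sum_(i <- s) F i x) = \sum_(i <- s) mean (F i).
Proof.
move=> cF; elim: s => [|i s ih].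
  rewrite big_nil; under eq_fun do rewrite big_nil.
  apply: eq_ReIm; rewrite ?Re_mean ?Im_mean/= Rintegral_cst// mul0r mulr0//.
under eq_fun do rewrite big_cons.
by rewrite meanD ?ih ?big_cons//; exact: ccont_sum.
Qed.

(** The factor [2] comes from treating the real and the imaginary part
    separately; sharp constants are never needed. *)
Lemma mean_sup f (K : R) : ccontinuous f -> (forall x, cmod (f x) <= K) ->
  cmod (mean f) <= 2 * K.
Proof.
move=> [f1 f2] fK; rewrite (le_trans (cmod_le _))// Re_mean Im_mean.
rewrite !normrM -mulrDr ger0_norm ?invr_ge0 ?(ltW twopi_gt0)//.
rewrite ler_pdivrMl ?twopi_gt0//.
have -> : 2 * pi * (2 * K) = K * (2 * pi) + K * (2 * pi) by ring.
by rewrite lerD// Rint_sup// => x; rewrite (le_trans _ (fK x)) ?Re_le_cmod ?Im_le_cmod.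
Qed.

Lemma is_derive_lin (a x : R) : is_derive x 1 (fun y : R => a * y) a.
Proof.
have := @is_deriveZ R R R id a x 1 1 (is_derive_id _ _).
by rewrite /GRing.scale/= mulr1.
Qed.

Lemma is_derive_sin_lin (a x : R) :
  is_derive x 1 (fun y => sin (a * y)) (a * cos (a * x)).
Proof.
by rewrite mulrC; exact: is_derive1_comp (is_derive_sin _) (is_derive_lin a x).
Qed.

Lemma is_derive_cos_lin (a x : R) :
  is_derive x 1 (fun y => cos (a * y)) (- a * sin (a * x)).
Proof.
rewrite mulNr mulrC -mulNr.
exact: is_derive1_comp (is_derive_cos _) (is_derive_lin a x).
Qed.

Lemma mean_mode l : mean (mode l) = (l == 0)%:R.
Proof.
have [->|l0] := eqVneq l 0.
  rewrite (_ : mode 0 = fun=> 1); last by apply/funext => x; rewrite mode0.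
  apply: eq_ReIm; rewrite ?Re_mean ?Im_mean/= Rintegral_cst// ?mul0r ?mulr0// mu_per.
  by rewrite mul1r mulVf ?gt_eqF ?twopi_gt0.
have lR0 : (l%:~R : R) != 0 by rewrite intr_eq0.
have [c1 c2] := ccont_mode R l.
have hm x : cos (l%:~R * (x + 2 * pi)) = cos (l%:~R * x) /\
            sin (l%:~R * (x + 2 * pi)) = sin (l%:~R * x) :> R.
  by have [] := mode_period l x.
have [h1 h2] := hm 0; rewrite add0r in h1 h2.
apply: eq_ReIm; rewrite ?Re_mean ?Im_mean.
- have dU (x : R) : is_derive x 1 (fun x => l%:~R^-1 * sin (l%:~R * x)) (cos (l%:~R * x)).
    rewrite -[cos _](mulKf lR0).
    exact: (@is_deriveZ R R R _ l%:~R^-1 x 1 _ (is_derive_sin_lin l%:~R x)).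
  by rewrite (Rint_FTC c1 dU) h2 subrr mulr0.
- have dU (x : R) : is_derive x 1 (fun x => - l%:~R^-1 * cos (l%:~R * x)) (sin (l%:~R * x)).
    have -> : sin (l%:~R * x) = - l%:~R^-1 * (- l%:~R * sin (l%:~R * x)).
      by rewrite mulNr mulNr mulrN opprK mulKf.
    exact: (@is_deriveZ R R R _ (- l%:~R^-1) x 1 _ (is_derive_cos_lin l%:~R x)).
  by rewrite (Rint_FTC c2 dU) h1 subrr mulr0.
Qed.

Lemma fcoefE f l : fcoef f l = mean (fun x => f x * mode (- l) x).
Proof.
by rewrite /fcoef /mean; congr (_ * cint _ _); apply/funext => x; rewrite cexp_modeN.
Qed.

Lemma fcoefD f g l : ccontinuous f -> ccontinuous g ->
  fcoef (fun x => f x + g x) l = fcoef f l + fcoef g l.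
Proof.
move=> cf cg; rewrite !fcoefE -meanD; last 2 first.
- by apply: ccontM => //; exact: ccont_mode.
- by apply: ccontM => //; exact: ccont_mode.
by congr mean; apply/funext => x; rewrite mulrDl.
Qed.

Lemma fcoefZ z f l : ccontinuous f ->
  fcoef (fun x => z * f x) l = z * fcoef f l.
Proof.
move=> cf; rewrite !fcoefE -meanZ; last by apply: ccontM => //; exact: ccont_mode.
by congr mean; apply/funext => x; rewrite mulrA.
Qed.

Lemma fcoefB f g l : ccontinuous f -> ccontinuous g ->
  fcoef (fun x => f x - g x) l = fcoef f l - fcoef g l.
Proof.
move=> cf cg.
rewrite (_ : (fun x => _) = (fun x => f x + -1 * g x)); last first.
  by apply/funext => x; rewrite mulN1r.
by rewrite fcoefD ?fcoefZ ?mulN1r//; exact: ccontZ.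
Qed.

Lemma fcoefJ f l : ccontinuous f ->
  fcoef (fun x => (f x)^*%R) l = (fcoef f (- l))^*%R.
Proof.
move=> cf; rewrite !fcoefE -meanJ; last by apply: ccontM => //; exact: ccont_mode.
by congr mean; apply/funext => x; rewrite rmorphM/= mode_conj opprK.
Qed.

Lemma fcoef_modeM f k l : fcoef (fun x => mode k x * f x) l = fcoef f (l - k).
Proof.
rewrite !fcoefE; congr mean; apply/funext => x.
by rewrite opprB modeMl; ring.
Qed.

Lemma fcoef_mode k l : fcoef (mode k : R -> C) l = (k == l)%:R.
Proof.
rewrite fcoefE (_ : (fun x => _) = mode (k - l)); first by rewrite mean_mode subr_eq0.
by apply/funext => x; rewrite modeMl.
Qed.

Lemma fcoef_sum (I : Type) (s : seq I) (F : I -> R -> C) l :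
  (forall i, ccontinuous (F i)) ->
  fcoef (fun x => \sum_(i <- s) F i x) l = \sum_(i <- s) fcoef (F i) l.
Proof.
move=> cF; under [RHS]eq_bigr do rewrite fcoefE.
rewrite -mean_sum; last by move=> i; apply: ccontM => //; exact: ccont_mode.
by rewrite fcoefE; congr mean; apply/funext => x; rewrite mulr_suml.
Qed.

Lemma fcoef_sup f (K : R) l : ccontinuous f -> (forall x, cmod (f x) <= K) ->
  cmod (fcoef f l) <= 2 * K.
Proof.
move=> cf fK; rewrite fcoefE; apply: mean_sup.
- by apply: ccontM => //; exact: ccont_mode.
- by move=> x; rewrite cmodM cmod_mode mulr1.
Qed.

End FourierCoefficients.

(** * Uniqueness of Fourier coefficients *)

Section Uniqueness.
Variable R : realType.
Local Notation C := R[i].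
Local Notation Re := complex.Re.
Local Notation Im := complex.Im.
Local Notation mu := (@lebesgue_measure R).
Local Notation per := (`[0, 2 * pi]%classic : set R).
Implicit Types (f g : R -> C).

Lemma Rint_ge_step (h : R -> R) (K k a b : R) : continuous h ->
  0 <= a -> a <= b -> b <= 2 * pi ->
  (forall x, x \in `[a, b] -> k - K <= h x) ->
  (forall x, x \in `[0, 2 * pi] -> x \notin `[a, b] -> - K <= h x) ->
  k * (b - a) - K * (2 * pi) <= \int[mu]_(x in per) h x.
Proof.
move=> ch a0 ab b2 hin hout.
have iA : mu.-integrable per (EFin \o (\1_(`[a, b]%classic) : R -> R)).
  by apply: integrableS (integrable_indic_itv a b true false).
have iZ : mu.-integrable per (EFin \o (fun x => k * (\1_(`[a, b]%classic) x : R))).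
  exact: (integrableZl _ k iA).
have iK : mu.-integrable per (EFin \o (fun=> K)).
  by apply: cont_integrable => x; exact: cvg_cst.
have -> : k * (b - a) - K * (2 * pi) =
    \int[mu]_(x in per) (k * \1_(`[a, b]%classic) x - K).
  rewrite RintegralB// RintegralZl// Rintegral_cst// mu_per; congr (_ * _ - _).
  rewrite /Rintegral integral_indic// setIidl; last first.
    by apply: subset_itv; rewrite bnd_simp.
  have /= := @lebesgue_measure_itv R `[a, b]; rewrite lte_fin => muab.
  transitivity (fine (if (a < b)%R then b%:E - a%:E else 0)%E); last by rewrite -muab.
  by case: ltgtP ab => //= ->; rewrite subrr.
apply: le_Rintegral => //.
- exact: (integrableB _ iZ iK).
- exact: cont_integrable.
move=> x xper; rewrite indicE.
have [xab|xab] := boolP (x \in `[a, b]).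
  by rewrite mem_set// mulr1 hin.
by rewrite memNset ?mulr0 ?sub0r ?hout//; exact/negP.
Qed.

Lemma bernoulli (q : R) n : 1 <= q -> 1 + n%:R * (q - 1) <= q ^+ n.
Proof.
move=> q1; elim: n => [|n ih]; first by rewrite mul0r addr0 expr0.
rewrite exprS -natr1; have := ler_wpM2l (le_trans ler01 q1) ih.
apply: le_trans; have : 0 <= n%:R * (q - 1) ^+ 2 by rewrite mulr_ge0// sqr_ge0.
by rewrite expr2; nra.
Qed.

Definition peak (x0 d x : R) : R := 1 + cos (x - x0) - cos d.

(** Outside the interval [|x - x0| <= d] the powers of [peak x0 d] stay
    bounded, while near [x0] they grow geometrically: were [h x0] positive,
    the integrals against high powers could not vanish. *)
Lemma peak_vanishing (h : R -> R) (x0 : R) : continuous h -> 0 < x0 < 2 * pi ->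
  (forall d n, \int[mu]_(x in per) (h x * peak x0 d x ^+ n) = 0) -> h x0 <= 0.
Proof.
move=> ch /andP[x00 x02] h0; rewrite leNgt; apply/negP => c0.
have [d0 d00 hd0] : exists2 d, 0 < d & forall x, `|x - x0| < d -> h x0 / 2 < h x.
  have c20 : 0 < h x0 / 2 by rewrite divr_gt0.
  have /cvgrPdist_lt/(_ _ c20) := ch x0.
  move=> /nbhs_ballP[d /= dd hd]; exists d => // x xd.
  have /hd : ball x0 d x by rewrite /ball/= distrC.
  by rewrite ltr_norml => /andP[_]; lra.
have [K [K0 hK]] : exists K, 0 <= K /\ forall x, x \in `[0, 2 * pi] -> `|h x| <= K.
  have cn : {within `[0, 2 * pi], continuous (fun x => `|h x|)}.
    by apply: continuous_subspaceT => x; apply: continuous_comp (ch x) _; exact: norm_continuous.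
  have [c _ hc] := EVT_max (ltW (twopi_gt0 R)) cn.
  by exists `|h c|; split.
(* The interval must stay inside one period, where [x0] is the only peak. *)
pose d := Num.min (d0 / 2) (Num.min (x0 / 2) ((2 * pi - x0) / 2)).
have dpos : 0 < d by rewrite !lt_min !divr_gt0// subr_gt0.
have [dd0 dx0 d2x0] : [/\ d < d0, d < x0 & d < 2 * pi - x0].
  have : d <= d0 / 2 by rewrite ge_min lexx.
  have : d <= x0 / 2 by rewrite !ge_min lexx orbT.
  have : d <= (2 * pi - x0) / 2 by rewrite !ge_min lexx !orbT.
  by move=> h1 h2 h3; split; lra.
have dpi : d < pi by lra.
have cosle (y z : R) : 0 <= y -> y <= z -> z <= pi -> cos z <= cos y.
  move=> y0 yz zp; rewrite leNgt ltr_cos ?in_itv/= ?y0 ?(le_trans y0 yz)//.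
  - by rewrite -leNgt.
  - by rewrite (le_trans yz).
pose q := 1 + cos (d / 2) - cos d.
have q1 : 1 < q.
  rewrite /q -addrA ltrDl subr_gt0 ltr_cos ?in_itv/=; lra.
have key n : (h x0 / 2) * q ^+ n * d <= K * (2 * pi).
  rewrite -subr_le0 -(h0 d n).
  have := @Rint_ge_step (fun x => h x * peak x0 d x ^+ n) K ((h x0 / 2) * q ^+ n) (x0 - d / 2) (x0 + d / 2).
  rewrite (_ : x0 + d / 2 - (x0 - d / 2) = d); last by lra.
  apply.
  - move=> x; apply: cvgM; first exact: ch.
    apply: (@cvg_comp _ _ _ (peak x0 d) (fun y => y ^+ n)); last exact: exprn_continuous.
    apply: cvgB; last exact: cvg_cst.
    apply: cvgD; first exact: cvg_cst.
    apply: (@cvg_comp _ _ _ (fun x => x - x0) cos); last exact: continuous_cos.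
    by apply: cvgB; [exact: cvg_id|exact: cvg_cst].
  - lra.
  - lra.
  - lra.
  - move=> x; rewrite in_itv/= => /andP[xl xr].
    have xd : `|x - x0| <= d / 2 by rewrite ler_norml; apply/andP; split; lra.
    have hx : h x0 / 2 < h x by apply: hd0; lra.
    have qx : q <= peak x0 d x.
      by rewrite /q /peak -(cos_norm (x - x0)) lerD2r lerD2l cosle//; lra.
    rewrite lerBlDr (@le_trans _ _ (h x * peak x0 d x ^+ n))//; last by rewrite lerDl.
    rewrite ler_pM//; [lra|by rewrite exprn_ge0//; lra|exact: ltW|].
    by rewrite lerXn2r ?nnegrE//; lra.
  - move=> x; rewrite in_itv/= => /andP[xl xr] xout.
    have hKx := hK x _; rewrite in_itv/= xl xr/= in hKx.
    have {}hKx := hKx isT.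
    have [xd|xd] := leP `|x - x0| d.
      rewrite (@le_trans _ _ 0)// ?oppr_le0// mulr_ge0//.
        have /hd0 : `|x - x0| < d0 by lra.
        lra.
      rewrite exprn_ge0// /peak -(cos_norm (x - x0)).
      have : cos d <= cos `|x - x0| by apply: cosle => //; lra.
      lra.
    have cx : cos (x - x0) <= cos d.
      rewrite -(cos_norm (x - x0)).
      have [xpi|xpi] := leP `|x - x0| pi; first by apply: cosle; lra.
      have -> : cos `|x - x0| = cos (2 * pi - `|x - x0|).
        by rewrite -cosN -(cosD2pi (- _)) mulr_natl addrC.
      have : `|x - x0| < 2 * pi - d by rewrite ltr_norml; apply/andP; split; lra.
      by move=> ?; apply: cosle; lra.
    have pk : `|peak x0 d x| <= 1.
      rewrite ler_norml /peak; have := cos_geN1 (x - x0); have := cos_le1 d.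
      by move=> ? ?; apply/andP; split; lra.
    have : `|h x * peak x0 d x ^+ n| <= K.
      rewrite normrM normrX -[leRHS]mulr1 ler_pM// exprn_ile1//.
    by rewrite ler_norml => /andP[].
have a0 : 0 < h x0 / 2 * d by rewrite mulr_gt0// divr_gt0.
have b0 : 0 < h x0 / 2 * d * (q - 1) by rewrite mulr_gt0// subr_gt0.
pose n := (Num.truncn (K * (2 * pi) / (h x0 / 2 * d * (q - 1)))).+1.
have := key n; apply/negP; rewrite -ltNge mulrAC.
apply: lt_le_trans (ler_wpM2l (ltW a0) (bernoulli n (ltW q1))).
have : K * (2 * pi) < n%:R * (h x0 / 2 * d * (q - 1)).
  by rewrite -ltr_pdivrMr//; exact: truncnS_gt.
by move: a0; nra.
Qed.

Definition trig_poly (p : R -> C) := exists s : seq (C * int),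
  p = fun x => \sum_(z <- s) z.1 * mode z.2 x.

Lemma trig_polyM p1 p2 : trig_poly p1 -> trig_poly p2 ->
  trig_poly (fun x => p1 x * p2 x).
Proof.
move=> [s1 ->] [s2 ->].
exists [seq (z.1 * y.1, z.2 + y.2) | z <- s1, y <- s2].
apply/funext => x; rewrite big_allpairs_dep/= mulr_suml; apply: eq_bigr => z _.
by rewrite mulr_sumr; apply: eq_bigr => y _/=; rewrite modeMl; ring.
Qed.

Lemma trig_poly_peak x0 d n : trig_poly (fun x => (peak x0 d x)%:C ^+ n).
Proof.
elim: n => [|n ih].
  exists [:: (1, 0)]; apply/funext => x.
  by rewrite big_seq1/= mode0 expr0 mulr1.
rewrite (_ : (fun x => _) = (fun x => (peak x0 d x)%:C * (peak x0 d x)%:C ^+ n)); last first.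
  by apply/funext => x; rewrite exprS.
apply: trig_polyM ih.
exists [:: ((1 - cos d)%:C, 0); (2^-1%:C * mode (- 1) x0, 1); (2^-1%:C * mode 1 x0, -1)].
apply/funext => x; rewrite !big_cons big_nil/= mode0.
by apply: eq_ReIm; rewrite !ReImE ?Re_mode ?Im_mode /peak ?mulN1r ?mulNr !mul1r ?cosN ?sinN ?cosB; lra.
Qed.

Lemma mean_trig_poly f p : ccontinuous f -> (forall l, fcoef f l = 0) ->
  trig_poly p -> mean (fun x => f x * p x) = 0.
Proof.
move=> cf f0 [s ->].
rewrite (_ : (fun x => _) = fun x => \sum_(z <- s) z.1 * (f x * mode z.2 x)); last first.
  by apply/funext => x; rewrite mulr_sumr; apply: eq_bigr => z _; ring.
rewrite mean_sum; last first.
  by move=> z; apply: ccontZ; apply: ccontM => //; exact: ccont_mode.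
rewrite big1// => z _; rewrite meanZ; last by apply: ccontM => //; exact: ccont_mode.
by have := f0 (- z.2); rewrite fcoefE opprK => ->; rewrite mulr0.
Qed.

Lemma Re_vanish f : ccontinuous f -> (forall l, fcoef f l = 0) ->
  forall x0, 0 < x0 < 2 * pi -> Re (f x0) <= 0.
Proof.
move=> cf f0 x0 x0i; apply: (@peak_vanishing (fun x => Re (f x))) => //; first by case: cf.
move=> d n; have := mean_trig_poly cf f0 (trig_poly_peak x0 d n).
move=> /(congr1 (@complex.Re R)); rewrite Re_mean/= => /eqP; rewrite mulf_eq0 invr_eq0 gt_eqF ?twopi_gt0//=.
move=> /eqP hp; rewrite -[RHS]hp; apply: eq_Rintegral => x _.
by rewrite -rmorphXn/= ReImE Re_real Im_real mulr0 subr0.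
Qed.

(** Vanishing coefficients annihilate every trigonometric polynomial, in
    particular the powers of the peaks. Applied to the multiples of [f] by the
    fourth roots of unity, this controls both signs of its real and imaginary
    parts. *)
Lemma fcoef_eq0 f : ccontinuous f -> periodic2pi f ->
  (forall l, fcoef f l = 0) -> forall x, f x = 0.
Proof.
move=> cf pf f0.
have Z z x0 : 0 < x0 < 2 * pi -> Re (z * f x0) <= 0.
  apply: (@Re_vanish (fun x => z * f x)); first exact: ccontZ.
  by move=> l; rewrite fcoefZ// f0 mulr0.
have f00 x0 : 0 < x0 < 2 * pi -> f x0 = 0.
  move=> x0i; have := Z 1 _ x0i; have := Z (-1) _ x0i.
  have := Z 'i%R _ x0i; have := Z (- 'i%R) _ x0i.
  rewrite mul1r mulN1r mulNr !ReImE !mul0r !mul1r => h1 h2 h3 h4.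
  by apply: eq_ReIm => /=; lra.
have f0_0 : f 0 = 0.
  apply: cmod_eq0; apply/eqP; rewrite eq_le cmod_ge0 andbT leNgt; apply/negP => c0.
  move/ccontinuousP : cf => /(_ 0 _ c0)[d d0 hd].
  pose y := Num.min (d / 2) pi.
  have y0 : 0 < y by rewrite lt_min divr_gt0//= pi_gt0.
  have : `|y - 0| < d.
    by rewrite subr0 gtr0_norm// gt_min; apply/orP; left; lra.
  move=> /hd; rewrite f00 ?sub0r ?cmodN ?ltxx// y0/= gt_min; apply/orP; right.
  by have := pi_gt0 R; lra.
have fn n x : f (x + n%:R * (2 * pi)) = f x.
  elim: n => [|n ih]; first by rewrite mul0r addr0.
  by rewrite -natr1 mulrDl mul1r addrA pf.
have fpos x : 0 <= x -> f x = 0.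
  move=> x0; pose n := Num.truncn (x / (2 * pi)).
  have tp := twopi_gt0 R.
  have /andP[n1 n2] : n%:R <= x / (2 * pi) < n.+1%:R.
    by apply: truncn_itv; rewrite divr_ge0// ltW.
  rewrite ler_pdivlMr// in n1; rewrite ltr_pdivrMr// in n2.
  rewrite -(subrK (n%:R * (2 * pi)) x) fn.
  have : 0 <= x - n%:R * (2 * pi) by rewrite subr_ge0.
  rewrite le_eqVlt => /predU1P[<-//|h]; apply: f00; rewrite h/=.
  by move: n2; rewrite -natr1; lra.
move=> x; have [|x0] := leP 0 x; first exact: fpos.
pose n := (Num.truncn (- x / (2 * pi))).+1.
rewrite -(fn n); apply: fpos.
have : - x / (2 * pi) < n%:R by exact: truncnS_gt.
by rewrite ltr_pdivrMr ?twopi_gt0//; lra.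
Qed.

End Uniqueness.

(** * Fourier series with summable coefficients *)

Section Series.
Variable R : realType.
Local Notation C := R[i].
Local Notation Re := complex.Re.
Local Notation Im := complex.Im.
Implicit Types (f g : R -> C) (a b : int -> C) (t : seq int).

(** The frequencies of a symmetric partial sum, as a sequence: sums over
    arbitrary finite sets of frequencies can then be compared with it by
    inclusion. *)
Definition window (N : nat) : seq int :=
  locked [seq k%:Z - N%:Z | k <- iota 0 N.*2.+1].

Lemma mem_window N l : (l \in window N) = (`|l| <= N)%N.
Proof.
rewrite /window -lock; apply/mapP/idP => [[k]|lN].
  by rewrite mem_iota => /andP[_ h] ->; lia.
exists (absz (l + N%:Z)); last by lia.
by rewrite mem_iota; lia.
Qed.

Lemma uniq_window N : uniq (window N).
Proof. by rewrite /window -lock map_inj_uniq ?iota_uniq// => k1 k2 h; lia. Qed.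

Lemma sub_window t : exists N, {subset t <= window N}.
Proof.
elim: t => [|l t [N hN]]; first by exists 0%N.
exists (maxn N `|l|%N) => k; rewrite inE mem_window => /predU1P[->|/hN].
  by rewrite leq_maxr.
by rewrite mem_window => /leq_trans; apply; rewrite leq_maxl.
Qed.

Lemma le_sum_subset (F : int -> R) t1 t2 : (forall l, 0 <= F l) ->
  uniq t1 -> uniq t2 -> {subset t1 <= t2} ->
  \sum_(l <- t1) F l <= \sum_(l <- t2) F l.
Proof.
move=> F0 u1 u2 s12.
rewrite (perm_big [seq l <- t2 | l \in t1]) /=; last first.
  apply: uniq_perm => //; first exact: filter_uniq.
  by move=> l; rewrite mem_filter/=; case: (boolP (l \in t1)) => // /s12 ->.
by rewrite big_filter [leRHS](bigID (fun l => l \in t1))/= lerDl sumr_ge0.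
Qed.

Lemma window_sumS (V : nmodType) (F : int -> V) N :
  \sum_(l <- window N.+1) F l =
  F N.+1%:Z + (F (- N.+1%:Z) + \sum_(l <- window N) F l).
Proof.
transitivity (\sum_(l <- [:: N.+1%:Z, - N.+1%:Z & window N]) F l); last by rewrite !big_cons.
apply: perm_big; apply: uniq_perm.
- exact: uniq_window.
- rewrite 2!cons_uniq in_cons 2!mem_window uniq_window; lia.
- move=> l; rewrite mem_window 2!in_cons mem_window; lia.
Qed.

Lemma window_sum_split (V : nmodType) (F : int -> V) N M : (N <= M)%N ->
  \sum_(l <- window M) F l = \sum_(l <- window N) F l +
    \sum_(l <- [seq l <- window M | l \notin window N]) F l.
Proof.
move=> NM; rewrite (bigID (fun l => l \in window N)) /= big_filter; congr +%R.
rewrite -big_filter; apply: perm_big; apply: uniq_perm.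
- exact/filter_uniq/uniq_window.
- exact: uniq_window.
- by move=> l; rewrite mem_filter !mem_window; lia.
Qed.

Lemma csumZ_window (a : int -> C) N :
  \sum_(k < N.*2.+1) a (k%:Z - N%:Z) = \sum_(l <- window N) a l.
Proof. by rewrite /window -lock big_map -(big_mkord xpredT (fun k => a (k%:Z - N%:Z))) /index_iota subn0. Qed.

Lemma csumZE a : csumZ a =
  limn (fun N => Re (\sum_(l <- window N) a l)) +i*
  limn (fun N => Im (\sum_(l <- window N) a l)).
Proof.
pose L (S : nat -> C) := limn (fun N => Re (S N)) +i* limn (fun N => Im (S N)).
transitivity (L (fun N => \sum_(k < N.*2.+1) a (k%:Z - N%:Z))) => //.
by congr L; apply/funext => N; rewrite csumZ_window.
Qed.

(** Absolute summability, tested on all finite sets so that no ordering of the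
    frequencies has to be chosen. *)
Definition abs_sum (a : int -> C) (S : R) :=
  forall t, uniq t -> \sum_(l <- t) cmod (a l) <= S.

Lemma abs_sum_le a b (K S : R) : 0 <= K -> abs_sum a S ->
  (forall l, cmod (b l) <= K * cmod (a l)) -> abs_sum b (K * S).
Proof.
move=> K0 aS ba t ut; apply: (@le_trans _ _ (\sum_(l <- t) K * cmod (a l))).
  exact: ler_sum.
by rewrite -mulr_sumr ler_wpM2l ?aS.
Qed.

(** The supremum of the finite sums is almost attained on one finite set, and
    what lies outside that set is then small. *)
Lemma abs_sum_tail a S : abs_sum a S -> forall e : R, 0 < e ->
  exists N, forall t, uniq t -> (forall l, l \in t -> (N < `|l|)%N) ->
    \sum_(l <- t) cmod (a l) <= e.
Proof.
move=> aS e e0.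
pose X : set R := [set \sum_(l <- t) cmod (a l) | t in [set t | uniq t]].
have X0 : has_sup X.
  by split; [exists 0, [::] => //; rewrite big_nil|exists S => _ [t ut <-]; exact: aS].
have [_ [t0 ut0 <-] ht0] := sup_adherent e0 X0.
have [N hN] := sub_window t0; exists N => t ut tN.
have u : uniq (t0 ++ t).
  rewrite cat_uniq ut0 ut andbT/=; apply/hasPn => l /tN lN.
  by apply/negP => /hN; rewrite mem_window leqNgt lN.
have : \sum_(l <- t0 ++ t) cmod (a l) <= sup X by apply: ub_le_sup; [case: X0|exists (t0 ++ t)].
by rewrite big_cat/=; move: ht0; lra.
Qed.

Lemma cauchy_seq_cvg (u : nat -> R) :
  (forall e, 0 < e -> exists N, forall n, (N <= n)%N -> `|u N - u n| <= e) -> cvgn u.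
Proof.
move=> h; apply/cauchy_cvgP/cauchy_exP => e e0.
have [N hN] := h _ (divr_gt0 e0 (ltr0Sn R 1)).
exists (u N); exists N => // n /= /hN un; rewrite /ball/=.
by apply: le_lt_trans un _; lra.
Qed.

Lemma cvg_seq_dist (u : nat -> R) (z e : R) : cvgn u ->
  (\forall n \near \oo, `|z - u n| <= e) -> `|z - limn u| <= e.
Proof.
move=> cu h; have hc : (fun n => `|z - u n|) @ \oo --> `|z - limn u|.
  by apply: cvg_norm; apply: cvgB => //; exact: cvg_cst.
by rewrite -(cvg_lim _ hc)//; apply: limr_le => //; apply/cvg_ex; eexists; exact: hc.
Qed.

Lemma csumZ_approx a S : abs_sum a S -> forall e : R, 0 < e ->
  exists N0, forall N, (N0 <= N)%N ->
    cmod (csumZ a - \sum_(l <- window N) a l) <= e.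
Proof.
move=> aS; have tail e : 0 < e -> exists N0, forall N M, (N0 <= N)%N -> (N <= M)%N ->
    cmod (\sum_(l <- window N) a l - \sum_(l <- window M) a l) <= e.
  move=> e0; have [N0 hN0] := abs_sum_tail aS e0; exists N0 => N M N0N NM.
  rewrite cmod_distC (_ : \sum_(l <- window M) a l =
    \sum_(l <- window N) a l + \sum_(l <- [seq l <- window M | l \notin window N]) a l); last first.
    exact: window_sum_split.
  rewrite addrAC subrr add0r (le_trans (cmod_sum _ _ _))// hN0//.
    exact/filter_uniq/uniq_window.
  by move=> l; rewrite mem_filter/= mem_window; lia.
have cR : cvgn (fun N => Re (\sum_(l <- window N) a l)).
  apply: cauchy_seq_cvg => e /tail[N0 h]; exists N0 => n n0.
  by rewrite (le_trans _ (h _ _ (leqnn _) n0))// -Re_N -Re_D Re_le_cmod.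
have cI : cvgn (fun N => Im (\sum_(l <- window N) a l)).
  apply: cauchy_seq_cvg => e /tail[N0 h]; exists N0 => n n0.
  by rewrite (le_trans _ (h _ _ (leqnn _) n0))// -Im_N -Im_D Im_le_cmod.
move=> e e0; have e20 : 0 < e / 2 by lra.
have [N0 h] := tail _ e20; exists N0 => N N0N.
rewrite csumZE.
rewrite (le_trans (cmod_le _))// !(Re_D, Im_D, Re_N, Im_N)/= (splitr e) lerD//.
- rewrite distrC; apply: cvg_seq_dist => //; exists N => // n /= Nn.
  by rewrite (le_trans _ (h _ _ N0N Nn))// -Re_N -Re_D Re_le_cmod.
- rewrite distrC; apply: cvg_seq_dist => //; exists N => // n /= Nn.
  by rewrite (le_trans _ (h _ _ N0N Nn))// -Im_N -Im_D Im_le_cmod.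
Qed.

Lemma le_of_eps (x y : R) : (forall e, 0 < e -> x <= y + e) -> x <= y.
Proof. by move=> h; apply/ler_addgt0Pr. Qed.

Lemma csumZ_bound a S : abs_sum a S -> cmod (csumZ a) <= S.
Proof.
move=> aS; apply: le_of_eps => e e0; have [N0 /(_ _ (leqnn _)) h] := csumZ_approx aS e0.
rewrite -(subrK (\sum_(l <- window N0) a l) (csumZ a)) addrC (le_trans (cmodD _ _))//.
rewrite addrC [leRHS]addrC lerD// (le_trans (cmod_sum _ _ _))//.
by rewrite aS// uniq_window.
Qed.

Definition synth a : R -> C := fun x => csumZ (fun l => a l * mode l x).

Lemma cmod_a_mode a l x : cmod (a l * mode l x) = cmod (a l).
Proof. by rewrite cmodM cmod_mode mulr1. Qed.

Lemma abs_sum_mode a S x : abs_sum a S -> abs_sum (fun l => a l * mode l x) S.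
Proof. by move=> h t /h; under [X in _ -> X <= _]eq_bigr do rewrite cmod_a_mode. Qed.

Definition partial_sum a N : R -> C := fun x => \sum_(l <- window N) a l * mode l x.

Lemma synth_approx a S : abs_sum a S -> forall e : R, 0 < e ->
  exists N0, forall N, (N0 <= N)%N -> forall x,
    cmod (synth a x - partial_sum a N x) <= e.
Proof.
move=> aS e e0; have [N0 h0] := abs_sum_tail aS e0; exists N0 => N N0N x.
apply: le_of_eps => d d0.
have [N1 h1] := csumZ_approx (abs_sum_mode x aS) d0.
have {}h1 := h1 _ (leq_maxl N1 N); set M := maxn N1 N in h1.
have NM : (N <= M)%N by rewrite leq_maxr.
rewrite /partial_sum -/(synth a x).
have -> : synth a x - \sum_(l <- window N) a l * mode l x =
  (\sum_(l <- window M) a l * mode l x - \sum_(l <- window N) a l * mode l x) +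
  (synth a x - \sum_(l <- window M) a l * mode l x) by ring.
rewrite (le_trans (cmodD _ _))// lerD//.
rewrite (_ : \sum_(l <- window M) a l * mode l x =
    \sum_(l <- window N) a l * mode l x +
    \sum_(l <- [seq l <- window M | l \notin window N]) a l * mode l x); last first.
  exact: window_sum_split.
rewrite addrAC subrr add0r (le_trans (cmod_sum _ _ _))//.
under eq_bigr do rewrite cmod_a_mode.
rewrite h0//; first exact/filter_uniq/uniq_window.
by move=> l; rewrite mem_filter/= mem_window; lia.
Qed.

Lemma ccont_partial_sum a N : ccontinuous (partial_sum a N).
Proof. by apply: ccont_sum => l; apply/ccontZ/ccont_mode. Qed.

Lemma ccont_synth a S : abs_sum a S -> ccontinuous (synth a).
Proof.
move=> aS; apply: (ccont_unif) => e e0.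
have [N hN] := synth_approx aS e0; exists (partial_sum a N).
by split; [exact: ccont_partial_sum|exact: hN].
Qed.

Lemma synth_period a : periodic2pi (synth a).
Proof. by move=> x; rewrite /synth; under eq_fun do rewrite mode_period. Qed.

Lemma synth_bound a S x : abs_sum a S -> cmod (synth a x) <= S.
Proof. by move=> aS; exact/csumZ_bound/abs_sum_mode. Qed.

Lemma fcoef_partial_sum a N l : (`|l| <= N)%N -> fcoef (partial_sum a N) l = a l.
Proof.
move=> lN; rewrite fcoef_sum; last by move=> k; apply/ccontZ/ccont_mode.
under eq_bigr do rewrite (fcoefZ _ _ (@ccont_mode R _)) fcoef_mode.
rewrite (big_rem l) ?mem_window//= eqxx mulr1 big1_seq ?addr0// => k /andP[_].
rewrite mem_rem_uniq ?uniq_window// inE => /andP[/negbTE -> _].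
exact: mulr0.
Qed.

Lemma fcoef_synth a S l : abs_sum a S -> fcoef (synth a) l = a l.
Proof.
move=> aS; apply/eqP; rewrite -subr_eq0; apply/eqP/cmod_eq0/eqP.
rewrite eq_le cmod_ge0 andbT; apply: le_of_eps => e e0; rewrite add0r.
have e20 : 0 < e / 2 by lra.
have [N0 h0] := synth_approx aS e20.
have {}h0 := h0 _ (leq_maxl N0 `|l|%N).
rewrite -(fcoef_partial_sum a (leq_maxr N0 `|l|%N)) -fcoefB.
- rewrite (le_trans (fcoef_sup _ _ h0)) //.
    by apply: ccontB; [exact: ccont_synth aS|exact: ccont_partial_sum].
  by lra.
- exact: ccont_synth aS.
- exact: ccont_partial_sum.
Qed.

Lemma synth_fcoef f S : ccontinuous f -> periodic2pi f -> abs_sum (fcoef f) S ->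
  synth (fcoef f) = f.
Proof.
move=> cf pf aS; apply/funext => x; apply/eqP; rewrite -subr_eq0; apply/eqP.
apply: (@fcoef_eq0 _ (fun x => synth (fcoef f) x - f x)).
- by apply: ccontB => //; exact: ccont_synth aS.
- by move=> y /=; rewrite pf synth_period.
- move=> l; rewrite fcoefB//; last exact: ccont_synth aS.
  by rewrite (fcoef_synth _ aS) subrr.
Qed.

Lemma fmultE (m : int -> C) f : fmult m f = synth (fun l => m l * fcoef f l).
Proof.
by apply/funext => x; rewrite /fmult /synth; congr csumZ; apply/funext => l; rewrite cexp_mode.
Qed.

Definition shift (h : R) f : R -> C := fun x => f (x + h).

Lemma shift_synth a h : shift h (synth a) = synth (fun l => mode l h * a l).
Proof.
apply/funext => x; rewrite /shift /synth; congr csumZ; apply/funext => l.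
by rewrite modeMx; ring.
Qed.

End Series.

(** * Weighted square-summable coefficients *)

Section Weights.
Variable R : realType.
Local Notation C := R[i].
Implicit Types (a b : int -> C) (t : seq int) (s : R) (x y : int -> R).

Lemma cauchy_schwarz (I : Type) (t : seq I) (x y : I -> R) :
  (\sum_(i <- t) x i * y i) ^+ 2 <=
  (\sum_(i <- t) x i ^+ 2) * (\sum_(i <- t) y i ^+ 2).
Proof.
elim: t => [|i t ih]; first by rewrite !big_nil mul0r expr0n.
rewrite !big_cons.
have : 0 <= \sum_(j <- t) x j ^+ 2 by apply: sumr_ge0 => j _; exact: sqr_ge0.
have : 0 <= \sum_(j <- t) y j ^+ 2 by apply: sumr_ge0 => j _; exact: sqr_ge0.
move: ih; set A := \sum_(j <- t) x j ^+ 2; set B := \sum_(j <- t) y j ^+ 2.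
set S := \sum_(_ <- _) _ * _; set u := x i; set v := y i => ih B0 A0.
suff : 2 * (S * (u * v)) <= A * v ^+ 2 + B * u ^+ 2 by move: ih; nra.
have P0 : 0 <= A * v ^+ 2 + B * u ^+ 2 by rewrite addr_ge0// mulr_ge0// sqr_ge0.
apply: le_trans (ler_norm _) _; rewrite -ler_sqr ?nnegrE// real_normK ?num_real//.
have : 4 * (u * v) ^+ 2 * S ^+ 2 <= 4 * (u * v) ^+ 2 * (A * B).
  by rewrite ler_wpM2l// mulr_ge0// sqr_ge0.
have : 0 <= (A * v ^+ 2 - B * u ^+ 2) ^+ 2 by exact: sqr_ge0.
by nra.
Qed.

Definition n2 t x : R := Num.sqrt (\sum_(l <- t) x l ^+ 2).

Lemma n2_ge0 t x : 0 <= n2 t x. Proof. exact: sqrtr_ge0. Qed.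

Lemma n2_sqr t x : n2 t x ^+ 2 = \sum_(l <- t) x l ^+ 2.
Proof. by rewrite sqr_sqrtr// sumr_ge0// => l _; exact: sqr_ge0. Qed.

Lemma n2_leP t x (B : R) : 0 <= B ->
  (n2 t x <= B) = (\sum_(l <- t) x l ^+ 2 <= B ^+ 2).
Proof. by move=> B0; rewrite -n2_sqr ler_sqr ?nnegrE ?n2_ge0. Qed.

Lemma n2_sum t x y : \sum_(l <- t) x l * y l <= n2 t x * n2 t y.
Proof.
apply: le_trans (ler_norm _) _.
rewrite -ler_sqr ?nnegrE ?mulr_ge0 ?n2_ge0// real_normK ?num_real// exprMn !n2_sqr.
exact: cauchy_schwarz.
Qed.

Lemma n2D t x y : n2 t (fun l => x l + y l) <= n2 t x + n2 t y.
Proof.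
rewrite n2_leP ?addr_ge0 ?n2_ge0// sqrrD !n2_sqr.
under eq_bigr do rewrite sqrrD; rewrite !big_split/= lerD2r lerD2l.
by rewrite mulr2n lerD// n2_sum.
Qed.

Lemma n2_le t x y : (forall l, l \in t -> `|x l| <= y l) -> n2 t x <= n2 t y.
Proof.
move=> xy; rewrite n2_leP ?n2_ge0// n2_sqr big_seq [leRHS]big_seq.
apply: ler_sum => l /xy h; rewrite -(real_normK (num_real (x l))).
by rewrite ler_sqr ?nnegrE// (le_trans _ h).
Qed.

Lemma n2Z t (k : R) x : 0 <= k -> n2 t (fun l => k * x l) = k * n2 t x.
Proof.
move=> k0; rewrite /n2; under eq_bigr do rewrite exprMn.
by rewrite -mulr_sumr sqrtrM ?sqr_ge0// sqrtr_sqr ger0_norm.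
Qed.

Lemma n2_le_sum t x : (forall l, 0 <= x l) -> n2 t x <= \sum_(l <- t) x l.
Proof.
move=> x0; elim: t => [|l t ih]; first by rewrite /n2 !big_nil sqrtr0.
have S0 : 0 <= \sum_(j <- t) x j by rewrite sumr_ge0.
rewrite n2_leP ?big_cons ?addr_ge0// -n2_sqr.
have := n2_ge0 t x; have := x0 l; move: ih S0.
set n := n2 t x; set S := \sum_(j <- t) x j; set v := x l => ih S0 v0 n0.
have : n ^+ 2 <= S ^+ 2 by rewrite ler_sqr ?nnegrE.
by nra.
Qed.

(** The square root of the weight of the Sobolev norm. *)
Definition wh s (l : int) : R := (1 + (l%:~R : R) ^+ 2) `^ (s / 2).

Lemma wbase_ge1 (l : int) : 1 <= 1 + (l%:~R : R) ^+ 2.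
Proof. by rewrite lerDl sqr_ge0. Qed.

Lemma wbase_gt0 (l : int) : 0 < 1 + (l%:~R : R) ^+ 2.
Proof. exact: lt_le_trans ltr01 (wbase_ge1 l). Qed.

Lemma wbase_neq0 (l : int) : 1 + (l%:~R : R) ^+ 2 != 0.
Proof. by rewrite gt_eqF// wbase_gt0. Qed.

Lemma wh_gt0 s l : 0 < wh s l.
Proof. by rewrite powR_gt0// wbase_gt0. Qed.

Lemma wh_ge0 s l : 0 <= wh s l. Proof. exact/ltW/wh_gt0. Qed.

Lemma wh_sqr s l : wh s l ^+ 2 = (1 + (l%:~R : R) ^+ 2) `^ s.
Proof.
rewrite expr2 /wh -powRD; last by rewrite wbase_neq0 implybT.
by congr (_ `^ _); lra.
Qed.

Lemma wh_le s s' l : s <= s' -> wh s l <= wh s' l.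
Proof. by move=> ss; rewrite ler_powR ?wbase_ge1// ler_pM2r// invr_gt0. Qed.

Lemma whD s s' l : wh (s + s') l = wh s l * wh s' l.
Proof.
rewrite /wh -powRD; last by rewrite wbase_neq0 implybT.
by rewrite mulrDl.
Qed.

Lemma wh1 l : `|l%:~R : R| <= wh 1 l.
Proof.
rewrite /wh mul1r powR12_sqrt; last exact/ltW/wbase_gt0.
rewrite -[leLHS]sqrtr_sqr ler_wsqrtr//.
by rewrite lerDr.
Qed.

(** Weighted square-summability, tested on finite sets of frequencies so that
    no series has to be formed. *)
Definition l2b s (B : R) a := 0 <= B /\
  forall t, uniq t -> n2 t (fun l => wh s l * cmod (a l)) <= B.

Lemma l2b_le s B B' a : B <= B' -> l2b s B a -> l2b s B' a.
Proof.
move=> BB [B0 h]; split; first exact: le_trans BB.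
by move=> t /h /le_trans; apply.
Qed.

Lemma l2bD s A B a b : l2b s A a -> l2b s B b -> l2b s (A + B) (fun l => a l + b l).
Proof.
move=> [A0 ha] [B0 hb]; split; first exact: addr_ge0.
move=> t ut; apply: le_trans (lerD (ha t ut) (hb t ut)).
apply: le_trans (n2D _ _ _); apply: n2_le => l _.
by rewrite ger0_norm ?mulr_ge0 ?wh_ge0 ?cmod_ge0// -mulrDr ler_wpM2l ?wh_ge0// cmodD.
Qed.

Lemma l2bM s s' (k B : R) a b : 0 <= k -> l2b s B a ->
  (forall l, wh s' l * cmod (b l) <= k * (wh s l * cmod (a l))) -> l2b s' (k * B) b.
Proof.
move=> k0 [B0 ha] h; split; first exact: mulr_ge0.
move=> t ut; apply: le_trans (ler_wpM2l k0 (ha t ut)); rewrite -n2Z//.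
by apply: n2_le => l _; rewrite ger0_norm ?mulr_ge0 ?wh_ge0 ?cmod_ge0.
Qed.

Lemma l2b_eq s B a b : (forall l, cmod (a l) = cmod (b l)) -> l2b s B a -> l2b s B b.
Proof.
move=> ab ha; rewrite -[B]mul1r; apply: (l2bM ler01 ha) => l.
by rewrite mul1r ab.
Qed.

Lemma l2bN s B a : l2b s B a -> l2b s B (fun l => a (- l)).
Proof.
move=> [B0 ha]; split=> // t ut.
have := ha (map (fun l => - l) t); rewrite (map_inj_uniq (@oppr_inj int)).
move=> /(_ ut); rewrite /n2 big_map; apply: le_trans.
rewrite (eq_bigr (fun l => (wh s (- l) * cmod (a (- l))) ^+ 2))// => l _.
by rewrite /wh rmorphN/= sqrrN.
Qed.

(** The right-hand side is three central terms plus the integral over [[1, N +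
    1]] of [2 / x ^ (2 s)], so that it is bounded in [N] for [s > 1/2]. *)
Lemma weights_window s (N : nat) : 2^-1 < s ->
  \sum_(l <- window N.+1) wh (- s) l ^+ 2 <=
    3 + 2 / (2 * s - 1) * (1 - expR (- (2 * s - 1) * ln N.+1%:R)).
Proof.
move=> hs; set c := 2 * s - 1; have c0 : 0 < c by rewrite /c; lra.
have whN l : wh (- s) (- l) = wh (- s) l by rewrite /wh rmorphN/= sqrrN.
have wh_le1 l : wh (- s) l ^+ 2 <= 1.
  rewrite wh_sqr -[leRHS](powRr0 (1 + (l%:~R : R) ^+ 2)) ler_powR ?wbase_ge1//.
  by lra.
elim: N => [|N ih].
  rewrite ln1 mulr0 expR0 subrr mulr0 addr0 window_sumS.
  have -> : window 0 = [:: 0] :> seq int.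
    by apply: perm_small_eq => //; apply: uniq_perm => // [|l]; rewrite ?uniq_window// mem_window inE; lia.
  rewrite big_seq1; have := wh_le1 1; have := wh_le1 (- 1); have := wh_le1 0.
  by lra.
rewrite window_sumS whN.
set m : R := N.+2%:R; set n : R := N.+1%:R in ih *.
have n0 : 0 < n by rewrite ltr0n.
have mn : m = n + 1 by rewrite /m -natr1.
have m0 : 0 < m by rewrite mn; lra.
have key : wh (- s) N.+2%:Z ^+ 2 <= (expR (- c * ln n) - expR (- c * ln m)) / c.
  rewrite wh_sqr ler_pdivlMr// mulrC.
  apply: (@le_trans _ _ (c * expR (- (2 * s) * ln m))).
    rewrite ler_wpM2l ?(ltW c0)// /powR gt_eqF ?wbase_gt0// ler_expR.
    have : 2 * ln m <= ln (1 + m ^+ 2).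
      have -> : 2 * ln m = ln (m ^+ 2) by rewrite lnXn// mulr_natl.
      by rewrite ler_ln ?posrE ?exprn_gt0//; [rewrite lerDr|rewrite addr_gt0// exprn_gt0].
    rewrite -/m; move=> h; rewrite !mulNr lerN2 (_ : 2 * s * ln m = s * (2 * ln m)); last by ring.
    by rewrite ler_wpM2l//; lra.
  have lnn : ln n <= ln m - m^-1.
    have -> : n = m * (1 + - m^-1) by rewrite mulrDr mulrN divff ?gt_eqF// mn; lra.
    rewrite lnM ?posrE//; last by rewrite subr_gt0 invf_lt1// mn; lra.
    rewrite lerD2l le_ln1Dx// ltrN2 invf_lt1// mn; lra.
  have : expR (- c * ln m) * (1 + c / m) <= expR (- c * ln n).
    apply: (@le_trans _ _ (expR (- c * ln m) * expR (c / m))).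
      by rewrite ler_wpM2l ?expR_ge0// expR_ge1Dx.
    rewrite -expRD ler_expR.
    have -> : - c * ln m + c / m = - (c * (ln m - m^-1)) by ring.
    by rewrite mulNr lerN2 ler_wpM2l// ltW.
  have -> : expR (- (2 * s) * ln m) = expR (- c * ln m) / m.
    rewrite -[X in _ / X](lnK (_ : m \is Num.pos)) ?posrE// -expRN -expRD.
    by congr expR; rewrite /c; ring.
  have -> : expR (- c * ln m) * (1 + c / m) =
    expR (- c * ln m) + c * (expR (- c * ln m) / m) by ring.
  by move=> h; rewrite lerBrDl.
move: ih key; rewrite !ler_pdivlMr//.
set W := wh _ _ ^+ 2; set S := \sum_(_ <- _) _.
set E1 := expR _; set E2 := expR _ => ih key.
have {}key : W <= (E1 - E2) / c by rewrite ler_pdivlMr.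
have -> : 3 + 2 / c * (1 - E2) = (3 + 2 / c * (1 - E1)) + 2 * ((E1 - E2) / c) by ring.
by lra.
Qed.

Definition weight_sums s : set R :=
  [set \sum_(l <- t) wh (- s) l ^+ 2 | t in [set t : seq int | uniq t]].

(** The embedding constant of $H^s$ in the continuous functions, $s > 1/2$. *)
Definition sup_const s : R := 1 + sup (weight_sums s).

Lemma sup_const_sum s t : 2^-1 < s -> uniq t -> \sum_(l <- t) wh (- s) l ^+ 2 <= sup_const s - 1.
Proof.
move=> hs ut; rewrite /sup_const addrC addKr; apply: ub_le_sup; last by exists t.
exists (3 + 2 / (2 * s - 1)) => _ [t' ut' <-].
have [N hN] := sub_window t'.
have c0 : 0 < 2 * s - 1 by lra.
apply: le_trans (le_sum_subset (t2 := window N.+1) _ ut' (uniq_window _) _) _.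
- by move=> l; exact: sqr_ge0.
- by move=> l /hN; rewrite !mem_window => /leqW.
apply: le_trans (weights_window N hs) _; rewrite lerD2l ler_piMr ?divr_ge0 ?(ltW c0)// gerBl expR_ge0.
Qed.

Lemma sup_const_ge1 s : 2^-1 < s -> 1 <= sup_const s.
Proof. by move=> hs; have := sup_const_sum hs (isT : uniq [::]); rewrite big_nil; lra. Qed.

Lemma sup_const_ge0 s : 2^-1 < s -> 0 <= sup_const s.
Proof. by move=> /sup_const_ge1; apply: le_trans. Qed.

(** The embedding of [H^s] in the functions with absolutely summable Fourier
    series: Cauchy-Schwarz against the weights. *)
Lemma l2b_abs_sum s B a : 2^-1 < s -> l2b s B a -> abs_sum a (sup_const s * B).
Proof.
move=> hs [B0 ha] t ut.
have -> : \sum_(l <- t) cmod (a l) = \sum_(l <- t) wh (- s) l * (wh s l * cmod (a l)).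
  apply: eq_bigr => l _; rewrite mulrA -whD addNr /wh mul0r powRr0 mul1r //.
apply: le_trans (n2_sum _ _ _) _; apply: ler_pM; rewrite ?n2_ge0 ?ha//.
have k1 := sup_const_ge1 hs; rewrite n2_leP ?sup_const_ge0// (le_trans (sup_const_sum hs ut))//.
by nra.
Qed.

End Weights.

Local Opaque fcoef fmult synth mean.

(** * Balls of Sobolev spaces *)

Section Balls.
Variable R : realType.
Local Notation C := R[i].
Implicit Types (f g : R -> C) (a b : int -> C) (t : seq int) (s : R).

(** The closed ball of radius [B] of $H^s$. Stating every estimate as
    membership in a ball avoids extended reals and finiteness side conditions.
    *)
Definition Hb s (B : R) f :=
  [/\ periodic2pi f, ccontinuous f & l2b s B (fcoef f)].

Lemma Hb_ge0 s B f : Hb s B f -> 0 <= B.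
Proof. by case=> _ _ []. Qed.

Lemma Hb_cont s B f : Hb s B f -> ccontinuous f.
Proof. by case. Qed.

Lemma Hb_per s B f : Hb s B f -> periodic2pi f.
Proof. by case. Qed.

Lemma Hb_ext s B f g : (forall x, f x = g x) -> Hb s B f -> Hb s B g.
Proof. by move=> /funext ->. Qed.

Lemma Hb_le s B B' f : B <= B' -> Hb s B f -> Hb s B' f.
Proof. by move=> BB [h1 h2 h3]; split=> //; exact: l2b_le h3. Qed.

Lemma Hb_lower s s' B f : s' <= s -> Hb s B f -> Hb s' B f.
Proof.
move=> ss [h1 h2 h3]; split=> //; rewrite -[B]mul1r; apply: (l2bM ler01 h3) => l.
by rewrite mul1r ler_wpM2r ?cmod_ge0// wh_le.
Qed.

Lemma HbD s A B f g : Hb s A f -> Hb s B g -> Hb s (A + B) (fun x => f x + g x).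
Proof.
move=> [f1 f2 f3] [g1 g2 g3]; split.
- by move=> x; rewrite f1 g1.
- exact: ccontD.
- by rewrite (_ : fcoef _ = fun l => fcoef f l + fcoef g l);
    [exact: l2bD|apply/funext => l; exact: fcoefD].
Qed.

Lemma HbZ s B f (z : C) : Hb s B f -> Hb s (cmod z * B) (fun x => z * f x).
Proof.
move=> [f1 f2 f3]; split.
- by move=> x; rewrite f1.
- exact: ccontZ.
- apply: (l2bM (cmod_ge0 z) f3) => l.
  by rewrite fcoefZ// cmodM mulrCA.
Qed.

Lemma HbN s B f : Hb s B f -> Hb s B (fun x => - f x).
Proof.
move=> /(HbZ (-1)); rewrite cmodN cmod1 mul1r.
by apply: Hb_ext => x; rewrite mulN1r.
Qed.

Lemma HbB s A B f g : Hb s A f -> Hb s B g -> Hb s (A + B) (fun x => f x - g x).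
Proof. by move=> hf /HbN; exact: HbD. Qed.

Lemma HbJ s B f : Hb s B f -> Hb s B (fun x => (f x)^*%R).
Proof.
move=> [f1 f2 f3]; split.
- by move=> x; rewrite f1.
- exact: ccontJ.
- apply: l2b_eq (l2bN f3) => l; by rewrite fcoefJ// cmodJ.
Qed.

Lemma Hb_synth s B a : 2^-1 < s -> l2b s B a -> Hb s B (synth a).
Proof.
move=> hs ha; have aS := l2b_abs_sum hs ha; split.
- exact: synth_period.
- exact: ccont_synth aS.
- by apply: l2b_eq ha => l; rewrite (fcoef_synth _ aS).
Qed.

Lemma Hb_abs_sum s B f : 2^-1 < s -> Hb s B f -> abs_sum (fcoef f) (sup_const s * B).
Proof. by move=> hs [_ _ h]; exact: l2b_abs_sum. Qed.

Lemma Hb_synthE s B f : 2^-1 < s -> Hb s B f -> synth (fcoef f) = f.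
Proof.
by move=> hs hf; have [f1 f2 f3] := hf; apply: synth_fcoef (Hb_abs_sum hs hf).
Qed.

Lemma Hb_sup s B f x : 2^-1 < s -> Hb s B f -> cmod (f x) <= sup_const s * B.
Proof.
move=> hs hf; rewrite -(Hb_synthE hs hf); apply: synth_bound.
exact: Hb_abs_sum hs hf.
Qed.

Lemma Hb0 s : Hb s 0 (fun _ : R => 0).
Proof.
split; first by [].
  exact: ccont_cst.
split=> // t ut; rewrite n2_leP// expr0n big1// => l _.
rewrite (_ : (fun=> 0) = fun x => 0 * mode 0 x); last by apply/funext => x; rewrite mul0r.
by rewrite fcoefZ ?mul0r ?cmod0 ?mulr0 ?expr0n//; exact: ccont_mode.
Qed.

Lemma Hb_fmult s B f (m : int -> C) : 2^-1 < s -> (forall l, cmod (m l) <= 1) ->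
  Hb s B f -> Hb s B (fmult m f).
Proof.
move=> hs hm [f1 f2 f3]; rewrite fmultE; apply: Hb_synth => //.
rewrite -[B]mul1r; apply: (l2bM ler01 f3) => l.
by rewrite mul1r ler_wpM2l ?wh_ge0// cmodM ler_piMl ?cmod_ge0.
Qed.

Lemma fcoef_fmult s B f (m : int -> C) l : 2^-1 < s -> (forall l, cmod (m l) <= 1) ->
  Hb s B f -> fcoef (fmult m f) l = m l * fcoef f l.
Proof.
move=> hs hm hf; rewrite fmultE.
have aS : abs_sum (fun l => m l * fcoef f l) (1 * (sup_const s * B)).
  apply: (abs_sum_le ler01 (Hb_abs_sum hs hf)) => k.
  by rewrite mul1r cmodM ler_piMl ?cmod_ge0.
by rewrite (fcoef_synth _ aS).
Qed.

Lemma Hb_inj s A B f g : 2^-1 < s -> Hb s A f -> Hb s B g ->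
  (forall l, fcoef f l = fcoef g l) -> f = g.
Proof.
move=> hs hf hg h; rewrite -(Hb_synthE hs hf) -(Hb_synthE hs hg).
by apply: (congr1 (@synth R)); apply/funext.
Qed.

Lemma fmultD s A B f g m : 2^-1 < s -> (forall l, cmod (m l) <= 1) ->
  Hb s A f -> Hb s B g ->
  fmult m (fun x => f x + g x) = (fun x => fmult m f x + fmult m g x).
Proof.
move=> hs hm hf hg; have hF := Hb_fmult hs hm hf; have hG := Hb_fmult hs hm hg.
apply: (Hb_inj hs (Hb_fmult hs hm (HbD hf hg)) (HbD hF hG)) => l.
have [cf cg cF cG] := And4 (Hb_cont hf) (Hb_cont hg) (Hb_cont hF) (Hb_cont hG).
rewrite (fcoef_fmult _ hs hm (HbD hf hg)) !fcoefD//.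
rewrite mulrDr.
by rewrite -(fcoef_fmult l hs hm hf) -(fcoef_fmult l hs hm hg).
Qed.

Lemma fmultZ s B f m (z : C) : 2^-1 < s -> (forall l, cmod (m l) <= 1) ->
  Hb s B f -> fmult m (fun x => z * f x) = (fun x => z * fmult m f x).
Proof.
move=> hs hm hf; have hF := Hb_fmult hs hm hf.
apply: (Hb_inj hs (Hb_fmult hs hm (HbZ z hf)) (HbZ z hF)) => l.
have [cf cF] := conj (Hb_cont hf) (Hb_cont hF).
rewrite (fcoef_fmult _ hs hm (HbZ z hf)) !fcoefZ//.
by rewrite (fcoef_fmult _ hs hm hf) mulrCA.
Qed.

Lemma fmultC s B f m m' : 2^-1 < s -> (forall l, cmod (m l) <= 1) ->
  (forall l, cmod (m' l) <= 1) -> Hb s B f ->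
  fmult m (fmult m' f) = fmult m' (fmult m f).
Proof.
move=> hs hm hm' hf; rewrite [LHS]fmultE [RHS]fmultE.
apply: (congr1 (@synth R)); apply/funext => l.
by rewrite (fcoef_fmult _ hs hm hf) (fcoef_fmult _ hs hm' hf) mulrCA.
Qed.

Lemma fcoef_shift s B f h l : 2^-1 < s -> Hb s B f ->
  fcoef (shift h f) l = mode l h * fcoef f l.
Proof.
move=> hs hf; rewrite -{1}(Hb_synthE hs hf) shift_synth.
have aS : abs_sum (fun l => mode l h * fcoef f l) (1 * (sup_const s * B)).
  apply: (abs_sum_le ler01 (Hb_abs_sum hs hf)) => k.
  by rewrite mul1r cmodM cmod_mode mul1r.
by rewrite (fcoef_synth _ aS).
Qed.

Lemma shift_fmult f h : fmult (fun l => mode l h) f = shift h (synth (fcoef f)).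
Proof. by rewrite shift_synth fmultE. Qed.

Lemma Hb_shift s B f h : 2^-1 < s -> Hb s B f -> Hb s B (shift h f).
Proof.
move=> hs hf; rewrite -(Hb_synthE hs hf) -shift_fmult; apply: Hb_fmult => // l.
by rewrite cmod_mode.
Qed.

Lemma fmult_shift s B f m h : 2^-1 < s -> (forall l, cmod (m l) <= 1) ->
  Hb s B f -> fmult m (shift h f) = shift h (fmult m f).
Proof.
move=> hs hm hf; rewrite [in RHS]fmultE shift_synth fmultE; apply: (congr1 (@synth R)).
by apply/funext => l; rewrite (fcoef_shift _ _ hs hf); ring.
Qed.

Lemma norm_sin_le (x : R) : `|sin x| <= `|x|.
Proof.
wlog x0 : x / 0 <= x.
  move=> h; have [/h//|/ltW x0] := leP 0 x.
  by have := h (- x); rewrite sinN !normrN; apply; rewrite oppr_ge0.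
move: x0; rewrite le_eqVlt => /predU1P[<-|x0]; first by rewrite sin0.
have cs : {within `[0, x], continuous (@sin R)}.
  by apply: continuous_subspaceT => y; exact: continuous_sin.
have [c _] := @MVT R sin cos 0 x x0 (fun y _ => is_derive_sin y) cs.
rewrite sin0 !subr0 => ->; by rewrite normrM ler_piMl// cos_max.
Qed.

Lemma norm_cos_sub1_le (x : R) : `|cos x - 1| <= `|x|.
Proof.
wlog x0 : x / 0 <= x.
  move=> h; have [/h//|/ltW x0] := leP 0 x.
  by have := h (- x); rewrite cosN !normrN; apply; rewrite oppr_ge0.
move: x0; rewrite le_eqVlt => /predU1P[<-|x0]; first by rewrite cos0 subrr.
have cc : {within `[0, x], continuous (@cos R)}.
  by apply: continuous_subspaceT => y; exact: continuous_cos.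
have [c _] := @MVT R cos (fun y => - sin y) 0 x x0 (fun y _ => is_derive_cos y) cc.
rewrite cos0 !subr0 => ->; by rewrite normrM normrN ler_piMl// sin_max.
Qed.

Lemma cmod_mode_sub1 l h : cmod (mode l h - 1) <= 2 * `|h| * `|l%:~R : R|.
Proof.
rewrite (le_trans (cmod_le _))// Re_D Im_D Re_N Im_N Re_mode Im_mode/= subr0.
have := norm_sin_le (l%:~R * h); have := norm_cos_sub1_le (l%:~R * h).
by rewrite normrM; lra.
Qed.

(** One derivative buys one power of the translation length. *)
Lemma Hb_shift_sub s B f h : 2^-1 < s -> Hb (s + 1) B f ->
  Hb s (2 * `|h| * B) (fun x => shift h f x - f x).
Proof.
move=> hs hf; have hf' : Hb s B f by apply: Hb_lower hf; rewrite lerDl.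
have [h1 h2 _] := HbB (Hb_shift h hs hf') hf'; split=> //.
have [_ cf f3] := hf.
have k0 : 0 <= 2 * `|h| by rewrite mulr_ge0.
apply: (l2bM k0 f3) => l.
rewrite fcoefB//; last exact: Hb_cont (Hb_shift h hs hf').
rewrite (fcoef_shift _ _ hs hf') -[X in _ - X]mul1r -mulrBl cmodM whD.
have := cmod_mode_sub1 l h; have := wh1 R l; have := wh_ge0 s l; have := cmod_ge0 (fcoef f l).
set F := cmod (fcoef f l); set D := cmod _; set w := wh s l; set w1 := wh 1 l.
move=> F0 w0 lw lD.
have : D <= 2 * `|h| * w1 by rewrite (le_trans lD)// ler_wpM2l.
move=> {lD} lD; rewrite mulrA [leRHS](_ : _ = w * (2 * `|h| * w1) * F); last by ring.
by rewrite ler_wpM2r// ler_wpM2l.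
Qed.

(** Each Fourier coefficient passes to the uniform limit, hence so does each
    finite weighted sum; this is Fatou's lemma for the Sobolev norm. *)
Lemma Hb_closed s B f : 0 <= B ->
  (forall e, 0 < e -> exists g, Hb s B g /\ forall x, cmod (f x - g x) <= e) ->
  Hb s B f.
Proof.
move=> B0 h.
have cf : ccontinuous f.
  apply: (ccont_unif) => e /h[g [hg fg]]; exists g; split=> //.
  exact: Hb_cont hg.
split=> //.
  move=> x; apply/eqP; rewrite -subr_eq0; apply/eqP/cmod_eq0/eqP.
  rewrite eq_le cmod_ge0 andbT; apply: le_of_eps => e e0; rewrite add0r.
  have e20 : 0 < e / 2 by lra.
  have [g [[pg _ _] fg]] := h _ e20.
  have -> : f (x + 2 * pi) - f x = (f (x + 2 * pi) - g (x + 2 * pi)) - (f x - g x).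
    by rewrite pg; ring.
  by rewrite (le_trans (cmodB _ _))// (splitr e) lerD.
split=> // t ut; apply: le_of_eps => e e0.
set W := n2 t (wh s); have W0 : 0 <= W by exact: n2_ge0.
have d0 : 0 < e / (2 * (W + 1)) by rewrite divr_gt0// mulr_gt0// ltr_wpDl.
have [g [[pg cg [_ /(_ t ut) hg]] fg]] := h _ d0.
set d := e / _ in d0 fg.
apply: (@le_trans _ _ (n2 t (fun l => wh s l * cmod (fcoef g l) + (2 * d) * wh s l))).
  apply: n2_le => l _; rewrite ger0_norm ?mulr_ge0 ?wh_ge0 ?cmod_ge0//.
  rewrite [_ * wh s l]mulrC -mulrDr ler_wpM2l ?wh_ge0//.
  have -> : fcoef f l = fcoef g l + fcoef (fun x => f x - g x) l.
    by rewrite fcoefB// addrCA subrr addr0.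
  rewrite (le_trans (cmodD _ _))// lerD2l fcoef_sup//; exact: ccontB.
apply: le_trans (n2D _ _ _) _; rewrite lerD// n2Z; last by rewrite mulr_ge0// ltW.
rewrite -/W /d; have -> : 2 * (e / (2 * (W + 1))) * W = e * (W / (W + 1)) by field; rewrite gt_eqF// ltr_wpDl.
by rewrite ler_piMr ?(ltW e0)// ler_pdivrMr ?ltr_wpDl// mul1r lerDl.
Qed.

End Balls.

(** * Products *)

Section Products.
Variable R : realType.
Local Notation C := R[i].
Implicit Types (f g : R -> C) (a b : int -> C) (t : seq int) (s : R).

(** The weight of a frequency [l] is carried by the larger of the two
    frequencies [k] and [l - k] that produce it. *)
Lemma wh_sub s k l : 0 <= s -> wh s l <= 2 `^ s * (wh s k + wh s (l - k)).
Proof.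
move=> s0; have s20 : 0 <= s / 2 by rewrite divr_ge0.
have E4 : (4 : R) `^ (s / 2) = 2 `^ s.
  have -> : (4 : R) = 2 ^+ 2 by ring.
  by rewrite -powR_mulrn// -powRrM; congr (_ `^ _); lra.
have key x y : 0 <= x -> 0 <= y -> 1 + (l%:~R : R) ^+ 2 <= 4 * x -> x <= y ->
    wh s l <= 2 `^ s * y `^ (s / 2).
  move=> x0 y0 lx xy; rewrite -E4 -powRM// /wh ge0_ler_powR// ?nnegrE.
  - exact/ltW/wbase_gt0.
  - by rewrite mulr_ge0.
  - by apply: le_trans lx _; rewrite ler_pM2l.
have lkl : (l%:~R : R) = k%:~R + (l - k)%:~R by rewrite -rmorphD/= addrC subrK.
have P0 := powR_ge0 (2 : R) s.
have [h|h] := leP ((k%:~R : R) ^+ 2) ((l - k)%:~R ^+ 2).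
- apply: (@le_trans _ _ (2 `^ s * wh s (l - k))).
    apply: (key (1 + (l - k)%:~R ^+ 2)) => //; [exact/ltW/wbase_gt0|exact/ltW/wbase_gt0|].
    rewrite lkl; move: h; set u : R := k%:~R; set v : R := (l - k)%:~R => h.
    have := sqr_ge0 (u - v); nra.
  by rewrite ler_wpM2l// lerDr wh_ge0.
- apply: (@le_trans _ _ (2 `^ s * wh s k)).
    apply: (key (1 + k%:~R ^+ 2)) => //; [exact/ltW/wbase_gt0|exact/ltW/wbase_gt0|].
    rewrite lkl; move: h; set u : R := k%:~R; set v : R := (l - k)%:~R => h.
    have := sqr_ge0 (u - v); nra.
  by rewrite ler_wpM2l// lerDl wh_ge0.
Qed.

(** Young's inequality for the convolution of a square-summable with a summable
    sequence; the summable one is either factor. *)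
Lemma young (x y : int -> R) (t u : seq int) (X Y : R) :
  (forall l, 0 <= x l) -> (forall l, 0 <= y l) -> 0 <= X -> 0 <= Y ->
  uniq t -> uniq u ->
  (n2 u x <= X) -> (forall v, uniq v -> \sum_(l <- v) y l <= Y) ->
  n2 t (fun l => \sum_(k <- u) x k * y (l - k)) <= X * Y.
Proof.
move=> x0 y0 X0 Y0 ut uu xX yY; rewrite n2_leP ?mulr_ge0//.
apply: (@le_trans _ _ (\sum_(l <- t) Y * \sum_(k <- u) x k ^+ 2 * y (l - k))).
  apply: ler_sum => l _.
  have -> : \sum_(k <- u) x k * y (l - k) =
      \sum_(k <- u) (x k * Num.sqrt (y (l - k))) * Num.sqrt (y (l - k)).
    by apply: eq_bigr => k _; rewrite -mulrA -expr2 sqr_sqrtr.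
  apply: le_trans (cauchy_schwarz _ _ _) _; rewrite mulrC.
  apply: ler_pM; [by apply: sumr_ge0 => k _; exact: sqr_ge0|by apply: sumr_ge0 => k _; exact: sqr_ge0| |].
    under eq_bigr do rewrite sqr_sqrtr//.
    have := yY [seq l - k | k <- u]; rewrite big_map; apply.
    by rewrite map_inj_uniq// => k1 k2 /addrI /oppr_inj.
  by apply: ler_sum => k _; rewrite exprMn sqr_sqrtr.
rewrite -mulr_sumr exchange_big/= exprMn [X in _ <= _ * X]expr2 mulrCA ler_wpM2l//.
apply: (@le_trans _ _ (\sum_(k <- u) x k ^+ 2 * Y)).
  apply: ler_sum => k _; rewrite -mulr_sumr ler_wpM2l ?sqr_ge0//.
  have := yY [seq l - k | l <- t]; rewrite big_map; apply.
  by rewrite map_inj_uniq// => k1 k2 /addIr.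
by rewrite -mulr_suml ler_wpM2r// -n2_sqr ler_sqr ?nnegrE ?n2_ge0.
Qed.

Lemma young_sym (x y : int -> R) (t u : seq int) (X Y : R) :
  (forall l, 0 <= x l) -> (forall l, 0 <= y l) -> 0 <= X -> 0 <= Y ->
  uniq t -> uniq u ->
  \sum_(l <- u) x l <= X -> (forall v, uniq v -> n2 v y <= Y) ->
  n2 t (fun l => \sum_(k <- u) x k * y (l - k)) <= X * Y.
Proof.
move=> x0 y0 X0 Y0 ut uu xX yY; rewrite n2_leP ?mulr_ge0//.
apply: (@le_trans _ _ (\sum_(l <- t) X * \sum_(k <- u) x k * y (l - k) ^+ 2)).
  apply: ler_sum => l _.
  have -> : \sum_(k <- u) x k * y (l - k) =
      \sum_(k <- u) Num.sqrt (x k) * (Num.sqrt (x k) * y (l - k)).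
    by apply: eq_bigr => k _; rewrite mulrA -expr2 sqr_sqrtr.
  apply: le_trans (cauchy_schwarz _ _ _) _.
  apply: ler_pM; [by apply: sumr_ge0 => k _; exact: sqr_ge0|by apply: sumr_ge0 => k _; exact: sqr_ge0| |].
    by under eq_bigr do rewrite sqr_sqrtr//.
  by apply: ler_sum => k _; rewrite exprMn sqr_sqrtr.
rewrite -mulr_sumr exchange_big/= exprMn [X in _ <= X * _]expr2 -mulrA ler_wpM2l//.
apply: (@le_trans _ _ (\sum_(k <- u) x k * Y ^+ 2)).
  apply: ler_sum => k _; rewrite -mulr_sumr ler_wpM2l//.
  have u' : uniq [seq l - k | l <- t] by rewrite map_inj_uniq// => k1 k2 /addIr.
  have := yY _ u'; rewrite n2_leP// big_map//.
by rewrite -mulr_suml ler_wpM2r// sqr_ge0.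
Qed.

(** The constant of the algebra property of $H^s$. *)
Definition mul_const s : R := 2 `^ s * (2 * sup_const s).

Lemma mul_const_ge0 s : 2^-1 < s -> 0 <= mul_const s.
Proof. by move=> hs; rewrite !mulr_ge0 ?powR_ge0 ?sup_const_ge0. Qed.

Lemma n2_partial_sumM s A B f g N t : 2^-1 < s -> Hb s A f -> Hb s B g -> uniq t ->
  n2 t (fun l => wh s l *
    cmod (fcoef (fun x => partial_sum (fcoef f) N x * g x) l)) <= mul_const s * A * B.
Proof.
move=> hs hf hg ut; have s0 : 0 <= s by lra.
have A0 := Hb_ge0 hf; have B0 := Hb_ge0 hg; have k0 := sup_const_ge0 hs.
have [_ cf [_ lf]] := hf; have [_ cg [_ lg]] := hg.
pose x1 l := wh s l * cmod (fcoef f l); pose y1 l := cmod (fcoef g l).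
pose x2 l := cmod (fcoef f l); pose y2 l := wh s l * cmod (fcoef g l).
have coefE l : fcoef (fun x => partial_sum (fcoef f) N x * g x) l =
    \sum_(k <- window N) fcoef f k * fcoef g (l - k).
  rewrite (_ : (fun x => _) = fun x => \sum_(k <- window N) fcoef f k * (mode k x * g x)).
    rewrite fcoef_sum; last first.
      by move=> k; apply: ccontZ; apply: ccontM => //; exact: ccont_mode.
    apply: eq_bigr => k _; rewrite fcoefZ ?fcoef_modeM//.
    by apply: ccontM => //; exact: ccont_mode.
  by apply/funext => x; rewrite mulr_suml; apply: eq_bigr => k _; rewrite mulrA.
apply: (@le_trans _ _ (n2 t (fun l => 2 `^ s * (\sum_(k <- window N) x1 k * y1 (l - k) +
    \sum_(k <- window N) x2 k * y2 (l - k))))).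
  apply: n2_le => l _; rewrite ger0_norm ?mulr_ge0 ?wh_ge0 ?cmod_ge0// coefE.
  apply: (@le_trans _ _ (wh s l * \sum_(k <- window N) x2 k * y1 (l - k))).
    rewrite ler_wpM2l ?wh_ge0// (le_trans (cmod_sum _ _ _))//.
    by apply: ler_sum => k _; rewrite cmodM.
  rewrite -big_split/= !mulr_sumr; apply: ler_sum => k _.
  rewrite /x1 /y2 -/(x2 k) -/(y1 (l - k)).
  have -> : 2 `^ s * (wh s k * x2 k * y1 (l - k) + x2 k * (wh s (l - k) * y1 (l - k))) =
    2 `^ s * (wh s k + wh s (l - k)) * (x2 k * y1 (l - k)) by ring.
  by rewrite ler_wpM2r ?wh_sub// mulr_ge0 ?cmod_ge0.
rewrite n2Z ?powR_ge0// /mul_const.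
have -> : 2 `^ s * (2 * sup_const s) * A * B = 2 `^ s * (A * (sup_const s * B) + (sup_const s * A) * B) by ring.
rewrite ler_wpM2l ?powR_ge0// (le_trans (n2D _ _ _))// lerD//.
- apply: young => //; [by move=> l; rewrite mulr_ge0 ?wh_ge0 ?cmod_ge0|by move=> l; exact: cmod_ge0|
    exact: mulr_ge0|exact: uniq_window|by apply: lf; exact: uniq_window|].
  by move=> v uv; apply: (Hb_abs_sum hs hg).
- apply: young_sym => //; [by move=> l; exact: cmod_ge0|by move=> l; rewrite mulr_ge0 ?wh_ge0 ?cmod_ge0|
    exact: mulr_ge0|exact: uniq_window|].
  by apply: (Hb_abs_sum hs hf); exact: uniq_window.
Qed.

(** The Fourier series of one factor is truncated first, so that the
    coefficients of the product are a finite convolution; the bound does not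
    depend on the truncation, which is removed by a uniform limit. *)
Lemma HbM s A B f g : 2^-1 < s -> Hb s A f -> Hb s B g ->
  Hb s (mul_const s * A * B) (fun x => f x * g x).
Proof.
move=> hs hf hg; have A0 := Hb_ge0 hf; have B0 := Hb_ge0 hg; have k0 := sup_const_ge0 hs.
apply: Hb_closed; first by rewrite !mulr_ge0 ?mul_const_ge0.
move=> e e0; have d0 : 0 < e / (sup_const s * B + 1) by rewrite divr_gt0// ltr_wpDl// mulr_ge0.
have fS := Hb_abs_sum hs hf.
have [N0 hN] := synth_approx fS d0; have {}hN := hN _ (leqnn N0).
exists (fun x => partial_sum (fcoef f) N0 x * g x); split.
  split.
  - move=> x; have [pg _ _] := hg; rewrite pg; congr (_ * _).
    by apply: eq_bigr => l _; rewrite mode_period.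
  - by apply: ccontM; [exact: ccont_partial_sum|exact: Hb_cont hg].
  - by split; [rewrite !mulr_ge0 ?mul_const_ge0|move=> t ut; exact: n2_partial_sumM].
move=> x; rewrite -mulrBl cmodM.
have := hN x; rewrite (Hb_synthE hs hf) => h1.
apply: (@le_trans _ _ (e / (sup_const s * B + 1) * (sup_const s * B))).
  exact: (ler_pM (cmod_ge0 _) (cmod_ge0 _) h1 (Hb_sup _ hs hg)).
rewrite -mulrA ler_piMr ?(ltW e0)// mulrC ler_pdivrMr ?mul1r ?lerDl//.
by rewrite ltr_wpDl// mulr_ge0.
Qed.

(** * Interpolation *)

(** The uniform norm controls each of the finitely many low frequencies, and
    the stronger ball makes the high ones uniformly small. *)
Lemma Hb_interp s s' B e : s < s' -> 0 <= B -> 0 < e ->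
  exists2 d, 0 < d & forall g, Hb s' B g -> (forall x, cmod (g x) <= d) -> Hb s e g.
Proof.
move=> ss B0 e0; set c := (s' - s) / 2.
have c0 : 0 < c by rewrite divr_gt0// subr_gt0.
set eta := e / (2 * (B + 1)).
have eta0 : 0 < eta by rewrite divr_gt0// mulr_gt0// ltr_wpDl.
pose X := (eta^-1) `^ (c^-1).
(* Beyond [L] the ratio of the two weights is at most [eta]. *)
pose L := (Num.truncn X).+1.
have Lw l : (L < `|l|)%N -> wh s l <= eta * wh s' l.
  move=> lL; have lX : X <= 1 + (l%:~R : R) ^+ 2.
    have XL : X <= L%:R by apply/ltW/truncnS_gt.
    have lR : L%:R <= `|l%:~R : R|.
      by rewrite -intr_norm -abszE -pmulrn ler_nat ltnW.
    have : 0 <= X by exact: powR_ge0.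
    rewrite -(real_normK (num_real (l%:~R : R))).
    by set y := `|_|; move: XL lR; rewrite -/y; nra.
  have : eta^-1 <= wh (s' - s) l.
    rewrite /wh -/c; have -> : eta^-1 = X `^ c.
      by rewrite /X -powRrM mulVf ?gt_eqF// powRr1// invr_ge0 ltW.
    by rewrite ge0_ler_powR ?nnegrE ?powR_ge0// ltW// ?wbase_gt0.
  move=> h; rewrite -[X in eta * wh X l](subrK s s') whD mulrA.
  by rewrite ler_peMl ?wh_ge0// -ler_pdivrMl// mulr1.
pose W := \sum_(l <- window L) wh s l.
have W0 : 0 <= W by apply: sumr_ge0 => l _; exact: wh_ge0.
exists (e / (4 * (W + 1))); first by rewrite divr_gt0// mulr_gt0// ltr_wpDl.
set d := e / _; have d0 : 0 < d by rewrite /d divr_gt0// mulr_gt0// ltr_wpDl.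
move=> g [pg cg [_ hg]] gd; split=> //; split; first exact: ltW.
move=> t ut; pose low l := if (`|l| <= L)%N then 2 * d * wh s l else 0.
have low0 l : 0 <= low l by rewrite /low; case: ifP => // _; rewrite mulr_ge0 ?wh_ge0// mulr_ge0// ltW.
apply: (@le_trans _ _ (n2 t (fun l => low l + eta * (wh s' l * cmod (fcoef g l))))).
  apply: n2_le => l _; rewrite ger0_norm ?mulr_ge0 ?wh_ge0 ?cmod_ge0//.
  rewrite /low; case: leqP => lL.
    rewrite mulrC [leLHS]mulrC -[leLHS]addr0 lerD//.
      by rewrite mulrC ler_wpM2r ?wh_ge0 ?fcoef_sup.
    by rewrite mulr_ge0 ?(ltW eta0)// mulr_ge0 ?wh_ge0 ?cmod_ge0.
  by rewrite add0r mulrA ler_wpM2r ?cmod_ge0 ?Lw.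
rewrite (le_trans (n2D _ _ _))// (splitr e) lerD//.
  rewrite (le_trans (n2_le_sum _ low0))//.
  apply: (@le_trans _ _ (2 * d * W)).
    rewrite /W mulr_sumr (bigID (fun l => (`|l| <= L)%N))/= [X in _ + X]big1; last first.
      by move=> l /negbTE lL; rewrite /low lL.
    rewrite addr0 -big_filter.
    apply: le_trans (le_sum_subset (t2 := window L) low0 (filter_uniq _ ut) (uniq_window _) _) _.
      by move=> l; rewrite mem_filter mem_window => /andP[].
    rewrite big_seq [leRHS]big_seq; apply: ler_sum => l; rewrite mem_window => lL.
    by rewrite /low lL.
  have -> : 2 * d * W = e / 2 * (W / (W + 1)).
    by rewrite /d; field; rewrite gt_eqF// ltr_wpDl.
  by rewrite ler_piMr ?divr_ge0 ?(ltW e0)// ler_pdivrMr ?ltr_wpDl// mul1r lerDl.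
rewrite n2Z ?(ltW eta0)// (le_trans (ler_wpM2l (ltW eta0) (hg t ut)))//.
have -> : eta * B = e / 2 * (B / (B + 1)).
  by rewrite /eta; field; rewrite gt_eqF// ltr_wpDl.
by rewrite ler_piMr ?divr_ge0 ?(ltW e0)// ler_pdivrMr ?ltr_wpDl// mul1r lerDl.
Qed.

(** * Balls and norms *)

Lemma Hb_Hnorm s B f : periodic2pi f -> ccontinuous f -> 0 <= B ->
  (Hnorm s f <= B%:E)%E -> Hb s B f.
Proof.
move=> pf cf B0 h; split=> //; split=> // t ut; rewrite n2_leP//.
move: h; rewrite /Hnorm; set E := esum _ _ => h.
have E0 : (0 <= E)%E.
  by apply: esum_ge0 => l _; rewrite lee_fin mulr_ge0 ?powR_ge0// sqr_ge0.
have {}h : (E <= (B ^+ 2)%:E)%E.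
  by rewrite -lee_sqrt ?lee_fin ?sqr_ge0//= sqrtr_sqr ger0_norm.
rewrite -lee_fin (le_trans _ h)// /E; apply: esum_ge.
exists [set` t]; first by split => //; exact: finite_seq.
rewrite -fsbig_seq// -sumEFin; apply: lee_sum => l _.
by rewrite lee_fin exprMn wh_sqr ler_wpM2l ?powR_ge0// cmodE.
Qed.

Lemma Hnorm_Hb s B f : Hb s B f -> in_Hs s f /\ (Hnorm s f <= B%:E)%E.
Proof.
move=> [pf cf [B0 h]]; suff E : (Hnorm s f <= B%:E)%E.
  by split=> //; split=> //; exact: le_lt_trans E (ltry _).
have -> : B = Num.sqrt (B ^+ 2) by rewrite sqrtr_sqr ger0_norm.
rewrite /Hnorm -[X in (_ <= X)%E]/(sqrte (B ^+ 2)%:E) lee_sqrt ?lee_fin ?sqr_ge0//.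
apply: ge_ereal_sup => _ [X [finX _] <-].
rewrite fsbig_finite//= sumEFin lee_fin.
have := h (finmap.enum_fset (fset_set X)) (finmap.fset_uniq _); rewrite n2_leP//; apply: le_trans.
apply: ler_sum => l _; by rewrite exprMn wh_sqr ler_wpM2l ?powR_ge0// cmodE.
Qed.

Lemma Hb_of_Hnorm2 s B (Psi : R -> 'cV[C]_2) j : in_Hs2 s Psi -> 0 <= B ->
  (Hnorm2 s Psi <= B%:E)%E -> Hb s B (cpt Psi j).
Proof.
move=> hPsi B0 h; have [pf cf _] := hPsi j; apply: Hb_Hnorm => //.
apply: le_trans h; rewrite /Hnorm2.
have H0 k : (0 <= Hnorm s (cpt Psi k))%E by exact: sqrte_ge0.
have HE k : Hnorm s (cpt Psi k) = sqrte (Hnorm s (cpt Psi k) ^+ 2)%E.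
  by rewrite sqrte_sqr gee0_abs.
have sq0 k : (0 <= Hnorm s (cpt Psi k) ^+ 2)%E by rewrite expe_ge0.
rewrite (HE j) lee_sqrt ?adde_ge0//.
have [->|->] : j = 0 \/ j = 1.
  by case: j {pf cf} => [[|[|//]]] p; [left|right]; apply: val_inj.
- by rewrite leeDl.
- by rewrite leeDr.
Qed.

Lemma Hnorm2_Hb s A B (Psi : R -> 'cV[C]_2) :
  Hb s A (cpt Psi 0) -> Hb s B (cpt Psi 1) ->
  in_Hs2 s Psi /\ (Hnorm2 s Psi <= (A + B)%:E)%E.
Proof.
move=> /[dup] hA /Hnorm_Hb[iA nA] /[dup] hB /Hnorm_Hb[iB nB]; split.
  move=> j; have [->|->] // : j = 0 \/ j = 1.
  by case: j => [[|[|//]]] p; [left|right]; apply: val_inj.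
have A0 := Hb_ge0 hA; have B0 := Hb_ge0 hB.
have -> : A + B = Num.sqrt ((A + B) ^+ 2) by rewrite sqrtr_sqr ger0_norm// addr_ge0.
rewrite /Hnorm2 -[X in (_ <= X)%E]/(sqrte ((A + B) ^+ 2)%:E) lee_sqrt ?lee_fin ?sqr_ge0//.
have sq X (D : R) : (0 <= X)%E -> (X <= D%:E)%E -> (X ^+ 2 <= (D ^+ 2)%:E)%E.
  case: X => [x||]// x0 xD; rewrite lee_fin in x0; rewrite lee_fin in xD.
  by rewrite -EFin_expe lee_fin ler_sqr ?nnegrE// (le_trans x0).
apply: (@le_trans _ _ (A ^+ 2 + B ^+ 2)%:E); last first.
  by rewrite lee_fin sqrrD lerD2r lerDl mulrn_wge0// mulr_ge0.
by rewrite EFinD leeD// sq// sqrte_ge0.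
Qed.

End Products.

(** * Differentiation of complex-valued functions of a real variable *)

Section Differentiation.
Variable R : realType.
Local Notation C := R[i].
Local Notation Re := complex.Re.
Local Notation Im := complex.Im.
Local Notation mu := (@lebesgue_measure R).
Local Notation per := (`[0, 2 * pi]%classic : set R).
Implicit Types (f g u v : R -> C) (x s h e : R).

Lemma is_derive_epsP (f : R -> R) x (d : R) : is_derive x 1 f d <->
  forall e, 0 < e -> exists2 dl, 0 < dl &
    forall h, `|h| < dl -> `|f (x + h) - f x - h * d| <= e * `|h|.
Proof.
split.
  move=> [df ed] e e0; move: df => /cvg_ex[l hl].
  have dl : d = l.
    by rewrite -ed; apply/cvg_lim => //; move: hl.
  move: hl => /cvgrPdist_lt/(_ _ e0); rewrite near_withinE => /nbhs_ballP[r /= r0 hr].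
  exists r => // h hh; have [->|h0] := eqVneq h 0.
    by rewrite addr0 subrr mul0r subrr normr0 mulr0.
  have := hr h; rewrite /ball/= sub0r normrN => /(_ hh h0).
  rewrite -dl scaler1 => /ltW k.
  have -> : f (x + h) - f x - h * d = - (h * (d - h^-1 * (f (h + x) - f x))).
    by rewrite mulrBr mulVKf// (addrC h) opprB; ring.
  by rewrite normrN normrM mulrC ler_wpM2r.
move=> H; have cv : (h^-1 *: (f (h *: (1 : R) + x) - f x)) @[h --> 0^'] --> d.
  apply/cvgrPdist_le => e e0; have [r r0 hr] := H e e0.
  rewrite near_withinE; apply/nbhs_ballP; exists r => //= h.
  rewrite /ball/= sub0r normrN scaler1 => /hr k h0.
  have -> : d - h^-1 *: (f (h + x) - f x) = - (h^-1 * (f (x + h) - f x - h * d)).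
    by rewrite /GRing.scale/= (addrC h); field.
  by rewrite normrN normrM normfV ler_pdivrMl ?normr_gt0// [leRHS]mulrC.
by split; [apply/cvg_ex; exists d|exact/cvg_lim].
Qed.

(** Differentiability stated with the modulus, so that no topology on [R[i]]
    is involved. *)
Definition cdiff u s (d : C) := forall e, 0 < e -> exists2 dl, 0 < dl &
  forall h, `|h| < dl -> cmod (u (s + h) - u s - h%:C * d) <= e * `|h|.

Lemma cdiffP u s d : cdiff u s d <->
  is_derive s 1 (fun y => Re (u y)) (Re d) /\ is_derive s 1 (fun y => Im (u y)) (Im d).
Proof.
split.
  move=> H; split; apply/is_derive_epsP => e e0; have [dl dl0 hd] := H e e0;
    exists dl => // h /hd; apply: le_trans.
  - apply: le_trans (Re_le_cmod _).
    by rewrite !(Re_D, Re_N, Re_M, Re_real, Im_real) mul0r subr0.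
  - apply: le_trans (Im_le_cmod _).
    by rewrite !(Im_D, Im_N, Im_M, Re_real, Im_real) mul0r addr0.
move=> [/is_derive_epsP H1 /is_derive_epsP H2] e e0.
have e20 : 0 < e / 2 by lra.
have [d1 d10 h1] := H1 _ e20; have [d2 d20 h2] := H2 _ e20.
exists (Num.min d1 d2); first by rewrite lt_min d10.
move=> h; rewrite lt_min => /andP[/h1 k1 /h2 k2].
rewrite (le_trans (cmod_le _))//.
rewrite !(Re_D, Re_N, Re_M, Re_real, Im_real, Im_D, Im_N, Im_M) !mul0r subr0 addr0.
by lra.
Qed.

Lemma cdiff_ext u v s d : (forall y, u y = v y) -> cdiff u s d -> cdiff v s d.
Proof. by move=> /funext ->. Qed.

Lemma cdiff_cst (z : C) s : cdiff (fun=> z) s 0.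
Proof.
move=> e e0; exists 1 => // h _.
by rewrite subrr mulr0 subr0 cmod0 mulr_ge0// ltW.
Qed.

Lemma cdiff_real s : cdiff (fun y => y%:C) s 1.
Proof.
move=> e e0; exists 1 => // h _.
by rewrite mulr1 rmorphD/= [X in X - _ - _]addrC addrK subrr cmod0 mulr_ge0// ltW.
Qed.

Lemma cdiffD u v s d1 d2 : cdiff u s d1 -> cdiff v s d2 ->
  cdiff (fun y => u y + v y) s (d1 + d2).
Proof.
move=> h1 h2 e e0; have e20 : 0 < e / 2 by lra.
have [r1 r10 k1] := h1 _ e20; have [r2 r20 k2] := h2 _ e20.
exists (Num.min r1 r2); first by rewrite lt_min r10.
move=> h; rewrite lt_min => /andP[/k1 m1 /k2 m2].
have -> : u (s + h) + v (s + h) - (u s + v s) - h%:C * (d1 + d2) =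
  (u (s + h) - u s - h%:C * d1) + (v (s + h) - v s - h%:C * d2) by ring.
by rewrite (le_trans (cmodD _ _))//; lra.
Qed.

Lemma cdiffZ u s d (z : C) : cdiff u s d -> cdiff (fun y => z * u y) s (z * d).
Proof.
move=> H e e0; have d0 : 0 < e / (cmod z + 1) by rewrite divr_gt0// ltr_wpDl ?cmod_ge0.
have [r r0 k] := H _ d0; exists r => // h /k m.
have -> : z * u (s + h) - z * u s - h%:C * (z * d) = z * (u (s + h) - u s - h%:C * d) by ring.
rewrite cmodM (le_trans (ler_wpM2l (cmod_ge0 _) m))// mulrA ler_wpM2r//.
rewrite mulrCA ler_piMr ?(ltW e0)// ler_pdivrMr ?ltr_wpDl ?cmod_ge0//.
by rewrite mul1r lerDl.
Qed.

Lemma cdiffN u s d : cdiff u s d -> cdiff (fun y => - u y) s (- d).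
Proof.
by move=> /(cdiffZ (-1)); rewrite mulN1r; exact: (cdiff_ext (fun y => mulN1r (u y))).
Qed.

Lemma cdiffB u v s d1 d2 : cdiff u s d1 -> cdiff v s d2 ->
  cdiff (fun y => u y - v y) s (d1 - d2).
Proof. by move=> h1 /cdiffN; exact: cdiffD. Qed.

Lemma cdiff_sum (I : Type) (t : seq I) (u : I -> R -> C) s (d : I -> C) :
  (forall i, cdiff (u i) s (d i)) ->
  cdiff (fun y => \sum_(i <- t) u i y) s (\sum_(i <- t) d i).
Proof.
move=> H; elim: t => [|i t ih].
  by rewrite big_nil; under [X in cdiff X]eq_fun do rewrite big_nil; exact: cdiff_cst.
by rewrite big_cons; under [X in cdiff X]eq_fun do rewrite big_cons; exact: (cdiffD (H i) ih).
Qed.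

Lemma within_contP (F : R -> R) a b : (forall s, s \in `[a, b] -> forall e, 0 < e ->
    exists2 d, 0 < d & forall s', s' \in `[a, b] -> `|s' - s| < d -> `|F s' - F s| < e) ->
  {within `[a, b], continuous F}.
Proof.
move=> H; apply/subspace_continuousP => x xab; apply/cvgrPdist_lt => e e0.
have [d d0 hd] := H x xab e e0.
rewrite near_withinE; apply/nbhs_ballP; exists d => //= y; rewrite /ball/= => yx yab.
by rewrite distrC; apply: hd => //; rewrite distrC.
Qed.

Definition ccontin_on (T : R) u := forall s, 0 <= s <= T -> forall e, 0 < e ->
  exists2 d, 0 < d & forall s', 0 <= s' <= T -> `|s' - s| < d -> cmod (u s' - u s) < e.

Lemma ccontin_onD T u v : ccontin_on T u -> ccontin_on T v ->
  ccontin_on T (fun s => u s + v s).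
Proof.
move=> h1 h2 s sT e e0; have e20 : 0 < e / 2 by lra.
have [d1 d10 k1] := h1 s sT _ e20; have [d2 d20 k2] := h2 s sT _ e20.
exists (Num.min d1 d2); first by rewrite lt_min d10.
move=> s' s'T; rewrite lt_min => /andP[/(k1 _ s'T) m1 /(k2 _ s'T) m2].
have -> : u s' + v s' - (u s + v s) = (u s' - u s) + (v s' - v s) by ring.
by rewrite (le_lt_trans (cmodD _ _))//; lra.
Qed.

Lemma cdiff_contin_on T u d : (forall s, cdiff u s (d s)) -> ccontin_on T u.
Proof.
move=> H s _ e e0; have [r r0 k] := H s 1 ltr01.
pose K := cmod (d s) + 1; have K0 : 0 < K by rewrite ltr_wpDl ?cmod_ge0.
exists (Num.min r (e / K)); first by rewrite lt_min r0 divr_gt0.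
move=> s' _; rewrite lt_min => /andP[/k m1 m2].
have -> : u s' - u s = (u s' - u s - (s' - s)%:C * d s) + (s' - s)%:C * d s by ring.
have := m1; rewrite (addrC s) subrK mul1r => {}m1.
rewrite (le_lt_trans (cmodD _ _))// [X in _ + X]cmodM cmod_real.
rewrite ltr_pdivlMr// in m2; move: m2; rewrite /K; lra.
Qed.

Lemma lip_contin_on T K u : (forall s s', 0 <= s <= T -> 0 <= s' <= T ->
  cmod (u s' - u s) <= K * `|s' - s|) -> ccontin_on T u.
Proof.
move=> H s sT e e0; pose K1 := Num.max K 0 + 1.
have m0 : 0 <= Num.max K 0 by rewrite le_max lexx orbT.
have K1p : 0 < K1 by rewrite ltr_wpDl.
exists (e / K1); first by rewrite divr_gt0.
move=> s' s'T; rewrite ltr_pdivlMr// => m; rewrite (le_lt_trans (H _ _ sT s'T))//.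
apply: le_lt_trans m; rewrite mulrC ler_wpM2l// /K1.
by rewrite (@le_trans _ _ (Num.max K 0))// ?le_max ?lexx// lerDl.
Qed.

(** The mean value theorem for the real and the imaginary part, hence the
    factor [2]. *)
Lemma cmod_MVT u (d : R -> C) T K : 0 < T -> ccontin_on T u ->
  (forall s, 0 < s < T -> cdiff u s (d s)) ->
  (forall s, 0 < s < T -> cmod (d s) <= K) ->
  cmod (u T - u 0) <= 2 * K * T.
Proof.
move=> T0 cu du dK.
have [c1 c1T e1] : exists2 c, c \in `]0, T[ & Re (u T) - Re (u 0) = Re (d c) * (T - 0).
  apply: (MVT (f := fun s => Re (u s)) (df := fun s => Re (d s)) T0).
    by move=> s; rewrite in_itv/= => /du /cdiffP[].
  apply: within_contP => s; rewrite in_itv/= => sT e e0; have [r r0 k] := cu s sT e e0.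
  exists r => // s'; rewrite in_itv/= => /k k' /k'; apply: le_lt_trans.
  by rewrite -Re_N -Re_D Re_le_cmod.
have [c2 c2T e2] : exists2 c, c \in `]0, T[ & Im (u T) - Im (u 0) = Im (d c) * (T - 0).
  apply: (MVT (f := fun s => Im (u s)) (df := fun s => Im (d s)) T0).
    by move=> s; rewrite in_itv/= => /du /cdiffP[].
  apply: within_contP => s; rewrite in_itv/= => sT e e0; have [r r0 k] := cu s sT e e0.
  exists r => // s'; rewrite in_itv/= => /k k' /k'; apply: le_lt_trans.
  by rewrite -Im_N -Im_D Im_le_cmod.
rewrite (le_trans (cmod_le _))// !(Re_D, Im_D, Re_N, Im_N) e1 e2 subr0 !normrM.
rewrite -mulrDl (ger0_norm (ltW T0)) ler_wpM2r ?(ltW T0)//.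
rewrite in_itv/= in c1T; rewrite in_itv/= in c2T.
have := le_trans (Re_le_cmod _) (dK _ c1T); have := le_trans (Im_le_cmod _) (dK _ c2T).
by lra.
Qed.

Lemma cdiff_scale_arg u (c : R) s d : cdiff u (c * s) d -> cdiff (fun y => u (c * y)) s (c%:C * d).
Proof.
move=> H e e0; have d0 : 0 < e / (`|c| + 1) by rewrite divr_gt0// ltr_wpDl.
have [r r0 k] := H _ d0; exists (r / (`|c| + 1)); first by rewrite divr_gt0// ltr_wpDl.
move=> h; rewrite ltr_pdivlMr ?ltr_wpDl// => hr.
have hc : `|c * h| < r.
  by rewrite normrM (le_lt_trans _ hr)// mulrC ler_wpM2l// lerDl.
have -> : u (c * (s + h)) - u (c * s) - h%:C * (c%:C * d) =
    u (c * s + c * h) - u (c * s) - (c * h)%:C * d.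
  by rewrite mulrDr rmorphM/=; ring.
have := k _ hc => m.
rewrite (le_trans m)// normrM mulrA ler_wpM2r// mulrAC -mulrA ler_piMr ?(ltW e0)//.
by rewrite ler_pdivrMr ?ltr_wpDl// mul1r lerDl.
Qed.

Lemma cdiff_shift_arg u x s d : cdiff u (x + s) d -> cdiff (fun y => u (x + y)) s d.
Proof. by move=> H e /H[r r0 k]; exists r => // h /k; rewrite addrA. Qed.

Lemma cmod_MVT_local u (d : R -> C) x r K : (forall y, cdiff u y (d y)) ->
  (forall y, `|y - x| < r -> cmod (d y) <= K) ->
  forall h, `|h| < r -> cmod (u (x + h) - u x) <= 2 * K * `|h|.
Proof.
move=> du dK h hr; have [->|h0] := eqVneq h 0.
  by rewrite addr0 subrr cmod0 normr0 mulr0.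
have h0' : 0 < `|h| by rewrite normr_gt0.
pose c := Num.sg h; have ch : c * `|h| = h by rewrite /c -numEsg.
have c1 : `|c| = 1 by rewrite /c normr_sg h0.
have dv s : cdiff (fun y => u (x + c * y)) s (c%:C * d (x + c * s)).
  by apply: (@cdiff_scale_arg (fun y => u (x + y))); apply: cdiff_shift_arg; exact: du.
have := @cmod_MVT (fun y => u (x + c * y)) _ `|h| K h0' (cdiff_contin_on dv) (fun s _ => dv s).
rewrite ch mulr0 addr0; apply=> s /andP[s0 sh].
rewrite cmodM cmod_real c1 mul1r; apply: dK.
by rewrite addrAC subrr add0r normrM c1 mul1r gtr0_norm// (lt_trans sh).
Qed.

(** Termwise differentiation: the derivatives converge uniformly. *)
Lemma cdiff_termwise (F D : nat -> R -> C) u (d : R -> C) x :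
  (forall N y, cdiff (F N) y (D N y)) ->
  (forall y e, 0 < e -> exists N0, forall N, (N0 <= N)%N -> cmod (u y - F N y) <= e) ->
  (forall e, 0 < e -> exists N0, forall N, (N0 <= N)%N -> forall y, cmod (d y - D N y) <= e) ->
  ccontinuous d -> cdiff u x (d x).
Proof.
move=> dF Fu Dd /ccontinuousP cd e e0; have e40 : 0 < e / 4 by lra.
have [r r0 hr] := cd x _ e40; exists r => // h hhr.
have [N0 hN0] := Dd _ e40.
apply: le_of_eps => eta eta0; have eta20 : 0 < eta / 2 by lra.
have [N1 hN1] := Fu (x + h) _ eta20; have [N2 hN2] := Fu x _ eta20.
pose N := maxn N0 (maxn N1 N2).
have l0 : (N0 <= N)%N by rewrite leq_max leqnn.
have l1 : (N1 <= N)%N by rewrite !leq_max leqnn orbT.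
have l2 : (N2 <= N)%N by rewrite !leq_max leqnn !orbT.
pose G y := F N y - d x * y%:C.
have dG y : cdiff G y (D N y - d x).
  by rewrite -[X in _ - X]mulr1; apply: cdiffB => //; apply/cdiffZ/cdiff_real.
have := @cmod_MVT_local G _ x r (e / 2) dG.
have /[swap] /[apply] : forall y, `|y - x| < r -> cmod (D N y - d x) <= e / 2.
  move=> y /hr k; have -> : D N y - d x = (d y - d x) - (d y - D N y) by ring.
  by rewrite (le_trans (cmodB _ _))//; have := hN0 _ l0 y; lra.
move=> /(_ _ hhr); rewrite (_ : 2 * (e / 2) = e); last by lra.
move=> k; have -> : u (x + h) - u x - h%:C * d x =
  (u (x + h) - F N (x + h)) - (u x - F N x) + (G (x + h) - G x).
  by rewrite /G rmorphD/=; ring.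
rewrite (le_trans (cmodD _ _))// addrC lerD// (le_trans (cmodB _ _))//.
by have := hN1 _ l1; have := hN2 _ l2; lra.
Qed.

(** * Derivatives of Sobolev functions *)

Lemma cdiff_mode l s : cdiff (mode l) s ('i%R * l%:~R * mode l s).
Proof.
apply/cdiffP; rewrite intrC.
have -> : Re ('i%R * (l%:~R)%:C * mode l s) = - l%:~R * sin (l%:~R * s).
  by rewrite !ReImE ?Re_mode ?Im_mode; ring.
have -> : Im ('i%R * (l%:~R)%:C * mode l s) = l%:~R * cos (l%:~R * s).
  by rewrite !ReImE ?Re_mode ?Im_mode; ring.
by split; [exact: is_derive_cos_lin|exact: is_derive_sin_lin].
Qed.

Definition dx_symbol f l : C := 'i%R * l%:~R * fcoef f l.

(** The derivative, defined through its coefficients so that its Sobolev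
    regularity is immediate; [cdiff_hderiv] identifies it. *)
Definition hderiv f : R -> C := synth (dx_symbol f).

Lemma l2b_dx_symbol s B f : Hb (s + 1) B f -> l2b s B (dx_symbol f).
Proof.
move=> [_ _ hf]; rewrite -[B]mul1r; apply: (l2bM ler01 hf) => l; rewrite mul1r.
rewrite /dx_symbol 2!cmodM cmod_i mul1r intrC cmod_real whD mulrA.
exact: (ler_wpM2r (cmod_ge0 _) (ler_wpM2l (wh_ge0 _ _) (wh1 R l))).
Qed.

Lemma Hb_hderiv s B f : 2^-1 < s -> Hb (s + 1) B f -> Hb s B (hderiv f).
Proof. by move=> hs /l2b_dx_symbol; exact: Hb_synth. Qed.

(** Termwise differentiation of the Fourier series: the coefficients of the
    derivative are still absolutely summable. *)
Lemma cdiff_hderiv s B f x : 2^-1 < s -> Hb (s + 1) B f -> cdiff f x (hderiv f x).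
Proof.
move=> hs hf; have hs1 : 2^-1 < s + 1 by lra.
have fS := Hb_abs_sum hs1 hf.
have dS := l2b_abs_sum hs (l2b_dx_symbol hf).
apply: (@cdiff_termwise (partial_sum (fcoef f)) (partial_sum (dx_symbol f)) f (hderiv f)).
- move=> N y; apply: cdiff_sum => l; rewrite /dx_symbol.
  have -> : 'i%R * l%:~R * fcoef f l * mode l y = fcoef f l * ('i%R * l%:~R * mode l y) by ring.
  exact/cdiffZ/cdiff_mode.
- move=> y e /(synth_approx fS)[N0 h]; exists N0 => N /h.
  by rewrite (Hb_synthE hs1 hf); apply.
- move=> e /(synth_approx dS)[N0 h]; exists N0 => N /h; apply.
- exact: ccont_synth dS.
Qed.

Lemma cderiv_eq u s d : cdiff u s d -> cderiv u s = d.
Proof.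
move=> /cdiffP[h1 h2]; rewrite /cderiv; apply: eq_ReIm; rewrite /= derive1E; exact: derive_val.
Qed.

(** * The operators of the schemes *)

Lemma exp_opE s B f h : 2^-1 < s -> Hb s B f -> exp_op h f = shift h f.
Proof.
move=> hs hf; rewrite /exp_op (_ : (fun l : int => _) = (fun l => mode l h)).
  by rewrite shift_fmult (Hb_synthE hs hf).
apply/funext => l; apply: cexp_imag; rewrite intrC !ReImE; ring.
Qed.

Lemma sqr_le_norm (a b : R) : 0 <= b -> a ^+ 2 <= b ^+ 2 -> `|a| <= b.
Proof. by move=> b0 h; rewrite -[leRHS]ger0_norm// -ler_sqr ?nnegrE// !real_normK ?num_real. Qed.

(** For imaginary [z] the number [phi1 z] is the average of [exp (z t)] over
    the unit interval. *)
Lemma cmod_phi1 (x : R) (z : C) : Re z = 0 -> Im z = x -> cmod (phi1 z) <= 1.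
Proof.
move=> z1 z2; rewrite /phi1; case: eqVneq => [_|z0]; first by rewrite cmod1.
rewrite cmodM.
have zx : cmod z = `|x| by rewrite /cmod z1 z2 expr0n/= add0r sqrtr_sqr.
have x0 : `|x| != 0 by rewrite -zx; apply: contraNneq z0 => /cmod_eq0 ->.
have -> : cmod z^-1 = `|x|^-1.
  by apply: (mulfI x0); rewrite mulfV// -{1}zx -cmodM mulfV// cmod1.
rewrite ler_pdivrMr ?lt_def ?x0//= mul1r (cexp_imag z1 z2).
rewrite -(ger0_norm (cmod_ge0 _)); apply: sqr_le_norm => //.
rewrite cmod_sqr Re_D Im_D Re_N Im_N/= subr0.
have hx : x = x / 2 + x / 2 by lra.
have := norm_sin_le (x / 2); have := cos2Dsin2 (x / 2); have := cos2Dsin2 x.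
have -> : cos x = 1 - 2 * sin (x / 2) ^+ 2.
  by rewrite {1}hx cosD; have := cos2Dsin2 (x / 2); rewrite !expr2; lra.
set S := sin x; set v := sin (x / 2) => h1 h2 h3.
have : v ^+ 2 <= (x / 2) ^+ 2.
  by rewrite -(real_normK (num_real v)) -(real_normK (num_real (x / 2))) ler_sqr ?nnegrE.
rewrite (real_normK (num_real x)).
move: h1; nra.
Qed.

Lemma phi1_symbol_le1 (h : R) l : cmod (phi1 ('i%R * h%:C * l%:~R)) <= 1.
Proof.
by apply: (@cmod_phi1 (h * l%:~R)); rewrite intrC !ReImE; ring.
Qed.

Lemma Hb_phi1_op s B f h : 2^-1 < s -> Hb s B f -> Hb s B (phi1_op h f).
Proof. by move=> hs; apply: Hb_fmult => // l; exact: phi1_symbol_le1. Qed.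

(** The symbol of [s phi1(c s d_x)] is the primitive of that of the translation
    by [c s]. *)
Lemma cdiff_phi1_symbol (c : R) l s :
  cdiff (fun s => s%:C * phi1 ('i%R * (c * s)%:C * l%:~R)) s (mode l (c * s)).
Proof.
have [cl0|cl0] := eqVneq (c * l%:~R) 0.
  have z0 y : 'i%R * (c * y)%:C * l%:~R = 0 :> C.
    apply: eq_ReIm; rewrite intrC !ReImE; [ring|].
    by rewrite [LHS](_ : _ = (c * l%:~R) * y); [rewrite cl0 mul0r|ring].
  apply: (@cdiff_ext (fun y => y%:C)).
    by move=> y; rewrite z0 /phi1 eqxx mulr1.
  rewrite (_ : mode l (c * s) = 1); first exact: cdiff_real.
  have e0 : l%:~R * (c * s) = 0 :> R by rewrite mulrA (mulrC _ c) cl0 mul0r.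
  by apply: eq_ReIm; rewrite ?Re_mode ?Im_mode e0 ?cos0 ?sin0.
pose w : C := 'i%R * (c * l%:~R)%:C.
have w0 : w != 0.
  apply: contra_neq cl0 => /(congr1 (@complex.Im R)); rewrite /w !ReImE mul0r mul1r add0r //.
have wE y : 'i%R * (c * y)%:C * l%:~R = w * y%:C :> C.
  by rewrite /w intrC; apply: eq_ReIm; rewrite !ReImE; ring.
have expE y : cexp (w * y%:C) = mode l (c * y).
  by apply: cexp_imag; rewrite /w !ReImE; ring.
apply: (@cdiff_ext (fun y => w^-1 * (mode l (c * y) - 1))).
  move=> y; rewrite wE /phi1; case: eqVneq => [|wy0].
    move/eqP; rewrite mulf_eq0 (negbTE w0)/= => /eqP y0.
    have y0' : y = 0 by move: y0 => /(congr1 (@complex.Re R)).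
    by rewrite y0' !mulr0 mode_at0 subrr mulr0 mul0r.
  rewrite expE; have y0 : y%:C != 0 :> C by apply: contra_neq wy0 => ->; rewrite mulr0.
  by field; rewrite w0 y0.
rewrite -[mode l _](mulKf w0) -[X in w^-1 * X]subr0; apply/cdiffZ/cdiffB; last exact: cdiff_cst.
have -> : w * mode l (c * s) = c%:C * ('i%R * l%:~R * mode l (c * s)).
  by rewrite /w rmorphM/= -intrC; ring.
exact/cdiff_scale_arg/cdiff_mode.
Qed.

Lemma cdiff_phi1_op r B f (c x s : R) : 2^-1 < r -> Hb r B f ->
  cdiff (fun s => s%:C * phi1_op (c * s) f x) s (f (x + c * s)).
Proof.
move=> hr hf; have fS := Hb_abs_sum hr hf.
pose F N s := \sum_(l <- window N)
  (fcoef f l * mode l x) * (s%:C * phi1 ('i%R * (c * s)%:C * l%:~R)).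
pose D N s := partial_sum (fcoef f) N (x + c * s).
apply: (@cdiff_termwise F D (fun s => s%:C * phi1_op (c * s) f x) (fun s => f (x + c * s))).
- move=> N y.
  have -> : D N y = \sum_(l <- window N) (fcoef f l * mode l x) * mode l (c * y).
    by apply: eq_bigr => l _; rewrite modeMx mulrA.
  exact: (cdiff_sum _ (fun l => cdiffZ _ (cdiff_phi1_symbol c l y))).
- move=> y e e0; pose m l := phi1 ('i%R * (c * y)%:C * l%:~R).
  have mS : abs_sum (fun l => m l * fcoef f l) (1 * (sup_const r * B)).
    apply: (abs_sum_le ler01 fS) => l.
    by rewrite mul1r cmodM ler_piMl ?cmod_ge0 ?phi1_symbol_le1.
  have d0 : 0 < e / (`|y| + 1) by rewrite divr_gt0// ltr_wpDl.
  have [N0 h] := synth_approx mS d0; exists N0 => N /h /(_ x) k.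
  have -> : y%:C * phi1_op (c * y) f x - F N y =
      y%:C * (synth (fun l => m l * fcoef f l) x - partial_sum (fun l => m l * fcoef f l) N x).
    rewrite mulrBr /phi1_op fmultE; congr (_ - _).
    rewrite /F /partial_sum mulr_sumr; apply: eq_bigr => l _; rewrite /m; ring.
  rewrite cmodM cmod_real (le_trans (ler_wpM2l (normr_ge0 _) k))//.
  by rewrite mulrCA ler_piMr ?(ltW e0)// ler_pdivrMr ?ltr_wpDl// mul1r lerDl.
- move=> e /(synth_approx fS)[N0 h]; exists N0 => N /h k y.
  by have := k (x + c * y); rewrite (Hb_synthE hr hf).
- have /ccontinuousP cf := Hb_cont hf; apply/ccontinuousP => y e e0.
  have [d d0 hd] := cf (x + c * y) e e0.
  exists (d / (`|c| + 1)); first by rewrite divr_gt0// ltr_wpDl.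
  move=> z; rewrite ltr_pdivlMr ?ltr_wpDl// => zy; apply: hd.
  rewrite opprD addrACA subrr add0r -mulrBr normrM (le_lt_trans _ zy)//.
  by rewrite mulrC ler_wpM2l// lerDl.
Qed.

End Differentiation.

(** * A mean value inequality in Sobolev spaces *)

Section MeanValue.
Variable R : realType.
Local Notation C := R[i].
Local Notation Re := complex.Re.
Local Notation Im := complex.Im.
Local Notation mu := (@lebesgue_measure R).
Local Notation per := (`[0, 2 * pi]%classic : set R).
Implicit Types (f g u v : R -> C) (x s h e : R).

Lemma cmod_lip u (d : R -> C) T K : ccontin_on T u ->
  (forall s, 0 < s < T -> cdiff u s (d s)) ->
  (forall s, 0 < s < T -> cmod (d s) <= K) ->
  forall s s', 0 <= s <= T -> 0 <= s' <= T -> cmod (u s' - u s) <= 2 * K * `|s' - s|.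
Proof.
move=> cu du dK s s'; wlog ss : s s' / s <= s'.
  move=> H; have [ss|/ltW ss] := leP s s'; first exact: H.
  by move=> sT s'T; rewrite cmod_distC distrC; exact: H.
move=> /andP[s0 sT] /andP[s'0 s'T]; move: ss; rewrite le_eqVlt => /predU1P[->|ss].
  by rewrite !subrr cmod0 normr0 mulr0.
have L0 : 0 < s' - s by rewrite subr_gt0.
have := @cmod_MVT _ (fun y => u (s + y)) (fun y => d (s + y)) (s' - s) K L0.
rewrite addrCA subrr !addr0 gtr0_norm//; apply.
- move=> y /andP[y0 y1] e e0; have [|r r0 k] := cu (s + y) _ e e0.
    by apply/andP; split; lra.
  exists r => // z /andP[z0 z1] zy; apply: k; first by apply/andP; split; lra.
  by rewrite opprD addrACA subrr add0r.
- by move=> y /andP[y0 y1]; apply: cdiff_shift_arg; apply: du; apply/andP; split; lra.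
- by move=> y /andP[y0 y1]; apply: dK; apply/andP; split; lra.
Qed.

Lemma cont_Re f : ccontinuous f -> continuous (fun x => Re (f x)).
Proof. by case. Qed.

(** Testing against a trigonometric polynomial [P] reduces the inequality to the
    scalar mean value theorem, with differentiation under the integral sign. *)
Lemma Re_mean_MVT (Q D : R -> R -> C) (P : R -> C) T K L : 0 < T -> ccontinuous P ->
  (forall x, cmod (P x) <= L) ->
  (forall s, 0 <= s <= T -> ccontinuous (Q s)) ->
  (forall x, ccontin_on T (fun s => Q s x)) ->
  (forall x s, 0 < s < T -> cdiff (fun s => Q s x) s (D s x)) ->
  (forall x s, 0 < s < T -> cmod (D s x) <= K) ->
  exists2 c, 0 < c < T &
    Re (mean (fun x => Q T x * P x)) - Re (mean (fun x => Q 0 x * P x)) =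
    Re (mean (fun x => D c x * P x)) * T.
Proof.
move=> T0 cP PL cQ cQs dQ DK.
pose f s x := Re (Q s x * P x); pose g s x := Re (D s x * P x).
have L0 : 0 <= L by exact: le_trans (cmod_ge0 _) (PL 0).
have K0 : 0 <= K.
  by apply: le_trans (cmod_ge0 _) (DK 0 (T / 2) _); apply/andP; split; lra.
have cf s : 0 <= s <= T -> continuous (f s).
  by move=> sT; apply: cont_Re; apply: ccontM => //; exact: cQ.
have df x s : 0 < s < T -> is_derive s 1 (f^~ x) (g s x).
  move=> sT; have : cdiff (fun s => Q s x * P x) s (D s x * P x).
    rewrite (mulrC (D s x)); apply: (cdiff_ext (fun y => mulrC (P x) (Q y x))).
    exact/cdiffZ/dQ.
  by move=> /cdiffP[].
have gb x s : 0 < s < T -> `|g s x| <= K * L.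
  move=> sT; rewrite (le_trans (Re_le_cmod _))// cmodM.
  by apply: ler_pM; rewrite ?cmod_ge0// DK.
pose F s := \int[mu]_(x in per) f s x.
have dF s : 0 < s < T -> is_derive s 1 F (\int[mu]_(x in per) g s x).
  move=> sT.
  have Is : (`]0, T[%classic : set R) s by rewrite /= in_itv/=.
  have I1 y : (`]0, T[%classic : set R) y -> mu.-integrable per (EFin \o f y).
    rewrite /= in_itv/= => /andP[y0 yT]; apply: cont_integrable.
    by apply: cf; rewrite !ltW.
  have I2 (y x : R) : (`]0, T[%classic : set R) y -> per x -> derivable (f^~ x) y 1.
    by rewrite /= in_itv/= => yT _; have [] := df x y yT.
  have I3 : mu.-integrable per (EFin \o (fun=> K * L)).
    by apply: cont_integrable => x; exact: cvg_cst.
  have dval (y x : R) : 0 < y < T -> partial1of2 f y x = g y x.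
    by move=> yT; rewrite partial1of2E; have [_] := df x y yT.
  have I4 (y x : R) : (`]0, T[%classic : set R) y -> per x -> `|partial1of2 f y x| <= K * L.
    by rewrite /= in_itv/= => yT _; rewrite dval// gb.
  have KL0 (x : R) : 0 <= K * L by exact: mulr_ge0.
  have mper : measurable (per : set (measurableTypeR R)) by [].
  split.
    exact: (derivable_under_integral mper Is I1 I2 KL0 I3 I4).
  rewrite -derive1E (differentiation_under_integral mper Is I1 I2 KL0 I3 I4).
  by apply: eq_Rintegral => x _; exact: dval.
have cF : {within `[0, T], continuous F}.
  apply: within_contP => s; rewrite in_itv/= => sT e e0.
  pose M := 2 * K * L * (2 * pi) + 1.
  have tp := twopi_gt0 R.
  have M0 : 0 < M by rewrite /M ltr_wpDl// mulr_ge0 ?(ltW tp)// !mulr_ge0.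
  exists (e / M); first by rewrite divr_gt0.
  move=> s'; rewrite in_itv/= => s'T; rewrite ltr_pdivlMr// => hs.
  rewrite /F -RintegralB//; last 2 first.
  - exact/cont_integrable/cf.
  - exact/cont_integrable/cf.
  have := @Rint_sup _ (fun x => f s' x - f s x) (2 * K * L * `|s' - s|).
  move=> /(_ _ _)/le_lt_trans; apply.
  - by move=> x; apply: cvgB; exact: cf.
  - move=> x; rewrite /f -Re_N -Re_D -mulrBl (le_trans (Re_le_cmod _))// cmodM.
    rewrite mulrAC; apply: ler_pM; rewrite ?cmod_ge0//.
    exact: (cmod_lip (cQs x) (dQ x) (DK x)).
  - apply: le_lt_trans hs.
    have -> : `|s' - s| * M = 2 * K * L * `|s' - s| * (2 * pi) + `|s' - s|.
      by rewrite /M; ring.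
    by rewrite lerDl.
have dF' s : s \in `]0, T[ -> is_derive s 1 F (\int[mu]_(x in per) g s x).
  by rewrite in_itv/=; exact: dF.
have [c cT E] := MVT T0 dF' cF.
exists c; first by rewrite in_itv/= in cT.
rewrite !Re_mean -mulrBr -mulrA; congr (_ * _).
by move: E; rewrite subr0.
Qed.

(** Testing [Q T - Q 0] against its own weighted coefficients gives the square
    of its norm on the left and, by Cauchy-Schwarz, its norm times [B T] on
    the right. *)
Lemma Hb_mean_value r T B (Q D : R -> R -> C) : 2^-1 < r -> 0 < T -> 0 <= B ->
  (forall s, 0 <= s <= T -> ccontinuous (Q s)) ->
  (forall s, 0 <= s <= T -> periodic2pi (Q s)) ->
  (forall x, ccontin_on T (fun s => Q s x)) ->
  (forall x s, 0 < s < T -> cdiff (fun s => Q s x) s (D s x)) ->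
  (forall s, 0 < s < T -> Hb r B (D s)) ->
  Hb r (B * T) (fun x => Q T x - Q 0 x).
Proof.
move=> hr T0 B0 cQ pQ cQs dQ DB.
have T00 : 0 <= (0 : R) <= T by rewrite lexx ltW.
have TT : 0 <= T <= T by rewrite lexx ltW.
split; first by move=> x; rewrite !pQ.
  by apply: ccontB; exact: cQ.
split; first by rewrite mulr_ge0// ltW.
move=> t ut; pose a l := fcoef (fun x => Q T x - Q 0 x) l.
(* These weights turn the pairing with [Q T - Q 0] into the square of its
   finite [H^r] norm. *)
pose c l : C := (wh r l ^+ 2)%:C * (a l)^*%R.
pose P x := \sum_(l <- t) c l * mode (- l) x.
have cP : ccontinuous P by apply: ccont_sum => l; apply/ccontZ/ccont_mode.
have PL x : cmod (P x) <= \sum_(l <- t) cmod (c l).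
  rewrite (le_trans (cmod_sum _ _ _))//; apply: ler_sum => l _.
  by rewrite cmodM cmod_mode mulr1.
have meanP f : ccontinuous f -> mean (fun x => f x * P x) = \sum_(l <- t) c l * fcoef f l.
  move=> cf; rewrite (_ : (fun x => _) = fun x => \sum_(l <- t) c l * (f x * mode (- l) x)).
    rewrite mean_sum; last by move=> l; apply: ccontZ; apply: ccontM => //; exact: ccont_mode.
    apply: eq_bigr => l _; rewrite meanZ ?fcoefE//.
    by apply: ccontM => //; exact: ccont_mode.
  by apply/funext => x; rewrite mulr_sumr; apply: eq_bigr => l _; ring.
have DK x s : 0 < s < T -> cmod (D s x) <= sup_const r * B.
  by move=> /DB; exact: Hb_sup.
have [s sT E] := Re_mean_MVT T0 cP PL cQ cQs dQ DK.
set n := n2 _ _.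
have n0 : 0 <= n by exact: n2_ge0.
have EL : Re (mean (fun x => Q T x * P x)) - Re (mean (fun x => Q 0 x * P x)) = n ^+ 2.
  rewrite (meanP _ (cQ _ TT)) (meanP _ (cQ _ T00)).
  transitivity (Re (\sum_(l <- t) c l * fcoef (Q T) l - \sum_(l <- t) c l * fcoef (Q 0) l)).
    by rewrite Re_D Re_N.
  rewrite -sumrB n2_sqr Re_sum; apply: eq_bigr => l _.
  rewrite -mulrBr -(fcoefB _ (cQ _ TT) (cQ _ T00)) -/(a l) exprMn cmod_sqr.
  by rewrite /c !(Re_M, Im_M, Re_J, Im_J, Re_real, Im_real); ring.
have ER : Re (mean (fun x => D s x * P x)) <= n * B.
  have cD := Hb_cont (DB s sT); rewrite meanP// Re_sum.
  apply: (@le_trans _ _ (\sum_(l <- t) (wh r l * cmod (a l)) * (wh r l * cmod (fcoef (D s) l)))).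
    apply: ler_sum => l _; rewrite (le_trans (ler_norm _))// (le_trans (Re_le_cmod _))//.
    rewrite /c 2!cmodM cmodJ cmod_real ger0_norm ?sqr_ge0// le_eqVlt; apply/orP; left; apply/eqP.
    ring.
  apply: le_trans (n2_sum _ _ _) _; rewrite ler_wpM2l//.
  by have [_ _ [_]] := DB s sT; apply.
rewrite leNgt; apply/negP => nBT.
have npos : 0 < n by apply: le_lt_trans nBT; rewrite mulr_ge0// ltW.
move: E; rewrite EL => E.
have : n ^+ 2 <= n * B * T by rewrite E ler_wpM2r// ltW.
by rewrite expr2 -mulrA ler_pM2l// leNgt nBT.
Qed.

End MeanValue.

Local Opaque mul_const sup_const Hb.

(** * Polynomial nonlinearities *)

Section Expressions.
Variable R : realType.
Local Notation C := R[i].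

(** A syntax for the nonlinearities and the schemes: boundedness, Lipschitz
    continuity and Taylor expansion in [H^s] all follow by structural
    induction. *)
Inductive expr (I : Type) : Type :=
| Var of I
| Add of expr I & expr I
| Mul of expr I & expr I
| Conj of expr I
| Mult of (int -> C) & expr I
| Scale of C & expr I.

Fixpoint eval I (env : I -> R -> C) (e : expr I) : R -> C :=
  match e with
  | Var i => env i
  | Add a b => fun x => eval env a x + eval env b x
  | Mul a b => fun x => eval env a x * eval env b x
  | Conj a => fun x => (eval env a x)^*%R
  | Mult m a => fmult m (eval env a)
  | Scale z a => fun x => z * eval env a x
  end.

Fixpoint wf I (e : expr I) : Prop :=
  match e with
  | Var i => True
  | Add a b | Mul a b => wf a /\ wf b
  | Conj a | Scale _ a => wf a
  | Mult m a => (forall l, cmod (m l) <= 1) /\ wf a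
  end.

Fixpoint subst I J (sg : I -> expr J) (e : expr I) : expr J :=
  match e with
  | Var i => sg i
  | Add a b => Add (subst sg a) (subst sg b)
  | Mul a b => Mul (subst sg a) (subst sg b)
  | Conj a => Conj (subst sg a)
  | Mult m a => Mult m (subst sg a)
  | Scale z a => Scale z (subst sg a)
  end.

Lemma eval_subst I J (sg : I -> expr J) env e :
  eval env (subst sg e) = eval (fun i => eval env (sg i)) e.
Proof.
by elim: e => [//|a iha b ihb|a iha b ihb|a iha|m a iha|z a iha] /=;
  rewrite ?iha ?ihb; reflexivity.
Qed.

Lemma wf_subst I J (sg : I -> expr J) e : (forall i, wf (sg i)) -> wf e -> wf (subst sg e).
Proof.
move=> hsg; elim: e => //= [a iha b ihb [/iha ? /ihb ?]|a iha b ihb [/iha ? /ihb ?]|m a iha [? /iha ?]];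
  by split.
Qed.

Lemma eval_ext I (env env' : I -> R -> C) e : (forall i, env i = env' i) ->
  eval env e = eval env' e.
Proof. by move=> h; congr (eval _ e); apply/funext. Qed.

(** The directional derivative, in the doubled set of variables: [inl] for the
    base point and [inr] for the direction. *)
Fixpoint dexpr I (e : expr I) : expr (I + I) :=
  match e with
  | Var i => Var (inr i)
  | Add a b => Add (dexpr a) (dexpr b)
  | Mul a b => Add (Mul (dexpr a) (subst (fun i => Var (inl i)) b))
                   (Mul (subst (fun i => Var (inl i)) a) (dexpr b))
  | Conj a => Conj (dexpr a)
  | Mult m a => Mult m (dexpr a)
  | Scale z a => Scale z (dexpr a)
  end.

Definition env2 I (x h : I -> R -> C) (j : I + I) : R -> C :=
  match j with inl i => x i | inr i => h i end.

Lemma wf_dexpr I (e : expr I) : wf e -> wf (dexpr e).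
Proof.
elim: e => //= [a iha b ihb [/iha ? /ihb ?]|a iha b ihb [wa wb]|m a iha [? /iha ?]]; try by split.
by split; split; [exact: iha|exact: wf_subst|exact: wf_subst|exact: ihb].
Qed.

Variable s : R.
Hypothesis hs : 2^-1 < s.

(** The next three functions compute, on the ball of radius [B] of the
    environments, a bound, a Lipschitz constant and a constant for the
    quadratic Taylor remainder. *)
Fixpoint bound_const I (e : expr I) (B : R) : R :=
  match e with
  | Var i => B
  | Add a b => bound_const a B + bound_const b B
  | Mul a b => mul_const s * bound_const a B * bound_const b B
  | Conj a => bound_const a B
  | Mult m a => bound_const a B
  | Scale z a => cmod z * bound_const a B
  end.

Fixpoint lip_const I (e : expr I) (B : R) : R :=
  match e with
  | Var i => 1
  | Add a b => lip_const a B + lip_const b B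
  | Mul a b => mul_const s * lip_const a B * bound_const b B + mul_const s * bound_const a B * lip_const b B
  | Conj a => lip_const a B
  | Mult m a => lip_const a B
  | Scale z a => cmod z * lip_const a B
  end.

Fixpoint taylor_const I (e : expr I) (B : R) : R :=
  match e with
  | Var i => 0
  | Add a b => taylor_const a B + taylor_const b B
  | Mul a b => mul_const s * taylor_const a B * bound_const b B + mul_const s * bound_const a B * taylor_const b B +
               mul_const s * lip_const a B * lip_const b B
  | Conj a => taylor_const a B
  | Mult m a => taylor_const a B
  | Scale z a => cmod z * taylor_const a B
  end.

Lemma bound_const_ge0 I (e : expr I) B : 0 <= B -> 0 <= bound_const e B.
Proof.
move=> B0; have k0 := mul_const_ge0 hs.
elim: e => //= [a iha b ihb|a iha b ihb|z a iha].
- exact: addr_ge0.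
- exact: mulr_ge0 (mulr_ge0 k0 iha) ihb.
- by rewrite mulr_ge0 ?cmod_ge0.
Qed.

Lemma lip_const_ge0 I (e : expr I) B : 0 <= B -> 0 <= lip_const e B.
Proof.
move=> B0; have k0 := mul_const_ge0 hs.
elim: e => //= [a iha b ihb|a iha b ihb|z a iha].
- exact: addr_ge0.
- by rewrite addr_ge0// (mulr_ge0 (mulr_ge0 k0 _))// bound_const_ge0.
- by rewrite mulr_ge0 ?cmod_ge0.
Qed.

Lemma taylor_const_ge0 I (e : expr I) B : 0 <= B -> 0 <= taylor_const e B.
Proof.
move=> B0; have k0 := mul_const_ge0 hs.
elim: e => //= [a iha b ihb|a iha b ihb|z a iha].
- exact: addr_ge0.
- by rewrite !addr_ge0// (mulr_ge0 (mulr_ge0 k0 _))// ?bound_const_ge0 ?lip_const_ge0.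
- by rewrite mulr_ge0 ?cmod_ge0.
Qed.

Lemma Hb_eval I (e : expr I) B env : wf e -> (forall i, Hb s B (env i)) ->
  Hb s (bound_const e B) (eval env e).
Proof.
move=> + henv; elim: e => /= [i _|a iha b ihb [/iha ha /ihb hb]|a iha b ihb [/iha ha /ihb hb]|
  a iha /iha ha|m a iha [hm /iha ha]|z a iha /iha ha].
- exact: henv.
- exact: HbD.
- exact: HbM.
- exact: HbJ.
- exact: Hb_fmult.
- exact: HbZ.
Qed.

Lemma Hb_eval_lip I (e : expr I) B d x y : wf e -> (forall i, Hb s B (x i)) ->
  (forall i, Hb s B (y i)) -> (forall i, Hb s d (fun z => x i z - y i z)) ->
  Hb s (lip_const e B * d) (fun z => eval x e z - eval y e z).
Proof.
move=> + hx hy hd; elim: e => /= [i _|a iha b ihb [wa wb]|a iha b ihb [wa wb]|a iha wa|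
  m a iha [hm wa]|z a iha wa].
- by rewrite mul1r.
- rewrite mulrDl; apply: Hb_ext (HbD (iha wa) (ihb wb)) => z; ring.
- have ha := Hb_eval wa hy; have hb := Hb_eval wb hx.
  have := HbD (HbM hs (iha wa) hb) (HbM hs ha (ihb wb)).
  rewrite [X in Hb s X _](_ : _ = (mul_const s * lip_const a B * bound_const b B + mul_const s * bound_const a B * lip_const b B) * d); last by ring.
  by apply: Hb_ext => z; ring.
- by apply: Hb_ext (HbJ (iha wa)) => z; rewrite rmorphB.
- have ha := Hb_eval wa hx; have hb := HbN (Hb_eval wa hy).
  apply: Hb_ext (Hb_fmult hs hm (iha wa)) => z.
  have -> : (fun z => eval x a z - eval y a z) = (fun z => eval x a z + -1 * eval y a z).
    by apply/funext => t; rewrite mulN1r.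
  by rewrite (fmultD hs hm ha (HbZ (-1) (Hb_eval wa hy))) (fmultZ _ hs hm (Hb_eval wa hy)) mulN1r.
- rewrite -mulrA; apply: Hb_ext (HbZ z (iha wa)) => t; ring.
Qed.

Lemma Hb_dexpr I (e : expr I) B d x h : wf e -> (forall i, Hb s B (x i)) ->
  (forall i, Hb s d (h i)) -> Hb s (lip_const e B * d) (eval (env2 x h) (dexpr e)).
Proof.
move=> + hx hh; elim: e => /= [i _|a iha b ihb [wa wb]|a iha b ihb [wa wb]|a iha wa|
  m a iha [hm wa]|z a iha wa].
- by rewrite mul1r.
- by rewrite mulrDl; exact: HbD (iha wa) (ihb wb).
- rewrite !eval_subst /=.
  have := HbD (HbM hs (iha wa) (Hb_eval wb hx)) (HbM hs (Hb_eval wa hx) (ihb wb)).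
  by rewrite [X in Hb s X _](_ : _ = (mul_const s * lip_const a B * bound_const b B + mul_const s * bound_const a B * lip_const b B) * d);
    last by ring.
- exact: HbJ (iha wa).
- exact: Hb_fmult hs hm (iha wa).
- by rewrite -mulrA; exact: HbZ (iha wa).
Qed.

(** The remainder of a product is made of products of a value and a remainder,
    and of one product of two increments. *)
Lemma Hb_taylor I (e : expr I) B d x y : wf e -> (forall i, Hb s B (x i)) ->
  (forall i, Hb s B (y i)) -> (forall i, Hb s d (fun z => x i z - y i z)) ->
  Hb s (taylor_const e B * d ^+ 2) (fun z => eval x e z - eval y e z -
    eval (env2 y (fun i z => x i z - y i z)) (dexpr e) z).
Proof.
move=> + hx hy hd; set hh := fun i z => x i z - y i z.
elim: e => /= [i _|a iha b ihb [wa wb]|a iha b ihb [wa wb]|a iha wa|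
  m a iha [hm wa]|z a iha wa].
- by rewrite mul0r; apply: Hb_ext (Hb0 s) => z; rewrite subrr.
- rewrite mulrDl; apply: Hb_ext (HbD (iha wa) (ihb wb)) => z; ring.
- rewrite !eval_subst /=.
  have ha := Hb_eval wa hy; have hb := Hb_eval wb hx.
  have la := Hb_dexpr wa hy hd; have lb := Hb_eval_lip wb hx hy hd.
  have := HbD (HbD (HbM hs (iha wa) hb) (HbM hs ha (ihb wb))) (HbM hs la lb).
  rewrite [X in Hb s X _](_ : _ = (mul_const s * taylor_const a B * bound_const b B + mul_const s * bound_const a B * taylor_const b B +
    mul_const s * lip_const a B * lip_const b B) * d ^+ 2); last by ring.
  by apply: Hb_ext => z; ring.
- by apply: Hb_ext (HbJ (iha wa)) => z; rewrite !rmorphB.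
- have hax := Hb_eval wa hx; have hay := Hb_eval wa hy; have hd' := Hb_dexpr wa hy hd.
  apply: Hb_ext (Hb_fmult hs hm (iha wa)) => z.
  set X := eval x a in hax *; set Y := eval y a in hay *.
  set Z := eval _ (dexpr a) in hd' *.
  have -> : (fun z => X z - Y z - Z z) = (fun z => (X z + -1 * Y z) + -1 * Z z).
    by apply/funext => t; rewrite !mulN1r.
  rewrite (fmultD hs hm (HbD hax (HbZ (-1) hay)) (HbZ (-1) hd')).
  rewrite (fmultD hs hm hax (HbZ (-1) hay)) (fmultZ _ hs hm hay) (fmultZ _ hs hm hd').
  by rewrite (mulN1r (fmult m Y z)) (mulN1r (fmult m Z z)).
- rewrite -mulrA; apply: Hb_ext (HbZ z (iha wa)) => t; ring.
Qed.

(** Real scalars only: because of [Conj] the derivative is merely real-linear.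
    *)
Lemma dexpr_scale I (e : expr I) B d x h (c : R) : wf e -> (forall i, Hb s B (x i)) ->
  (forall i, Hb s d (h i)) ->
  eval (env2 x (fun i z => c%:C * h i z)) (dexpr e) =
  (fun z => c%:C * eval (env2 x h) (dexpr e) z).
Proof.
move=> + hx hh; elim: e => //= [a iha b ihb [wa wb]|a iha b ihb [wa wb]|a iha wa|
  m a iha [hm wa]|z a iha wa].
- by rewrite (iha wa) (ihb wb); apply/funext => z; ring.
- by rewrite !eval_subst /= (iha wa) (ihb wb); apply/funext => z; ring.
- rewrite (iha wa); apply/funext => z; rewrite rmorphM/=; congr (_ * _).
  by rewrite conjcE conjc_real.
- by rewrite (iha wa) (fmultZ _ hs hm (Hb_dexpr wa hx hh)).
- by rewrite (iha wa); apply/funext => t; ring.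
Qed.

(** Fourier multipliers commute with translations, so the nonlinearities do.
    *)
Lemma eval_shift I (e : expr I) B env c : wf e -> (forall i, Hb s B (env i)) ->
  eval (fun i => shift c (env i)) e = shift c (eval env e).
Proof.
move=> + henv; elim: e => //= [a iha b ihb [wa wb]|a iha b ihb [wa wb]|a iha wa|
  m a iha [hm wa]|z a iha wa].
- by rewrite (iha wa) (ihb wb).
- by rewrite (iha wa) (ihb wb).
- by rewrite (iha wa).
- by rewrite (iha wa) (fmult_shift _ hs hm (Hb_eval wa henv)).
- by rewrite (iha wa).
Qed.

End Expressions.
Arguments Var {R I} _.

(** * Local error *)

Section LocalError.
Variable R : realType.
Local Notation C := R[i].

(** The two characteristic components of the spinor and the external
    potential. *)
Inductive var3 : Type := vp | vq | vv.

Definition env3 (p q V : R -> C) (i : var3) : R -> C :=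
  match i with vp => p | vq => q | vv => V end.

Definition swap_var (i : var3) : expr R var3 :=
  match i with vp => Var vq | vq => Var vp | vv => Var vv end.

(** The direction in which the correction differentiates the rate: the
    velocities [- i N] of the two profiles, and no motion of the potential. *)
Definition corr_subst (E : expr R var3) (j : var3 + var3) : expr R var3 :=
  match j with
  | inl i => Var i
  | inr vp => Scale (- 'i%R) E
  | inr vq => Scale (- 'i%R) (subst swap_var E)
  | inr vv => Scale 0 (Var vv)
  end.

(** The second-order correction of the schemes is [- tau ^ 2 / 2] times this
    expression. *)
Definition corr (E : expr R var3) : expr R var3 :=
  Scale 'i%R (subst (corr_subst E) (dexpr E)).

Lemma wf_swap E : wf E -> wf (subst swap_var E).
Proof. by apply: wf_subst; case. Qed.

Lemma wf_corr E : wf E -> wf (corr E).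
Proof.
move=> wE /=; apply: wf_subst; last exact: wf_dexpr.
by case=> [i|[]] //=; exact: wf_swap.
Qed.

Lemma eval_swap p q V E : eval (env3 p q V) (subst swap_var E) = eval (env3 q p V) E.
Proof. by rewrite eval_subst; apply: eval_ext; case. Qed.

Lemma eval_corr p q V E : eval (env3 p q V) (corr E) =
  (fun x => 'i%R * eval (env2 (env3 p q V)
     (env3 (fun y => - 'i%R * eval (env3 p q V) E y)
           (fun y => - 'i%R * eval (env3 q p V) E y) (fun y => 0 * V y))) (dexpr E) x).
Proof.
rewrite /= eval_subst; apply/funext => x; congr (_ * _).
rewrite (eval_ext (env' := env2 (env3 p q V)
     (env3 (fun y => - 'i%R * eval (env3 p q V) E y)
           (fun y => - 'i%R * eval (env3 q p V) E y) (fun y => 0 * V y))))//.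
by case=> [i|[]] //=; rewrite eval_swap.
Qed.

Lemma Hb_env3 s A (p q V : R -> C) i : Hb s A p -> Hb s A q -> Hb s A V -> Hb s A (env3 p q V i).
Proof. by move=> hp hq hV; case: i; [exact: hp|exact: hq|exact: hV]. Qed.

Lemma Hb_env3B s A (p q V p' q' V' : R -> C) : Hb s A (fun x => p x - p' x) ->
  Hb s A (fun x => q x - q' x) -> Hb s A (fun x => V x - V' x) ->
  forall i, Hb s A (fun x => env3 p q V i x - env3 p' q' V' i x).
Proof. by move=> hp hq hV; case; [exact: hp|exact: hq|exact: hV]. Qed.

Lemma ccontin_on_sub T T' (u : R -> C) : T' <= T -> ccontin_on T u -> ccontin_on T' u.
Proof.
move=> TT H s /andP[s0 sT] e e0.
have [|d d0 k] := H s _ e e0; first by rewrite s0 (le_trans sT).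
by exists d => // s' /andP[s'0 s'T]; apply: k; rewrite s'0 (le_trans s'T).
Qed.

Lemma cdiffZr (u : R -> C) s d z : cdiff u s d -> cdiff (fun y => u y * z) s (d * z).
Proof.
move=> h; rewrite mulrC; apply: (cdiff_ext (u := fun y => z * u y)).
  by move=> y; exact: mulrC.
exact: cdiffZ.
Qed.

Lemma cdiff_lin (z : C) s : cdiff (fun y => y%:C * z) s z.
Proof. by have := cdiffZr z (cdiff_real s); rewrite mul1r. Qed.

Lemma cmod_Ni : cmod (- 'i%R : C) = 1.
Proof. by rewrite cmodN cmod_i. Qed.

Lemma Hb_Ni s A (f : R -> C) : Hb s A f -> Hb s A (fun x => - 'i%R * f x).
Proof. by move=> /(HbZ (- 'i%R)); rewrite cmod_Ni mul1r. Qed.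

Lemma shift0 (f : R -> C) : shift 0 f = f.
Proof. by apply/funext => x; rewrite /shift addr0. Qed.

(** The profiles [u], [w] are the two components of the solution transported along
    the two families of characteristics, which cross at relative speed [2 sg]. *)
Definition twisted (E : expr R var3) V (tau sg : R) (u w : R -> R -> C) :=
  forall x s, 0 < s < tau -> cdiff (fun s => u s x) s
    (- 'i%R * eval (env3 (u s) (shift (2 * (sg * s)) (w s)) (shift (sg * s) V)) E x).

Variables (r : R) (E : expr R var3) (B BV : R).
Hypotheses (hr : 2^-1 < r) (wE : wf E) (B0 : 0 <= B) (BV0 : 0 <= BV).
Let A := B + BV.
Let A0 : 0 <= A. Proof. exact: addr_ge0. Qed.
Let e1 := bound_const r E A.
Let e10 : 0 <= e1. Proof. exact: bound_const_ge0. Qed.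
Let g1 := bound_const (r + 1) E A.
Let hr1 : 2^-1 < r + 1. Proof. by move: hr; lra. Qed.
Let g10 : 0 <= g1. Proof. exact: bound_const_ge0. Qed.
Let d1 := e1 + 4 * B + 2 * BV.
Let d10 : 0 <= d1. Proof. by rewrite !addr_ge0// mulr_ge0. Qed.
Let k2 := lip_const r E A * d1.
Let k20 : 0 <= k2. Proof. by rewrite mulr_ge0// lip_const_ge0. Qed.

Section Profiles.
Variables (V : R -> C) (tau sg : R) (u w : R -> R -> C).
Hypotheses (tau0 : 0 < tau) (tau1 : tau <= 1) (sg1 : `|sg| <= 1).
Hypothesis HV : Hb (r + 1) BV V.
Hypothesis Hu : forall s, 0 <= s <= tau -> Hb (r + 1) B (u s).
Hypothesis Hw : forall s, 0 <= s <= tau -> Hb (r + 1) B (w s).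
Hypothesis cu : forall x, ccontin_on tau (fun s => u s x).
Hypothesis tw : twisted E V tau sg u w.

Let lower f a : Hb (r + 1) a f -> Hb r a f.
Proof. by apply: Hb_lower; rewrite lerDl. Qed.

Let T0 : 0 <= (0 : R) <= tau. Proof. by rewrite lexx ltW. Qed.

Let Henv s a : 0 <= s <= tau ->
  forall i, Hb r A (env3 (u s) (shift a (w s)) (shift (sg * s) V) i).
Proof.
move=> sT i; apply: Hb_env3.
- by apply: Hb_le (lower (Hu sT)); rewrite lerDl.
- by apply: Hb_shift => //; apply: Hb_le (lower (Hw sT)); rewrite lerDl.
- by apply: Hb_shift => //; apply: Hb_le (lower HV); rewrite lerDr.
Qed.

(** Pointwise, the velocity of a profile is bounded by the rate; the mean
    value inequality in [H^r] makes this a Lipschitz bound. *)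
Lemma profile_lip s : 0 <= s <= tau -> Hb r (e1 * s) (fun x => u s x - u 0 x).
Proof.
move=> /andP[]; rewrite le_eqVlt => /predU1P[<- _|s0 sT].
  by rewrite mulr0; apply: Hb_ext (Hb0 r) => x; rewrite subrr.
have sub y : 0 <= y <= s -> 0 <= y <= tau.
  by move=> /andP[-> ys]; exact: le_trans sT.
apply: (Hb_mean_value (D := fun s x => - 'i%R *
    eval (env3 (u s) (shift (2 * (sg * s)) (w s)) (shift (sg * s) V)) E x)) => //.
- by move=> y /sub /Hu /Hb_cont.
- by move=> y /sub /Hu /Hb_per.
- by move=> x; apply: ccontin_on_sub (cu x).
- by move=> x y /andP[y0 ys]; apply: tw; rewrite y0 (lt_le_trans ys).
- move=> y /andP[y0 ys]; apply/Hb_Ni/Hb_eval => //; apply: Henv.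
  by rewrite ltW//= (le_trans (ltW ys)).
Qed.

Hypothesis lw : forall s, 0 <= s <= tau -> Hb r (e1 * s) (fun x => w s x - w 0 x).

Let shift_lip s c f a : 0 <= s -> `|c| <= 1 -> Hb (r + 1) a f ->
  Hb r (2 * s * a) (fun x => shift (c * s) f x - f x).
Proof.
move=> s0 c1 hf; apply: Hb_le (Hb_shift_sub (c * s) hr hf).
rewrite ler_wpM2r ?(Hb_ge0 hf)// ler_wpM2l// normrM (ger0_norm s0).
by rewrite ler_piMl.
Qed.

Let shift_lip2 s f a : 0 <= s -> Hb (r + 1) a f ->
  Hb r (4 * s * a) (fun x => shift (2 * (sg * s)) f x - f x).
Proof.
move=> s0 hf; apply: Hb_le (Hb_shift_sub (2 * (sg * s)) hr hf).
rewrite ler_wpM2r ?(Hb_ge0 hf)// !normrM (ger0_norm s0) (ger0_norm (_ : 0 <= 2))//.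
have : `|sg| * s <= s by rewrite ler_piMl.
lra.
Qed.

Let HG : Hb r e1 (eval (env3 (u 0) (w 0) V) E).
Proof.
have := Henv (2 * (sg * 0)) T0; rewrite !mulr0 !shift0 => h; exact: Hb_eval.
Qed.

(** The velocity varies with the profiles, by the preceding bound for both
    components, and with the relative translation, which costs one derivative.
    *)
Lemma profile_expand s : 0 <= s <= tau ->
  Hb r (k2 * s ^+ 2) (fun x => u s x - u 0 x + 'i%R * (s%:C * eval (env3 (u 0) (w 0) V) E x)).
Proof.
move=> /andP[]; rewrite le_eqVlt => /predU1P[<- _|s0 sT].
  by rewrite expr0n mulr0; apply: Hb_ext (Hb0 r) => x; rewrite subrr mul0r mulr0 addr0.
set G := eval (env3 (u 0) (w 0) V) E.
have HG' : Hb r e1 G := HG.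
have sub y : 0 <= y <= s -> 0 <= y <= tau.
  by move=> /andP[-> ys]; exact: le_trans sT.
pose Q y x := u y x + 'i%R * (y%:C * G x).
pose D y x := - 'i%R * eval (env3 (u y) (shift (2 * (sg * y)) (w y)) (shift (sg * y) V)) E x
  + 'i%R * G x.
rewrite (_ : k2 * s ^+ 2 = k2 * s * s); last by rewrite expr2 mulrA.
have H := @Hb_mean_value _ r s (k2 * s) Q D hr s0.
apply: Hb_ext (H _ _ _ _ _ _) => [x|||||x y /andP[y0 ys]|y /andP[y0 ys]].
- by rewrite /Q mul0r mulr0 addr0; ring.
- by rewrite mulr_ge0// ltW.
- move=> y /sub yT; apply: ccontD; first exact: Hb_cont (Hu yT).
  by do 2 apply: ccontZ; exact: Hb_cont HG.
- by move=> y /sub yT x; rewrite /Q (Hb_per (Hu yT)) (Hb_per HG').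
- move=> x; apply: ccontin_onD; first exact: ccontin_on_sub (cu x).
  apply: (cdiff_contin_on (d := fun=> 'i%R * G x)) => y.
  exact/cdiffZ/cdiff_lin.
- apply: cdiffD; first by apply: tw; rewrite y0 (lt_le_trans ys).
  exact/cdiffZ/cdiff_lin.
have yT : 0 <= y <= tau by rewrite ltW//= (le_trans (ltW ys)).
have y1 : 0 <= y by exact: ltW.
have h0 := Henv (2 * (sg * 0)) T0; rewrite !mulr0 !shift0 in h0.
have dd : forall i, Hb r (d1 * s) (fun x =>
    env3 (u y) (shift (2 * (sg * y)) (w y)) (shift (sg * y) V) i x - env3 (u 0) (w 0) V i x).
  have ys' := ltW ys.
  apply: Hb_env3B.
  - apply: Hb_le (profile_lip yT); apply: (@le_trans _ _ (e1 * s)); first by rewrite ler_wpM2l.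
    by rewrite ler_wpM2r ?(ltW s0)// /d1 -addrA lerDl addr_ge0// mulr_ge0.
  - have h1 := Hb_shift (2 * (sg * y)) hr (lw yT).
    have h2 := shift_lip2 y1 (Hw T0).
    apply: Hb_le (Hb_ext _ (HbD h1 h2)) => [|x]; last by rewrite /shift; ring.
    have := ler_wpM2l e10 ys'; have := ler_wpM2l B0 ys'.
    have : 0 <= BV * s by rewrite mulr_ge0// ltW.
    by rewrite /d1; lra.
  - apply: Hb_le (shift_lip y1 sg1 HV).
    have := ler_wpM2l BV0 ys'; have : 0 <= e1 * s by rewrite mulr_ge0// ltW.
    have : 0 <= B * s by rewrite mulr_ge0// ltW.
    by rewrite /d1; lra.
have := Hb_Ni (Hb_eval_lip hr wE (Henv (2 * (sg * y)) yT) h0 dd).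
rewrite mulrA; apply: Hb_ext => x; rewrite /D /G; ring.
Qed.

End Profiles.

Section Step.
Variables (V : R -> C) (tau sg : R) (u w : R -> R -> C).
Hypotheses (tau0 : 0 < tau) (tau1 : tau <= 1) (sg1 : `|sg| <= 1).
Hypothesis HV : Hb (r + 1) BV V.
Hypothesis Hu : forall s, 0 <= s <= tau -> Hb (r + 1) B (u s).
Hypothesis Hw : forall s, 0 <= s <= tau -> Hb (r + 1) B (w s).
Hypothesis cu : forall x, ccontin_on tau (fun s => u s x).
Hypothesis cw : forall x, ccontin_on tau (fun s => w s x).
Hypothesis tu : twisted E V tau sg u w.
Hypothesis tw : twisted E V tau (- sg) w u.
Variable W : R -> R -> C.
Hypothesis cW : forall s, 0 <= s <= tau -> ccontinuous (W s).
Hypothesis pW : forall s, 0 <= s <= tau -> periodic2pi (W s).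
Hypothesis W0 : forall x, W 0 x = 0.
Hypothesis csW : forall x, ccontin_on tau (fun s => W s x).
Hypothesis dW : forall x s, 0 < s < tau -> cdiff (fun s => W s x) s
  (eval (env3 (u 0) (shift (2 * (sg * s)) (w 0)) (shift (sg * s) V)) E x).

Let lower f a : Hb (r + 1) a f -> Hb r a f.
Proof. by apply: Hb_lower; rewrite lerDl. Qed.

Let T0 : 0 <= (0 : R) <= tau. Proof. by rewrite lexx ltW. Qed.

Let A2 := A + e1 + 1.
Let kloc := taylor_const r E A * e1 ^+ 2 + lip_const r (dexpr E) A2 * k2 +
  lip_const r (dexpr E) A2 * (4 * A + 4 * g1).

(** The increment of the rate is Taylor expanded at the transported initial
    profiles [y s]; the integral [W] of the rate along [y s] is what the
    scheme computes exactly. The linear term is evaluated in the direction [s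
    h0 s] and then with its translations undone, which costs one derivative
    and one power of time: the remaining velocity is [O (s ^ 2)]. *)
Lemma local_twisted : Hb r (kloc * tau ^+ 3) (fun x => u tau x - (u 0 x - 'i%R * W tau x) +
    (tau ^+ 2 / 2)%:C * eval (env3 (u 0) (w 0) V) (corr E) x).
Proof.
have Nsg1 : `|- sg| <= 1 by rewrite normrN.
have lu := profile_lip HV Hu Hw cu tu.
have lw := profile_lip HV Hw Hu cw tw.
have xu := profile_expand tau0 sg1 HV Hu Hw cu tu lw.
have xw := profile_expand tau0 Nsg1 HV Hw Hu cw tw lu.
set G := eval (env3 (u 0) (w 0) V) E in xu.
set G' := eval (env3 (w 0) (u 0) V) E in xw.
have env0 (p q : R -> C) s : Hb (r + 1) B p -> Hb (r + 1) B q ->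
    forall i, Hb (r + 1) A (env3 p q (shift s V) i).
  move=> hp hq i; apply: Hb_env3.
  - by apply: Hb_le hp; rewrite lerDl.
  - by apply: Hb_le hq; rewrite lerDl.
  - by apply: Hb_shift => //; apply: Hb_le HV; rewrite lerDr.
have HG1 : Hb (r + 1) g1 G.
  by have := env0 _ _ 0 (Hu T0) (Hw T0); rewrite shift0 => h; exact: Hb_eval.
have HG1' : Hb (r + 1) g1 G'.
  by have := env0 _ _ 0 (Hw T0) (Hu T0); rewrite shift0 => h; exact: Hb_eval.
have HG : Hb r e1 G.
  have := env0 _ _ 0 (Hu T0) (Hw T0); rewrite shift0 => h.
  by apply: Hb_eval => // i; apply: lower.
have HG' : Hb r e1 G'.
  have := env0 _ _ 0 (Hw T0) (Hu T0); rewrite shift0 => h.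
  by apply: Hb_eval => // i; apply: lower.
set Ec := eval (env3 (u 0) (w 0) V) (corr E).
pose y0 := env3 (u 0) (w 0) V.
pose k0 := env3 (fun y => - 'i%R * G y) (fun y => - 'i%R * G' y) (fun y => 0 * V y).
have EcE x : Ec x = 'i%R * eval (env2 y0 k0) (dexpr E) x by rewrite /Ec eval_corr.
pose y s := env3 (u 0) (shift (2 * (sg * s)) (w 0)) (shift (sg * s) V).
pose X s := env3 (u s) (shift (2 * (sg * s)) (w s)) (shift (sg * s) V).
pose h s i x := X s i x - y s i x.
pose h0 s := env3 (fun z => - 'i%R * G z) (shift (2 * (sg * s)) (fun z => - 'i%R * G' z))
  (fun z => 0 * V z).
have A2A : A <= A2 by rewrite /A2 -addrA lerDl addr_ge0.
have A2e : e1 <= A2 by rewrite /A2 addrAC lerDr addr_ge0.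
have A20 : 0 <= A2 by exact: le_trans A2A.
have Hy s : forall i, Hb r A (y s i).
  move=> i; apply/lower; apply: env0; [exact: Hu|apply: Hb_shift => //; exact: Hw].
have HX s : 0 <= s <= tau -> forall i, Hb r A (X s i).
  move=> sT i; apply/lower; apply: env0; [exact: Hu|apply: Hb_shift => //; exact: Hw].
have Hh s : 0 <= s <= tau -> forall i, Hb r (e1 * s) (h s i).
  move=> sT; apply: Hb_env3B; first exact: lu.
  - exact: (Hb_shift (2 * (sg * s)) hr (lw _ sT)).
  - apply: Hb_le (Hb_ext _ (Hb0 r)); last by move=> x; rewrite subrr.
    by rewrite mulr_ge0//; case/andP: sT.
have Hh0 s : forall i, Hb r e1 (h0 s i).
  case=> /=; [exact: Hb_Ni|exact/Hb_shift/Hb_Ni|].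
  by apply: Hb_le e10 (Hb_ext _ (Hb0 r)) => x; rewrite mul0r.
have Hhh s : 0 <= s <= tau -> forall i, Hb r (k2 * s ^+ 2) (fun x => h s i x - s%:C * h0 s i x).
  move=> sT; case; rewrite /h /h0 /=.
  - by apply: Hb_ext (xu _ sT) => x; rewrite /G; ring.
  - apply: Hb_ext (Hb_shift (2 * (sg * s)) hr (xw _ sT)) => x; rewrite /shift /G'; ring.
  - apply: Hb_le (Hb_ext _ (Hb0 r)); last by move=> x; rewrite subrr mul0r mulr0 subrr.
    by rewrite mulr_ge0// sqr_ge0.
have s_le s : 0 <= s <= tau -> s <= 1 by case/andP=> _ /le_trans; apply.
have Dbound s : 0 <= s <= tau -> Hb r (kloc * s ^+ 2) (fun x =>
    - 'i%R * (eval (X s) E x - eval (y s) E x) + s%:C * Ec x).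
  move=> sT; have /andP[s0 _] := sT; have s1 := s_le _ sT.
  have B1 : Hb r (taylor_const r E A * e1 ^+ 2 * s ^+ 2) (fun x =>
      eval (X s) E x - eval (y s) E x - eval (env2 (y s) (h s)) (dexpr E) x).
    by have := Hb_taylor hr wE (HX _ sT) (Hy s) (Hh _ sT); rewrite exprMn mulrA.
  have Hh' : forall i, Hb r A2 (h s i).
    move=> i; apply: Hb_le (Hh _ sT i); apply: le_trans A2e.
    by rewrite ler_piMr.
  have Hsh0 : forall i, Hb r A2 (fun x => s%:C * h0 s i x).
    move=> i; apply: Hb_le (HbZ s%:C (Hh0 s i)); apply: le_trans A2e.
    by rewrite cmod_real ger0_norm// ler_piMl.
  have B2 : Hb r (lip_const r (dexpr E) A2 * (k2 * s ^+ 2)) (fun x =>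
      eval (env2 (y s) (h s)) (dexpr E) x -
      eval (env2 (y s) (fun i x => s%:C * h0 s i x)) (dexpr E) x).
    apply: Hb_eval_lip => //; first exact: wf_dexpr.
    - by case=> i //=; apply: Hb_le A2A _.
    - by case=> i //=; apply: Hb_le A2A _.
    - case=> i /=; last exact: Hhh.
      apply: Hb_le (Hb_ext _ (Hb0 r)); last by move=> x; rewrite subrr.
      by rewrite mulr_ge0// sqr_ge0.
  have B3 : Hb r (lip_const r (dexpr E) A2 * ((4 * A + 4 * g1) * s)) (fun x =>
      eval (env2 (y s) (h0 s)) (dexpr E) x - eval (env2 y0 k0) (dexpr E) x).
    have sg0 (f : R -> C) a : Hb (r + 1) a f ->
        Hb r (4 * a * s) (fun x => shift (2 * (sg * s)) f x - f x).
      move=> hf; apply: Hb_le (Hb_shift_sub (2 * (sg * s)) hr hf).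
      have a0 := Hb_ge0 hf.
      rewrite !normrM (ger0_norm s0) (ger0_norm (_ : 0 <= 2))//.
      have : `|sg| * s * a <= s * a by rewrite ler_wpM2r// ler_piMl.
      lra.
    have As : 0 <= A * s by exact: mulr_ge0.
    have gs : 0 <= g1 * s by exact: mulr_ge0.
    apply: Hb_eval_lip => //; first exact: wf_dexpr.
    - by case=> i /=; [apply: Hb_le A2A _|apply: Hb_le A2e _].
    - case=> i /=; first by apply: Hb_le A2A _; have := Hy 0 i; rewrite /y !mulr0 !shift0.
      by apply: Hb_le A2e _; have := Hh0 0 i; rewrite /h0 !mulr0 !shift0.
    - case; apply: Hb_env3B.
      + apply: Hb_le (Hb_ext _ (Hb0 r)); last by move=> x; rewrite subrr.
        by lra.
      + apply: Hb_le (sg0 _ _ (Hw T0)).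
        have : B * s <= A * s by rewrite ler_wpM2r// lerDl.
        by lra.
      + have h1 := Hb_shift_sub (sg * s) hr HV.
        apply: Hb_le h1; rewrite normrM (ger0_norm s0).
        have : `|sg| * s * BV <= s * BV by rewrite ler_wpM2r// ler_piMl.
        have : BV * s <= A * s by rewrite ler_wpM2r// lerDr.
        by lra.
      + apply: Hb_le (Hb_ext _ (Hb0 r)); last by move=> x; rewrite subrr.
        by lra.
      + apply: Hb_le (sg0 _ _ (Hb_Ni HG1')).
        by lra.
      + apply: Hb_le (Hb_ext _ (Hb0 r)); last by move=> x; rewrite subrr.
        by lra.
  have B4 := HbZ s%:C B3.
  have := Hb_Ni (HbD (HbD B1 B2) B4); rewrite cmod_real (ger0_norm s0).
  rewrite [X in Hb r X _](_ : _ = kloc * s ^+ 2); last by rewrite /kloc; ring.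
  apply: Hb_ext => x.
  rewrite (dexpr_scale hr s wE (Hy s) (Hh0 s)) EcE; ring.
(* [Q] is the error of the scheme over the time [s], up to the value [u 0] at
   [s = 0]. *)
pose Q s x := u s x + 'i%R * W s x + (s ^+ 2 / 2)%:C * Ec x.
pose D s x := - 'i%R * (eval (X s) E x - eval (y s) E x) + s%:C * Ec x.
have kloc0 : 0 <= kloc.
  rewrite /kloc !addr_ge0//; first by rewrite mulr_ge0 ?sqr_ge0// taylor_const_ge0.
  - by rewrite mulr_ge0// lip_const_ge0.
  - by rewrite mulr_ge0 ?lip_const_ge0// addr_ge0// mulr_ge0.
have HEc : Hb r (bound_const r (corr E) A) Ec.
  apply: Hb_eval => //; first exact: wf_corr.
  by have := Hy 0; rewrite /y !mulr0 !shift0.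
have dsq s : cdiff (fun s : R => (s ^+ 2 / 2)%:C : C) s s%:C.
  move=> e e0; exists e => // hh hhe.
  rewrite -rmorphM -!rmorphB /= cmod_real.
  have -> : (s + hh) ^+ 2 / 2 - s ^+ 2 / 2 - hh * s = hh ^+ 2 / 2 by field.
  rewrite normrM normrX normfV (ger0_norm (_ : 0 <= 2 :> R))// expr2.
  have := ler_wpM2r (normr_ge0 hh) (ltW hhe); have := normr_ge0 hh; nra.
rewrite (_ : kloc * tau ^+ 3 = kloc * tau ^+ 2 * tau); last by rewrite -mulrA -exprSr.
have H := @Hb_mean_value _ r tau (kloc * tau ^+ 2) Q D hr tau0.
apply: Hb_ext (H _ _ _ _ _ _) => [x|||||x s sT|s /andP[s0 sT]].
- by rewrite /Q W0 expr0n mul0r mul0r mulr0 !addr0; ring.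
- by rewrite mulr_ge0// sqr_ge0.
- move=> s sT; apply: ccontD; first apply: ccontD.
  + exact: Hb_cont (Hu sT).
  + exact/ccontZ/cW.
  + exact/ccontZ/(Hb_cont HEc).
- by move=> s sT x; rewrite /Q (Hb_per (Hu sT)) pW// (Hb_per HEc).
- move=> x; apply: ccontin_onD; first apply: ccontin_onD; first exact: cu.
  + move=> s sT e e0; have [d d0 k] := csW x sT e0; exists d => // s' s'T /k.
    by rewrite -mulrBr cmodM cmod_i mul1r; apply.
  + by apply: (cdiff_contin_on (d := fun s => s%:C * Ec x)) => s; exact: cdiffZr.
- have -> : D s x = - 'i%R * eval (X s) E x + 'i%R * eval (y s) E x + s%:C * Ec x.
    by rewrite /D; ring.
  apply: cdiffD; first apply: cdiffD.
  + exact: tu.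
  + exact/cdiffZ/dW.
  + exact: cdiffZr.
have sT' : 0 <= s <= tau by rewrite !ltW.
apply: Hb_le (Dbound _ sT'); rewrite ler_wpM2l// ler_sqr ?nnegrE ltW//.
Qed.

End Step.

End LocalError.

(** * Global error *)

Section GlobalError.
Variable R : realType.
Local Notation C := R[i].
Variables (r : R) (E : expr R var3) (E1 : R -> expr R var3).
Hypotheses (hr : 2^-1 < r) (wE : wf E) (wE1 : forall a, wf (E1 a)).
Hypothesis lipE1 : forall a A, lip_const r (E1 a) A = lip_const r (E1 0) A.

(** [s * E1 (sg * s)] is the integral over [[0, s]] of the rate along the free
    flow: this is what makes the schemes exact at first order. *)
Hypothesis dE1 : forall A p q V (sg s x : R), Hb r A p -> Hb r A q -> Hb r A V ->
  cdiff (fun s => s%:C * eval (env3 p q V) (E1 (sg * s)) x) s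
    (eval (env3 p (shift (2 * (sg * s)) q) (shift (sg * s) V)) E x).

(** One step for the component that travels with speed [sg]. *)
Definition step (sg tau : R) (p q V : R -> C) : R -> C := fun x =>
  shift (- (sg * tau)) p x
  - 'i%R * (tau%:C * shift (- (sg * tau)) (eval (env3 p q V) (E1 (sg * tau))) x)
  - (tau ^+ 2 / 2)%:C * eval (env3 p q V) (corr E) x.

(** Translations are isometries, so the stability constant is [1 + O (tau)].
    *)
Lemma Hb_step_sub A d sg tau p q V p' q' : 0 < tau -> tau <= 1 ->
  Hb r A p -> Hb r A q -> Hb r A V -> Hb r A p' -> Hb r A q' ->
  Hb r d (fun x => p x - p' x) -> Hb r d (fun x => q x - q' x) ->
  Hb r ((1 + (lip_const r (E1 0) A + lip_const r (corr E) A) * tau) * d)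
    (fun x => step sg tau p q V x - step sg tau p' q' V x).
Proof.
move=> t0 t1 hp hq hV hp' hq' dp dq.
have A0 := Hb_ge0 hp; have d0 := Hb_ge0 dp.
have h1 i := Hb_env3 i hp hq hV.
have h2 i := Hb_env3 i hp' hq' hV.
have hd : forall i, Hb r d (fun x => env3 p q V i x - env3 p' q' V i x).
  apply: (Hb_env3B dp dq); apply: Hb_le d0 (Hb_ext _ (Hb0 r)) => x.
  by rewrite subrr.
have B1 := Hb_shift (- (sg * tau)) hr dp.
have B2 := Hb_shift (- (sg * tau)) hr (Hb_eval_lip hr (wE1 (sg * tau)) h1 h2 hd).
have B3 := Hb_eval_lip hr (wf_corr wE) h1 h2 hd.
have := HbB (HbB B1 (HbZ 'i%R (HbZ tau%:C B2))) (HbZ (tau ^+ 2 / 2)%:C B3).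
rewrite lipE1 cmod_i !cmod_real (ger0_norm (ltW t0)) ger0_norm; last by rewrite divr_ge0 ?sqr_ge0.
move=> H; apply: Hb_le (Hb_ext _ H) => [|x]; last by rewrite /step /shift; ring.
have k1 : 0 <= lip_const r (corr E) A * d by rewrite mulr_ge0// lip_const_ge0.
have : tau ^+ 2 / 2 * (lip_const r (corr E) A * d) <= tau * (lip_const r (corr E) A * d).
  rewrite ler_wpM2r//; have : tau * tau <= tau by rewrite ler_piMl// ltW.
  by rewrite expr2; move: t0; lra.
lra.
Qed.

Variables (V : R -> C) (B BV : R).
Hypotheses (B0 : 0 <= B) (BV0 : 0 <= BV) (HV : Hb (r + 1) BV V).

Definition joint_lip (T : R) (f : R -> R -> C) := exists L, forall t t' x x',
  0 <= t <= T -> 0 <= t' <= T ->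
  cmod (f t x - f t' x') <= L * (`|t - t'| + `|x - x'|).

(** Along its characteristic, each component of the solution is one of the
    twisted profiles. The scheme evaluates the correction at [x] instead of [x
    - sg tau]; the difference costs one derivative and is of third order. *)
Lemma local_step : exists2 K : R, 0 <= K & forall (sg t tau T : R) (p q : R -> R -> C),
  `|sg| <= 1 -> 0 <= t -> 0 < tau -> tau <= 1 -> t + tau <= T ->
  (forall t, 0 <= t <= T -> Hb (r + 1) B (p t)) ->
  (forall t, 0 <= t <= T -> Hb (r + 1) B (q t)) ->
  joint_lip T p ->
  joint_lip T q ->
  (forall x t, 0 < t < T -> cdiff (fun s => p (t + s) (x + sg * s)) 0
     (- 'i%R * eval (env3 (p t) (q t) V) E x)) ->
  (forall x t, 0 < t < T -> cdiff (fun s => q (t + s) (x + - sg * s)) 0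
     (- 'i%R * eval (env3 (q t) (p t) V) E x)) ->
  Hb r (K * tau ^+ 3) (fun x => p (t + tau) x - step sg tau (p t) (q t) V x).
Proof.
have loc := @local_twisted R r E B BV hr wE B0 BV0.
have hr1 : 2^-1 < r + 1 by move: hr; lra.
match type of loc with context [Hb r (?X * _ ^+ 3) _] => set K := X in loc end.
pose K2 := bound_const (r + 1) (corr E) (B + BV).
have K20 : 0 <= K2 by apply: bound_const_ge0 => //; exact: addr_ge0.
exists (`|K| + K2); first by rewrite addr_ge0.
move=> sg t tau T p q sg1 t0 tau0 tau1 tT hp hq [Lp lp] [Lq lq] dp dq.
have sub s : 0 <= s <= tau -> 0 <= t + s <= T.
  by move=> /andP[s0 st]; apply/andP; split; lra.
pose u s := shift (sg * s) (p (t + s)); pose w s := shift (- sg * s) (q (t + s)).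
have Hu s : 0 <= s <= tau -> Hb (r + 1) B (u s).
  by move=> /sub /hp h; exact: Hb_shift.
have Hw s : 0 <= s <= tau -> Hb (r + 1) B (w s).
  by move=> /sub /hq h; exact: Hb_shift.
have clip (g : R -> R -> C) L c x : `|c| <= 1 -> (forall t t' x x', 0 <= t <= T -> 0 <= t' <= T ->
     cmod (g t x - g t' x') <= L * (`|t - t'| + `|x - x'|)) ->
     ccontin_on tau (fun s => g (t + s) (x + c * s)).
  move=> c1 H; apply: (@lip_contin_on _ _ (2 * `|L|)) => s s' sT s'T.
  rewrite (le_trans (H _ _ _ _ (sub _ s'T) (sub _ sT)))//.
  rewrite !opprD !(addrACA _ _ (- _)) !subrr !add0r -mulrBr normrM.
  have h1 : `|c| * `|s' - s| <= `|s' - s| by rewrite ler_piMl.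
  apply: (@le_trans _ _ (`|L| * (`|s' - s| + `|c| * `|s' - s|))).
    by rewrite ler_wpM2r ?ler_norm// addr_ge0// mulr_ge0.
  have -> : 2 * `|L| * `|s' - s| = `|L| * (`|s' - s| + `|s' - s|) by ring.
  by rewrite ler_wpM2l// lerD2l.
have cu x : ccontin_on tau (fun s => u s x) by exact: clip lp.
have cw x : ccontin_on tau (fun s => w s x) by apply: clip lq; rewrite ?normrN.
have tws (f g : R -> R -> C) c : (forall t, 0 <= t <= T -> Hb (r + 1) B (f t)) ->
   (forall t, 0 <= t <= T -> Hb (r + 1) B (g t)) ->
   (forall x t, 0 < t < T -> cdiff (fun s => f (t + s) (x + c * s)) 0
     (- 'i%R * eval (env3 (f t) (g t) V) E x)) ->
   twisted E V tau c (fun s => shift (c * s) (f (t + s))) (fun s => shift (- c * s) (g (t + s))).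
  move=> hf hg H x s /andP[s0 st].
  have ts : 0 < t + s < T by apply/andP; split; lra.
  have ts' : 0 <= t + s <= T by rewrite !ltW; case/andP: ts.
  have := H (x + c * s) (t + s) ts.
  have -> : eval (env3 (f (t + s)) (g (t + s)) V) E (x + c * s) =
      eval (env3 (shift (c * s) (f (t + s))) (shift (2 * (c * s)) (shift (- c * s) (g (t + s))))
        (shift (c * s) V)) E x.
    transitivity (shift (c * s) (eval (env3 (f (t + s)) (g (t + s)) V) E) x) => //.
    have henv i : Hb (r + 1) (B + BV) (env3 (f (t + s)) (g (t + s)) V i).
      apply: Hb_env3.
      - by apply: Hb_le (hf _ ts'); rewrite lerDl.
      - by apply: Hb_le (hg _ ts'); rewrite lerDl.
      - by apply: Hb_le HV; rewrite lerDr.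
    rewrite -(eval_shift hr1 _ wE henv); congr (eval _ _ _); apply/funext; case=> //=.
    by apply/funext => y; rewrite /shift; congr (g _ _); ring.
  move=> D e /D[d d0 k]; exists d => // h /k.
  rewrite /shift add0r mulr0 !addr0 mulrDr !addrA; exact.
have tu : twisted E V tau sg u w by apply: tws.
have tw : twisted E V tau (- sg) w u.
  by have := tws q p (- sg) hq hp dq; rewrite opprK.
have lower f a : Hb (r + 1) a f -> Hb r a f by apply: Hb_lower; rewrite lerDl.
have T0 : 0 <= (0 : R) <= tau by rewrite lexx ltW.
have u0 : u 0 = p t by rewrite /u mulr0 addr0 shift0.
have w0 : w 0 = q t by rewrite /w mulr0 addr0 shift0.
have hA : forall i, Hb (r + 1) (B + BV) (env3 (p t) (q t) V i).
  move=> i; apply: Hb_env3.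
  - by apply: Hb_le (_ : Hb _ B _); rewrite ?lerDl// -u0; exact: Hu.
  - by apply: Hb_le (_ : Hb _ B _); rewrite ?lerDl// -w0; exact: Hw.
  - by apply: Hb_le HV; rewrite lerDr.
pose W s x := s%:C * eval (env3 (p t) (q t) V) (E1 (sg * s)) x.
have hEv s := Hb_eval hr (wE1 (sg * s)) (fun i => lower _ _ (hA i)).
have cW s : 0 <= s <= tau -> ccontinuous (W s).
  by move=> _; apply/ccontZ/(Hb_cont (hEv s)).
have pW s : 0 <= s <= tau -> periodic2pi (W s).
  by move=> _ x; rewrite /W (Hb_per (hEv s)).
have W0 x : W 0 x = 0 by rewrite /W mul0r.
have dW' x s : cdiff (fun s => W s x) s
    (eval (env3 (u 0) (shift (2 * (sg * s)) (w 0)) (shift (sg * s) V)) E x).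
  rewrite u0 w0; apply: dE1; [exact/lower/(hA vp)|exact/lower/(hA vq)|exact/lower/(hA vv)].
have csW x : ccontin_on tau (fun s => W s x) by exact: cdiff_contin_on (dW' x).
have := loc V tau sg u w tau0 tau1 sg1 HV Hu Hw cu cw tu tw W cW pW W0 csW (fun x s _ => dW' x s).
rewrite u0 w0 => /(Hb_shift (- (sg * tau)) hr) H1.
have HE := Hb_eval hr1 (wf_corr wE) hA.
have H2 := HbN (HbZ (tau ^+ 2 / 2)%:C (Hb_shift_sub (- (sg * tau)) hr HE)).
apply: Hb_le (Hb_ext _ (HbD H1 H2)) => [|x].
  rewrite [leRHS]mulrDl; apply: lerD.
    by rewrite ler_wpM2r ?ler_norm// exprn_ge0// ltW.
  rewrite cmod_real ger0_norm ?divr_ge0 ?sqr_ge0// normrN normrM (ger0_norm (ltW tau0)).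
  have -> : tau ^+ 2 / 2 * (2 * (`|sg| * tau) * bound_const (r + 1) (corr E) (B + BV)) =
    `|sg| * (K2 * tau ^+ 3) by rewrite /K2; field.
  by rewrite ler_piMl// mulr_ge0// exprn_ge0// ltW.
rewrite /step /u /W /shift.
rewrite (_ : x + - (sg * tau) + sg * tau = x); last by ring.
ring.
Qed.

(** Gronwall's argument for the discrete flow. The constants are those of the
    ball of radius one larger than that of the solution; the smallness
    assumption keeps the numerical solution in that ball, which is what the
    induction needs. *)
Lemma global_error : exists K L : R, [/\ 0 <= K, 0 <= L &
  forall (tau T : R) (p q : R -> R -> C) (pn qn : nat -> R -> C),
  0 < tau -> tau <= 1 -> K * tau ^+ 2 * (T * expR (L * T)) <= 1 ->
  (forall t, 0 <= t <= T -> Hb (r + 1) B (p t)) ->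
  (forall t, 0 <= t <= T -> Hb (r + 1) B (q t)) ->
  joint_lip T p ->
  joint_lip T q ->
  (forall x t, 0 < t < T -> cdiff (fun s => p (t + s) (x + s)) 0
     (- 'i%R * eval (env3 (p t) (q t) V) E x)) ->
  (forall x t, 0 < t < T -> cdiff (fun s => q (t + s) (x - s)) 0
     (- 'i%R * eval (env3 (q t) (p t) V) E x)) ->
  pn 0%N = p 0 -> qn 0%N = q 0 ->
  (forall n A, Hb r A (pn n) -> Hb r A (qn n) ->
     pn n.+1 = step 1 tau (pn n) (qn n) V /\ qn n.+1 = step (- 1) tau (qn n) (pn n) V) ->
  forall n : nat, n%:R * tau <= T ->
    Hb r (K * tau ^+ 2 * (n%:R * tau * expR (L * (n%:R * tau))))
      (fun x => p (n%:R * tau) x - pn n x) /\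
    Hb r (K * tau ^+ 2 * (n%:R * tau * expR (L * (n%:R * tau))))
      (fun x => q (n%:R * tau) x - qn n x)].
Proof.
have [K K0 loc] := local_step.
pose A := B + 1 + BV; have A0 : 0 <= A by rewrite !addr_ge0.
pose L := lip_const r (E1 0) A + lip_const r (corr E) A.
have L0 : 0 <= L by rewrite addr_ge0// lip_const_ge0.
exists K, L; split=> // tau T p q pn qn t0 t1 small hp hq lp lq dp dq p0 q0 scheme.
have lower f a : Hb (r + 1) a f -> Hb r a f by apply: Hb_lower; rewrite lerDl.
elim=> [_|n ih nT].
  rewrite !mul0r mulr0 p0 q0.
  by split; apply: Hb_ext (Hb0 r) => x; rewrite subrr.
have ntT : n%:R * tau <= T by apply: le_trans nT; rewrite ler_wpM2r ?ler_nat// ltW.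
have nt0 : 0 <= n%:R * tau by rewrite mulr_ge0// ltW.
have tI : 0 <= n%:R * tau <= T by rewrite nt0.
have [hpn hqn] := ih ntT; set d := K * _ * _ in hpn hqn.
have d1 : d <= 1.
  apply: le_trans small; apply: (ler_wpM2l (mulr_ge0 K0 (sqr_ge0 tau))).
  by apply: ler_pM => //; rewrite ler_expR ler_wpM2l.
have BA : B <= A by rewrite /A -addrA lerDl addr_ge0.
have BVA : BV <= A by rewrite /A lerDr addr_ge0.
have P1 : Hb r A (p (n%:R * tau)) by apply: Hb_le BA (lower _ _ (hp _ tI)).
have Q1 : Hb r A (q (n%:R * tau)) by apply: Hb_le BA (lower _ _ (hq _ tI)).
have dA : B + d <= A by rewrite /A; move: d1 BV0; lra.
have P2 : Hb r A (pn n).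
  apply: Hb_le dA (Hb_ext _ (HbB (lower _ _ (hp _ tI)) hpn)) => x; ring.
have Q2 : Hb r A (qn n).
  apply: Hb_le dA (Hb_ext _ (HbB (lower _ _ (hq _ tI)) hqn)) => x; ring.
have V1 : Hb r A V by apply: Hb_le BVA (lower _ _ HV).
have [-> ->] := scheme n A P2 Q2.
have E1S : n.+1%:R * tau = n%:R * tau + tau by rewrite -natr1 mulrDl mul1r.
have nT' : n%:R * tau + tau <= T by rewrite -E1S.
have bound : K * tau ^+ 3 + (1 + L * tau) * d <=
    K * tau ^+ 2 * (n.+1%:R * tau * expR (L * (n.+1%:R * tau))).
  rewrite E1S mulrDr expRD /d; set X := expR (L * (n%:R * tau)).
  have X1 : 1 <= X by rewrite -expR0 ler_expR mulr_ge0.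
  have Y1 : 1 + L * tau <= expR (L * tau) by exact: expR_ge1Dx.
  set Y := expR (L * tau) in Y1 *.
  have Lt : 0 <= L * tau by rewrite mulr_ge0// ltW.
  have Kt : 0 <= K * tau ^+ 2 by rewrite mulr_ge0// sqr_ge0.
  have h1 : K * tau ^+ 2 * tau * 1 <= K * tau ^+ 2 * tau * (X * Y).
    rewrite ler_wpM2l ?mulr_ge0 ?(ltW t0)//; apply: mulr_ege1 => //.
    by apply: le_trans Y1; rewrite lerDl.
  have h2 : (1 + L * tau) * (K * tau ^+ 2 * (n%:R * tau * X)) <=
      Y * (K * tau ^+ 2 * (n%:R * tau * X)).
    by rewrite ler_wpM2r// mulr_ge0// mulr_ge0// (le_trans ler01).
  rewrite [K * tau ^+ 3](_ : _ = K * tau ^+ 2 * tau * 1); last by ring.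
  rewrite [leRHS](_ : _ = K * tau ^+ 2 * tau * (X * Y) +
    Y * (K * tau ^+ 2 * (n%:R * tau * X))); last by ring.
  exact: lerD.
have N11 : `|(1 : R)| <= 1 by rewrite normr1.
have NN11 : `|(- 1 : R)| <= 1 by rewrite normrN normr1.
have dp' x t : 0 < t < T -> cdiff (fun s => p (t + s) (x + 1 * s)) 0
     (- 'i%R * eval (env3 (p t) (q t) V) E x).
  move=> tT; apply: (@cdiff_ext _ (fun s => p (t + s) (x + s))); last exact: dp.
  by move=> y; rewrite mul1r.
have dq' x t : 0 < t < T -> cdiff (fun s => q (t + s) (x + - 1 * s)) 0
     (- 'i%R * eval (env3 (q t) (p t) V) E x).
  move=> tT; apply: (@cdiff_ext _ (fun s => q (t + s) (x - s))); last exact: dq.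
  by move=> y; rewrite mulN1r.
have dp'' x t : 0 < t < T -> cdiff (fun s => p (t + s) (x + - - 1 * s)) 0
     (- 'i%R * eval (env3 (p t) (q t) V) E x).
  by rewrite opprK; exact: dp'.
have lp1 := loc 1 _ tau T p q N11 nt0 t0 t1 nT' hp hq lp lq dp' dq'.
have lq1 := loc (- 1) _ tau T q p NN11 nt0 t0 t1 nT' hq hp lq lp dq' dp''.
have sp := Hb_step_sub 1 t0 t1 P1 Q1 V1 P2 Q2 hpn hqn.
have sq := Hb_step_sub (- 1) t0 t1 Q1 P1 V1 Q2 P2 hqn hpn.
split; apply: Hb_le bound _; rewrite E1S.
- apply: Hb_ext (HbD lp1 sp) => x; ring.
- apply: Hb_ext (HbD lq1 sq) => x; ring.
Qed.

End GlobalError.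

(** * Integrals of functions bounded almost everywhere *)

Section AlmostEverywhereLe.
Import HBNNSimple.

(** The integral of a nonnegative function is a supremum over simple
    functions, and modifying a simple function on a null set does not change
    its integral. So the comparison also holds for integrands that are not
    Borel, such as a function that is merely almost everywhere equal to a
    continuous one. *)
Lemma le_integral_ae d (T : measurableType d) (R : realType)
    (mu : {measure set T -> \bar R}) (D : set T) (f g : T -> \bar R) :
  (forall x, 0 <= f x)%E -> (forall x, 0 <= g x)%E ->
  {ae mu, forall x, D x -> (f x <= g x)%E} ->
  (\int[mu]_(x in D) f x <= \int[mu]_(x in D) g x)%E.
Proof.
move=> f0 g0 [N [mN muN fgN]].
rewrite [leLHS]integral_mkcond [leRHS]integral_mkcond.
have p0 (k : T -> \bar R) : (forall x, 0 <= k x)%E -> forall x, (0 <= (k \_ D) x)%E.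
  by move=> k0 x; rewrite patchE; case: ifP.
rewrite !ge0_integralTE; [|exact: p0|exact: p0].
apply: ge_ereal_sup => _ [h hf <-].
pose h' := proj_nnsfun h (measurableC mN).
have h'E x : h' x = if x \in N then 0 else h x.
  rewrite /h' /proj_nnsfun /= measurable_realfun.mindicE in_setC; case: (x \in N) => /=; rewrite ?mulr0 ?mulr1//.
have -> : sintegral mu h = sintegral mu h'.
  have E (k : {nnsfun T >-> R}) : sintegral mu k = (\int[mu]_(x in ~` N) (k x)%:E)%E.
    transitivity (\int[mu]_x (k x)%:E)%E.
      by rewrite integralT_nnsfun.
    rewrite (ge0_negligible_integral mN measurableT _ _ muN)//.
    - by rewrite setTD.
    - by apply/measurable_realfun.measurable_EFinP; exact: measurable_funP.
    - by move=> x _; rewrite lee_fin; exact: fun_ge0.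
  rewrite !E; apply: eq_integral => x; rewrite in_setC h'E.
  by case: (x \in N).
apply: ereal_sup_ubound; exists h' => // x.
rewrite h'E; case: ifPn => [_|xN]; first exact: p0.
have := hf x; rewrite !patchE; case: ifP => // xD hx.
apply: le_trans hx _; apply: contrapT => fg.
move: xN; apply/negP; rewrite negbK; apply/mem_set/fgN => /= H; apply: fg.
by apply: H; exact/set_mem.
Qed.

End AlmostEverywhereLe.

Section AlmostEverywhere.
Variable R : realType.
Local Notation C := R[i].
Local Notation Re := complex.Re.
Local Notation Im := complex.Im.
Local Notation mu := (@lebesgue_measure R).

Lemma aeS (P Q : R -> Prop) : (forall x, P x -> Q x) ->
  {ae mu, forall x : R, P x} -> {ae mu, forall x : R, Q x}.
Proof. exact: (@filterS _ _ (ae_filter_ringOfSetsType mu)). Qed.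

Lemma aeS2 (P Q S : R -> Prop) : (forall x, P x -> Q x -> S x) ->
  {ae mu, forall x : R, P x} -> {ae mu, forall x : R, Q x} ->
  {ae mu, forall x : R, S x}.
Proof. exact: (@filterS2 _ _ (ae_filter_ringOfSetsType mu)). Qed.

Lemma Rint_ae_between (f : R -> R) (a b s t : R) : s <= t ->
  {ae mu, forall x : R, s < x < t -> a <= f x <= b} ->
  a * (t - s) <= \int[mu]_(x in `[s, t]) f x <= b * (t - s).
Proof.
move=> st H.
have mst : fine (mu `[s, t]%classic) = t - s.
  by rewrite lebesgue_measure_itv/= lte_fin; move: st; case: ltgtP => //= -> _; rewrite subrr.
have fmu : mu `[s, t]%classic \is a fin_num.
  by rewrite lebesgue_measure_itv/=; case: ifP.
have H' : {ae mu, forall x : R, `[s, t]%classic x -> a <= f x <= b}.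
  have E1 : {ae mu, forall x : R, x != s} by exists [set s]; split => //; [exact: lebesgue_measure_set1|move=> x /=; move/negP; rewrite negbK => /eqP].
  have E2 : {ae mu, forall x : R, x != t} by exists [set t]; split => //; [exact: lebesgue_measure_set1|move=> x /=; move/negP; rewrite negbK => /eqP].
  apply: aeS2 (aeS2 (fun x h1 h2 => conj h1 h2) E1 E2) H => x [xs xt] h; rewrite /= in_itv/= => /andP[sx tx].
  by apply: h; rewrite !lt_neqAle eq_sym xs sx xt tx.
pose pos (x : R) := Num.max x 0; pose neg (x : R) := Num.max (- x) 0.
have pn x : x = pos x - neg x.
  by rewrite /pos /neg; case: (leP x 0) => h; case: (leP (- x) 0) => h'; lra.
have pos0 x : 0 <= pos x by rewrite le_max lexx orbT.
have neg0 x : 0 <= neg x by rewrite le_max lexx orbT.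
have posm x y : x <= y -> pos x <= pos y.
  by move=> xy; rewrite ge_max le_max xy /= le_max lexx orbT.
have negm x y : x <= y -> neg y <= neg x.
  by move=> xy; rewrite ge_max le_max lerN2 xy /= le_max lexx orbT.
have cst c : (\int[mu]_(x in `[s, t]) c%:E = (c * (t - s))%:E)%E.
  by rewrite integral_cst//= -mst EFinM fineK.
have ub (h : R -> R) c : (forall x, 0 <= h x) -> 0 <= c ->
    {ae mu, forall x : R, `[s, t]%classic x -> h x <= c} ->
    (\int[mu]_(x in `[s, t]) (h x)%:E <= (c * (t - s))%:E)%E.
  by move=> h0 c0 hc; rewrite -cst; apply: le_integral_ae.
have lb (h : R -> R) c : (forall x, 0 <= h x) -> 0 <= c ->
    {ae mu, forall x : R, `[s, t]%classic x -> c <= h x} ->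
    ((c * (t - s))%:E <= \int[mu]_(x in `[s, t]) (h x)%:E)%E.
  by move=> h0 c0 hc; rewrite -cst; apply: le_integral_ae.
have P1 := ub (fun x => pos (f x)) (pos b) (fun x => pos0 _) (pos0 _)
  (aeS (fun x k xI => posm _ _ (proj2 (andP (k xI)))) H').
have P2 := lb (fun x => pos (f x)) (pos a) (fun x => pos0 _) (pos0 _)
  (aeS (fun x k xI => posm _ _ (proj1 (andP (k xI)))) H').
have N1 := ub (fun x => neg (f x)) (neg a) (fun x => neg0 _) (neg0 _)
  (aeS (fun x k xI => negm _ _ (proj1 (andP (k xI)))) H').
have N2 := lb (fun x => neg (f x)) (neg b) (fun x => neg0 _) (neg0 _)
  (aeS (fun x k xI => negm _ _ (proj2 (andP (k xI)))) H').
rewrite /Rintegral integralE.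
pose P : \bar R := (\int[mu]_(x in `[s, t]) (pos (f x))%:E)%E.
pose N : \bar R := (\int[mu]_(x in `[s, t]) (neg (f x))%:E)%E.
have -> : (\int[mu]_(x in `[s, t]) (fun x => (f x)%:E)^\+ x = P)%E.
  by apply: eq_integral => x _; rewrite funeposE /pos EFin_max.
have -> : (\int[mu]_(x in `[s, t]) (fun x => (f x)%:E)^\- x = N)%E.
  by apply: eq_integral => x _; rewrite funenegE /neg EFin_max.
have fin (X : \bar R) x y : (x%:E <= X)%E -> (X <= y%:E)%E -> X = (fine X)%:E.
  by case: X.
move: (P1) (P2); rewrite -/P (fin P _ _ P2 P1) !lee_fin => p1 p2.
move: (N1) (N2); rewrite -/N (fin N _ _ N2 N1) !lee_fin => n1 n2.
rewrite -EFinB /= [in X in X && _](pn a) [in X in _ && X](pn b) !mulrBl.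
by apply/andP; split; lra.
Qed.

Lemma ae_ex (P : R -> Prop) (a b : R) : a < b -> {ae mu, forall x : R, P x} ->
  exists x, a < x < b /\ P x.
Proof.
move=> ab [N [mN muN PN]]; apply: contrapT => nex.
have sub : `]a, b[%classic `<=` N.
  move=> x; rewrite /= in_itv/= => xab; apply: PN => /= Px.
  by apply: nex; exists x.
have : (mu `]a, b[%classic <= mu N)%E.
  by apply: le_measure => //; rewrite inE.
by rewrite muN lebesgue_measure_itv/= lte_fin ab -EFinB lee_fin subr_le0 leNgt ab.
Qed.

Lemma cint_ae_near (f : R -> C) (z : C) (e s t : R) : s <= t ->
  {ae mu, forall x : R, s < x < t -> cmod (f x - z) <= e} ->
  cmod (cint `[s, t] f - (t - s)%:C * z) <= 2 * e * (t - s).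
Proof.
move=> st H.
have H1 : forall x, (s < x < t -> cmod (f x - z) <= e) -> s < x < t -> Re z - e <= Re (f x) <= Re z + e.
  move=> x k /k; have := Re_le_cmod (f x - z); rewrite Re_D Re_N => k1 k2.
  have := le_trans k1 k2; rewrite ler_norml => /andP[? ?]; apply/andP; split; lra.
have H2 : forall x, (s < x < t -> cmod (f x - z) <= e) -> s < x < t -> Im z - e <= Im (f x) <= Im z + e.
  move=> x k /k; have := Im_le_cmod (f x - z); rewrite Im_D Im_N => k1 k2.
  have := le_trans k1 k2; rewrite ler_norml => /andP[? ?]; apply/andP; split; lra.
have /andP[a1 a2] := Rint_ae_between st (aeS H1 H).
have /andP[b1 b2] := Rint_ae_between st (aeS H2 H).
rewrite /cint; move: a1 a2 b1 b2.
move: (\int[mu]_(x in `[s, t]) Re (f x)) (\int[mu]_(x in `[s, t]) Im (f x)).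
move=> A B a1 a2 b1 b2; rewrite (le_trans (cmod_le _))// !(Re_D, Re_N, Re_M, Im_D, Im_N, Im_M, Re_real, Im_real) /=.
rewrite !mul0r subr0 addr0.
have -> : 2 * e * (t - s) = e * (t - s) + e * (t - s) by ring.
apply: lerD; rewrite ler_norml; apply/andP; split; nra.
Qed.

End AlmostEverywhere.

(** * Regularity of solutions along characteristics *)

Section Characteristics.
Variable R : realType.
Local Notation C := R[i].
Local Notation mu := (@lebesgue_measure R).

Lemma hderivB (s A B : R) (f g : R -> C) : 2^-1 < s ->
  Hb (s + 1) A f -> Hb (s + 1) B g ->
  hderiv (fun x => f x - g x) = (fun x => hderiv f x - hderiv g x).
Proof.
move=> hs hf hg; apply/funext => x.
have H : Hb (s + 1) (A + B) (fun x => f x - g x) := HbB hf hg.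
rewrite -(cderiv_eq (cdiff_hderiv x hs H)).
exact: cderiv_eq (cdiffB (cdiff_hderiv x hs hf) (cdiff_hderiv x hs hg)).
Qed.

Section Increments.
Variables (T : R) (u w : R -> R -> C).
Hypothesis inc : forall s t x, 0 <= s -> s <= t -> t <= T ->
  u t x - u s x = cint `[s, t] (fun rho => w rho x).

Lemma increment_near (s t y e : R) (z : C) : 0 <= s -> s <= t -> t <= T ->
  {ae mu, forall rho : R, s < rho < t -> cmod (w rho y - z) <= e} ->
  cmod (u t y - u s y - (t - s)%:C * z) <= 2 * e * (t - s).
Proof. by move=> s0 st tT H; rewrite inc//; apply: cint_ae_near. Qed.

Lemma increment_le (K : R) :
  {ae mu, forall rho : R, 0 < rho < T -> forall x, cmod (w rho x) <= K} ->
  forall t t' x, 0 <= t <= T -> 0 <= t' <= T ->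
    cmod (u t x - u t' x) <= 2 * K * `|t - t'|.
Proof.
move=> H.
have main s t x : 0 <= s -> s <= t -> t <= T ->
    cmod (u t x - u s x) <= 2 * K * (t - s).
  move=> s0 st tT; have := @increment_near s t x K 0 s0 st tT.
  rewrite mulr0 subr0; apply; apply: aeS H => rho h /andP[sr rt].
  by rewrite subr0; apply: h; rewrite (le_lt_trans s0 sr) (lt_le_trans rt tT).
move=> t t' x /andP[t0 tT] /andP[t'0 t'T]; case: (leP t t') => tt'.
  by rewrite cmod_distC distrC ger0_norm ?subr_ge0//; exact: main.
by rewrite gtr0_norm ?subr_gt0//; apply: main => //; exact: ltW.
Qed.

(** If the integrand is almost everywhere close to [z] near [(t, x)], the
    increments of [u] in time are those of a function with time derivative
    [z], uniformly in space near [x]. *)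
Lemma increment_rate (t x : R) (z : C) : 0 < t < T ->
  (forall e, 0 < e -> exists2 d, 0 < d &
    {ae mu, forall rho : R, 0 < rho < T -> `|rho - t| < d ->
       forall y, `|y - x| < d -> cmod (w rho y - z) <= e}) ->
  forall e, 0 < e -> exists2 d, 0 < d & forall h y, `|h| < d -> `|y - x| < d ->
    cmod (u (t + h) y - u t y - h%:C * z) <= e * `|h|.
Proof.
move=> /andP[t0 tT] H e e0; have e2 : 0 < e / 2 by rewrite divr_gt0.
have [d d0 hd] := H _ e2.
exists (Num.min d (Num.min t (T - t))); first by rewrite !lt_min d0 t0 subr_gt0.
move=> h y; rewrite !lt_min => /andP[hd1 /andP[ht hT]] /andP[yd _].
have -> : e = 2 * (e / 2) by field.
move: hd1 ht hT; rewrite !ltr_norml => /andP[a1 a2] /andP[b1 b2] /andP[c1 c2].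
case: (leP 0 h) => h0.
  rewrite [X in _ <= _ * X]ger0_norm//.
  have := @increment_near t (t + h) y (e / 2) z.
  have -> : t + h - t = h by ring.
  apply; [lra|lra|lra|].
  apply: aeS hd => rho k /andP[k1 k2]; apply: k => //; first by apply/andP; split; lra.
  by rewrite ltr_norml; apply/andP; split; lra.
rewrite [X in _ <= _ * X]ltr0_norm//.
have := @increment_near (t + h) t y (e / 2) z.
have -> : t - (t + h) = - h by ring.
have -> : u (t + h) y - u t y - h%:C * z = - (u t y - u (t + h) y - (- h)%:C * z).
  by rewrite rmorphN /=; ring.
rewrite cmodN; apply; [lra|lra|lra|].
apply: aeS hd => rho k /andP[k1 k2]; apply: k => //; first by apply/andP; split; lra.
by rewrite ltr_norml; apply/andP; split; lra.
Qed.

End Increments.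

Section Joint.
Variable T : R.

Definition joint_cont (f : R -> R -> C) : Prop :=
  forall t x e, 0 <= t <= T -> 0 < e -> exists2 d, 0 < d &
    forall t' x', 0 <= t' <= T -> `|t' - t| < d -> `|x' - x| < d ->
      cmod (f t' x' - f t x) <= e.

Definition sup_cont (f : R -> R -> C) : Prop :=
  forall t e, 0 <= t <= T -> 0 < e -> exists2 d, 0 < d &
    forall t', 0 <= t' <= T -> `|t' - t| < d -> forall x,
      cmod (f t' x - f t x) <= e.

Lemma joint_cont_sup (f : R -> R -> C) :
  (forall t, 0 <= t <= T -> ccontinuous (f t)) -> sup_cont f -> joint_cont f.
Proof.
move=> fc fs t x e tT e0; have e2 : 0 < e / 2 by rewrite divr_gt0.
have [d d0 hd] := fs t _ tT e2.
have [d' d'0 hd'] := proj1 (ccontinuousP _) (fc _ tT) x _ e2.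
exists (Num.min d d'); first by rewrite lt_min d0.
move=> t' x' t'T; rewrite !lt_min => /andP[a _] /andP[_ b].
have -> : f t' x' - f t x = (f t' x' - f t x') + (f t x' - f t x) by ring.
apply: le_trans (cmodD _ _) _; rewrite [leRHS](splitr e).
by apply: lerD; [exact: hd|apply/ltW/hd'].
Qed.

Lemma joint_contD (f g : R -> R -> C) : joint_cont f -> joint_cont g ->
  joint_cont (fun t x => f t x + g t x).
Proof.
move=> hf hg t x e tT e0; have e2 : 0 < e / 2 by rewrite divr_gt0.
have [d d0 hd] := hf t x _ tT e2; have [d' d'0 hd'] := hg t x _ tT e2.
exists (Num.min d d'); first by rewrite lt_min d0.
move=> t' x' t'T; rewrite !lt_min => /andP[a a'] /andP[b b'].
have -> : f t' x' + g t' x' - (f t x + g t x) = (f t' x' - f t x) + (g t' x' - g t x) by ring.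
apply: le_trans (cmodD _ _) _; rewrite [leRHS](splitr e).
by apply: lerD; [exact: hd|exact: hd'].
Qed.

Lemma joint_contZ (c : C) (f : R -> R -> C) : joint_cont f -> joint_cont (fun t x => c * f t x).
Proof.
move=> hf t x e tT e0; have c1 : 0 < cmod c + 1 by rewrite ltr_wpDl ?cmod_ge0.
have [d d0 hd] := hf t x _ tT (divr_gt0 e0 c1).
exists d => // t' x' t'T a b; rewrite -mulrBr cmodM.
have := hd _ _ t'T a b => k.
apply: le_trans (ler_wpM2l (cmod_ge0 _) k) _.
by rewrite mulrA ler_pdivrMr// mulrC ler_pM2l// lerDl.
Qed.

(** Sup-continuity in time and a uniform bound in a smoother space give, by
    interpolation, continuity in time of the profile in every weaker space. *)
Lemma Hb_time_cont (s s' B : R) (f : R -> R -> C) : s' < s -> 0 <= B ->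
  (forall t, 0 <= t <= T -> Hb s B (f t)) -> sup_cont f ->
  forall t e, 0 <= t <= T -> 0 < e -> exists2 d, 0 < d &
    forall t', 0 <= t' <= T -> `|t' - t| < d ->
      Hb s' e (fun x => f t' x - f t x).
Proof.
move=> ss B0 hf fs t e tT e0.
have BB : 0 <= B + B by exact: addr_ge0.
have [d d0 hd] := Hb_interp ss BB e0.
have [d' d'0 hd'] := fs t _ tT d0.
exists d' => // t' t'T a; apply: hd; last exact: hd'.
exact: (HbB (hf _ t'T) (hf _ tT)).
Qed.

End Joint.

(** The space derivatives [D0], [D1] cancel along the characteristic: the
    increment of [u0 + u1] is compared with [- i N] alone. *)
Let transport_add (U0 U1 W0 W1 X0 X1 D0 D1 N M h : C) :
  U0 + U1 - (X0 + X1) - h * (- 'i * N) =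
  ((U0 - W0 - h * (-1 * D1 + - ('i / 2) * (N + M))) +
   (U1 - W1 - h * (-1 * D0 + - ('i / 2) * (N + -1 * M)))) +
  ((W0 - X0 - h * D0) + (W1 - X1 - h * D1)).
Proof. by field. Qed.

Let transport_sub (U0 U1 W0 W1 X0 X1 D0 D1 N M h : C) :
  U0 - U1 - (X0 - X1) - h * (- 'i * M) =
  ((U0 - W0 - h * (-1 * D1 + - ('i / 2) * (N + M))) -
   (U1 - W1 - h * (-1 * D0 + - ('i / 2) * (N + -1 * M)))) +
  ((W0 - X0 - (- h) * D0) - (W1 - X1 - (- h) * D1)).
Proof. by field. Qed.

Let cmod4 (a b c d : C) (e h : R) :
  cmod a <= e / 4 * h -> cmod b <= e / 4 * h -> cmod c <= e / 4 * h ->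
  cmod d <= e / 4 * h ->
  cmod ((a + b) + (c + d)) <= e * h /\ cmod ((a - b) + (c - d)) <= e * h.
Proof.
move=> ha hb hc hd.
have k1 := cmodD (a + b) (c + d); have k2 := cmodD a b; have k3 := cmodD c d.
have k4 := cmodD (a - b) (c - d); have k5 := cmodB a b; have k6 := cmodB c d.
by split; lra.
Qed.

Section Solution.
Variables (r T B BV : R) (u0 u1 w0 w1 : R -> R -> C) (V : R -> C).
Variable E : expr R var3.
Hypotheses (hr : 2^-1 < r) (T0 : 0 < T) (B0 : 0 <= B) (BV0 : 0 <= BV).
Hypotheses (wE : wf E) (HV : Hb (r + 1) BV V).
Hypothesis inc0 : forall s t x, 0 <= s -> s <= t -> t <= T ->
  u0 t x - u0 s x = cint `[s, t] (fun rho => w0 rho x).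
Hypothesis inc1 : forall s t x, 0 <= s -> s <= t -> t <= T ->
  u1 t x - u1 s x = cint `[s, t] (fun rho => w1 rho x).
Hypothesis aeH : {ae mu, forall t : R, 0 < t < T ->
  Hb (r + 1) B (u0 t) /\ Hb (r + 1) B (u1 t)}.

Let p t x := u0 t x + u1 t x.
Let q t x := u0 t x - u1 t x.
Let Np t := eval (env3 (p t) (q t) V) E.
Let Nm t := eval (env3 (q t) (p t) V) E.
Let g0 t x := - 1 * hderiv (u1 t) x + - ('i / 2) * (Np t x + Nm t x).
Let g1 t x := - 1 * hderiv (u0 t) x + - ('i / 2) * (Np t x + -1 * Nm t x).

Hypothesis eq0 : {ae mu, forall t : R, 0 < t < T -> forall x,
  w0 t x = - cderiv (u1 t) x - 'i * ((Np t x + Nm t x) / 2)}.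
Hypothesis eq1 : {ae mu, forall t : R, 0 < t < T -> forall x,
  w1 t x = - cderiv (u0 t) x - 'i * ((Np t x - Nm t x) / 2)}.

Let hr1 : 0 <= r + 1. Proof. by move: hr; lra. Qed.
Let rr1 : r <= r + 1. Proof. by move: hr; lra. Qed.
Let A := B + B + BV.

Let aerate : {ae mu, forall t : R, 0 < t < T ->
  [/\ Hb (r + 1) B (u0 t), Hb (r + 1) B (u1 t),
   (forall x, w0 t x = g0 t x) & forall x, w1 t x = g1 t x]}.
Proof.
apply: aeS2 (aeS2 (fun x h1 h2 => conj h1 h2) eq0 eq1) aeH => t [e0 e1] h tT.
have [H0 H1] := h tT; split=> // x.
  rewrite e0// (cderiv_eq (cdiff_hderiv x hr H1)) /g0; ring.
rewrite e1// (cderiv_eq (cdiff_hderiv x hr H0)) /g1; ring.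
Qed.

Let HbN t : Hb (r + 1) B (u0 t) -> Hb (r + 1) B (u1 t) ->
  Hb r (bound_const r E A) (Np t) /\ Hb r (bound_const r E A) (Nm t).
Proof.
move=> H0 H1.
have a1 : B + B <= A by rewrite lerDl.
have a2 : BV <= A by rewrite lerDr addr_ge0.
have hp : Hb r A (p t) := Hb_le a1 (HbD (Hb_lower rr1 H0) (Hb_lower rr1 H1)).
have hq : Hb r A (q t) := Hb_le a1 (HbB (Hb_lower rr1 H0) (Hb_lower rr1 H1)).
have hV : Hb r A V := Hb_le a2 (Hb_lower rr1 HV).
split; apply: (Hb_eval hr wE) => i; exact: Hb_env3.
Qed.

(** The equation bounds the velocity of almost every time uniformly in space.
    *)
Lemma solution_lip : exists2 K, 0 <= K & forall t t' x, 0 <= t <= T -> 0 <= t' <= T ->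
  cmod (u0 t x - u0 t' x) <= K * `|t - t'| /\ cmod (u1 t x - u1 t' x) <= K * `|t - t'|.
Proof.
pose K : R := cmod (-1 : C) * (sup_const r * B) +
  cmod (- ('i / 2) : C) * (sup_const r * bound_const r E A + (1 + cmod (-1 : C)) * (sup_const r * bound_const r E A)).
have A0 : 0 <= A by rewrite !addr_ge0.
have k0 := sup_const_ge0 hr; have kb0 : 0 <= bound_const r E A by exact: bound_const_ge0.
have K0 : 0 <= K.
  by rewrite addr_ge0// mulr_ge0 ?cmod_ge0// ?addr_ge0// mulr_ge0// ?addr_ge0// ?cmod_ge0// mulr_ge0.
have bd t : 0 < t < T -> Hb (r + 1) B (u0 t) -> Hb (r + 1) B (u1 t) ->
    forall x, cmod (g0 t x) <= K /\ cmod (g1 t x) <= K.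
  move=> tT H0 H1 x; have [hp hm] := HbN H0 H1.
  have b0 := Hb_sup x hr (Hb_hderiv hr H0); have b1 := Hb_sup x hr (Hb_hderiv hr H1).
  have bp := Hb_sup x hr hp; have bm := Hb_sup x hr hm.
  have bm' : cmod (-1 * Nm t x) <= cmod (-1 : C) * (sup_const r * bound_const r E A).
    by rewrite (cmodM (-1) (Nm t x)); exact: (ler_wpM2l (cmod_ge0 _) bm).
  have c1 : 1 <= 1 + cmod (-1 : C) by rewrite lerDl cmod_ge0.
  have kk : 0 <= sup_const r * bound_const r E A by rewrite mulr_ge0.
  split; apply: le_trans (cmodD _ _) _; rewrite [cmod (-1 * _)]cmodM [cmod (- ('i / 2) * _)]cmodM; apply: lerD.
  - exact: (ler_wpM2l (cmod_ge0 _) b1).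
  - apply: (ler_wpM2l (cmod_ge0 _)); apply: le_trans (cmodD _ _) _; apply: (lerD bp).
    by apply: (le_trans bm); rewrite ler_peMl.
  - exact: (ler_wpM2l (cmod_ge0 _) b0).
  - apply: (ler_wpM2l (cmod_ge0 _)); apply: le_trans (cmodD _ _) _; apply: (lerD bp).
    by apply: (le_trans bm'); rewrite ler_wpM2r// lerDr.
have l0 : {ae mu, forall t : R, 0 < t < T -> forall x, cmod (w0 t x) <= K}.
  by apply: aeS aerate => t h tT x; have [H0 H1 -> _] := h tT; have [] := bd _ tT H0 H1 x.
have l1 : {ae mu, forall t : R, 0 < t < T -> forall x, cmod (w1 t x) <= K}.
  by apply: aeS aerate => t h tT x; have [H0 H1 _ ->] := h tT; have [] := bd _ tT H0 H1 x.
exists (2 * K) => [|t t' x tT t'T]; first by rewrite mulr_ge0.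
split; [exact: (increment_le inc0 l0)|exact: (increment_le inc1 l1)].
Qed.

Lemma solution_sup_cont : sup_cont T u0 /\ sup_cont T u1.
Proof.
have [K K0 h] := solution_lip.
have K1 : 0 < K + 1 by rewrite ltr_wpDl.
have main (t t' e : R) : `|t' - t| < e / (K + 1) -> K * `|t' - t| <= e.
  move=> k; apply: le_trans (_ : (K + 1) * `|t' - t| <= e).
    by rewrite ler_wpM2r// lerDl.
  by rewrite mulrC -ler_pdivlMr// ltW.
have eK e : 0 < e -> 0 < e / (K + 1) by move=> e0; rewrite divr_gt0.
split=> t e tT e0; exists (e / (K + 1)); [exact: eK| |exact: eK|] => t' t'T a x.
  by have [k0 _] := h t' t x t'T tT; exact: (le_trans k0 (main _ _ _ a)).
by have [_ k0] := h t' t x t'T tT; exact: (le_trans k0 (main _ _ _ a)).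
Qed.

(** Regularity holds at every time, not only almost every: the good times are
    dense and balls of the Sobolev space are closed for uniform convergence. *)
Lemma solution_Hb t : 0 <= t <= T -> Hb (r + 1) B (u0 t) /\ Hb (r + 1) B (u1 t).
Proof.
move=> tT; have [c0 c1] := solution_sup_cont.
have main e : 0 < e -> exists t', [/\ Hb (r + 1) B (u0 t'), Hb (r + 1) B (u1 t'),
    (forall x, cmod (u0 t x - u0 t' x) <= e) & forall x, cmod (u1 t x - u1 t' x) <= e].
  move=> e0; have [d d0 hd] := c0 t e tT e0; have [d' d'0 hd'] := c1 t e tT e0.
  pose dd := Num.min d d'; have dd0 : 0 < dd by rewrite lt_min d0.
  case/andP: (tT) => t0 tT'.
  have ab : Num.max 0 (t - dd) < Num.min T (t + dd).
    by rewrite gt_max !lt_min T0 /=; apply/andP; split; [|apply/andP; split]; lra.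
  have [t' []] := ae_ex ab aerate.
  rewrite gt_max lt_min => /andP[/andP[a1 a2] /andP[a3 a4]] h.
  have t'T : 0 < t' < T by rewrite a1.
  have t'T' : 0 <= t' <= T by rewrite !ltW.
  have [H0 H1 _ _] := h t'T.
  have td : `|t' - t| < dd by rewrite ltr_norml; apply/andP; split; lra.
  move: td; rewrite lt_min => /andP[td td'].
  by exists t'; split=> // x; rewrite cmod_distC; [exact: hd|exact: hd'].
by split; apply: (Hb_closed B0) => e /main[t' [H0 H1 k0 k1]]; [exists (u0 t')|exists (u1 t')].
Qed.

Let joint_cont_hderiv (u : R -> R -> C) : (forall t, 0 <= t <= T -> Hb (r + 1) B (u t)) ->
  sup_cont T u -> joint_cont T (fun t => hderiv (u t)).
Proof.
move=> hu su; apply: joint_cont_sup => [t tT|t e tT e0].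
  by case: (Hb_hderiv hr (hu _ tT)).
pose s := (r + 2^-1) / 2.
have hs : 2^-1 < s by rewrite /s; move: hr; lra.
have sr : s + 1 < r + 1 by rewrite /s; move: hr; lra.
have ek : 0 < e / sup_const s by rewrite divr_gt0// (lt_le_trans ltr01)// sup_const_ge1.
have [d d0 hd] := Hb_time_cont sr B0 hu su tT ek.
exists d => // t' t'T a x.
have := Hb_sup x hs (Hb_hderiv hs (hd _ t'T a)).
rewrite (hderivB hr (hu _ t'T) (hu _ tT)) mulrCA divff ?mulr1//.
by rewrite gt_eqF// (lt_le_trans ltr01)// sup_const_ge1.
Qed.

Let HbpqV t : 0 <= t <= T -> [/\ Hb r A (p t), Hb r A (q t) & Hb r A V].
Proof.
move=> /solution_Hb[H0 H1].
have a1 : B + B <= A by rewrite lerDl.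
have a2 : BV <= A by rewrite lerDr addr_ge0.
split; last exact: (Hb_le a2 (Hb_lower rr1 HV)).
  exact: (Hb_le a1 (HbD (Hb_lower rr1 H0) (Hb_lower rr1 H1))).
exact: (Hb_le a1 (HbB (Hb_lower rr1 H0) (Hb_lower rr1 H1))).
Qed.

Let jcont_N : joint_cont T Np /\ joint_cont T Nm.
Proof.
have [c0 c1] := solution_sup_cont.
have h0 t : 0 <= t <= T -> Hb (r + 1) B (u0 t) by move=> /solution_Hb[].
have h1 t : 0 <= t <= T -> Hb (r + 1) B (u1 t) by move=> /solution_Hb[].
have A0 : 0 <= A by rewrite !addr_ge0.
have r1 : r < r + 1 by rewrite ltrDl.
pose k := sup_const r * lip_const r E A.
have k0 : 0 <= k by rewrite mulr_ge0 ?sup_const_ge0//; exact: lip_const_ge0.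
have hd t e : 0 <= t <= T -> 0 < e -> exists2 d, 0 < d &
    forall t', 0 <= t' <= T -> `|t' - t| < d ->
      [/\ Hb r e (fun x => p t' x - p t x), Hb r e (fun x => q t' x - q t x) &
          Hb r e (fun x => V x - V x)].
  move=> tT e0; have e2 : 0 < e / 2 by rewrite divr_gt0.
  have [d d0 hd] := Hb_time_cont r1 B0 h0 c0 tT e2.
  have [d' d'0 hd'] := Hb_time_cont r1 B0 h1 c1 tT e2.
  exists (Num.min d d') => [|t' t'T]; first by rewrite lt_min d0.
  rewrite lt_min => /andP[a a'].
  have H0 := hd _ t'T a; have H1 := hd' _ t'T a'; rewrite (splitr e); split.
  - by apply: Hb_ext (HbD H0 H1) => x; rewrite /p; ring.
  - by apply: Hb_ext (HbB H0 H1) => x; rewrite /q; ring.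
  - apply: Hb_le (Hb_ext _ (Hb0 r)) => [|x]; first by rewrite -splitr ltW.
    by rewrite subrr.
have fin (e : R) : 0 < e -> sup_const r * (lip_const r E A * (e / (k + 1))) <= e.
  move=> e0; rewrite mulrA mulrA ler_pdivrMr ?ltr_wpDl// mulrC ler_pM2l//.
  by rewrite lerDl.
have ek (e : R) : 0 < e -> 0 < e / (k + 1) by move=> e0; rewrite divr_gt0// ltr_wpDl.
split; apply: joint_cont_sup.
- by move=> t /solution_Hb[H0 H1]; case: (HbN H0 H1) => [[]].
- move=> t e tT e0; have [d d0 hd'] := hd t _ tT (ek _ e0).
  exists d => // t' t'T a x; have [dp dq dV] := hd' _ t'T a.
  have [hp hq hV] := HbpqV tT; have [hp' hq' hV'] := HbpqV t'T.
  have H := @Hb_eval_lip _ _ hr _ E A _ (env3 (p t') (q t') V) (env3 (p t) (q t) V) wE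
    (fun i => Hb_env3 i hp' hq' hV) (fun i => Hb_env3 i hp hq hV) (Hb_env3B dp dq dV).
  exact: (le_trans (Hb_sup x hr H) (fin _ e0)).
- by move=> t /solution_Hb[H0 H1]; case: (HbN H0 H1) => [_ []].
- move=> t e tT e0; have [d d0 hd'] := hd t _ tT (ek _ e0).
  exists d => // t' t'T a x; have [dp dq dV] := hd' _ t'T a.
  have [hp hq hV] := HbpqV tT; have [hp' hq' hV'] := HbpqV t'T.
  have H := @Hb_eval_lip _ _ hr _ E A _ (env3 (q t') (p t') V) (env3 (q t) (p t) V) wE
    (fun i => Hb_env3 i hq' hp' hV) (fun i => Hb_env3 i hq hp hV) (Hb_env3B dq dp dV).
  exact: (le_trans (Hb_sup x hr H) (fin _ e0)).
Qed.

Let jcont_g : joint_cont T g0 /\ joint_cont T g1.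
Proof.
have [jp jm] := jcont_N; have [c0 c1] := solution_sup_cont.
have h0 t : 0 <= t <= T -> Hb (r + 1) B (u0 t) by move=> /solution_Hb[].
have h1 t : 0 <= t <= T -> Hb (r + 1) B (u1 t) by move=> /solution_Hb[].
split; apply: joint_contD.
- exact: (joint_contZ _ (joint_cont_hderiv h1 c1)).
- exact: (joint_contZ _ (joint_contD jp jm)).
- exact: (joint_contZ _ (joint_cont_hderiv h0 c0)).
- exact: (joint_contZ _ (joint_contD jp (joint_contZ _ jm))).
Qed.

Let rates t x : 0 < t < T -> forall e, 0 < e -> exists2 d, 0 < d &
  forall h y, `|h| < d -> `|y - x| < d ->
    cmod (u0 (t + h) y - u0 t y - h%:C * g0 t x) <= e * `|h| /\
    cmod (u1 (t + h) y - u1 t y - h%:C * g1 t x) <= e * `|h|.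
Proof.
move=> tT; have [j0 j1] := jcont_g.
have tT' : 0 <= t <= T by case/andP: tT => a b; rewrite !ltW.
have k0 := @increment_rate T u0 w0 inc0 t x (g0 t x) tT.
have k1 := @increment_rate T u1 w1 inc1 t x (g1 t x) tT.
have {}k0 := k0 _; have {}k1 := k1 _.
have H0 e : 0 < e -> exists2 d, 0 < d &
    {ae mu, forall rho : R, 0 < rho < T -> `|rho - t| < d ->
       forall y, `|y - x| < d -> cmod (w0 rho y - g0 t x) <= e}.
  move=> e0; have [d d0 hd] := j0 t x e tT' e0; exists d => //.
  apply: aeS aerate => rho h rT rd y yd; have [_ _ -> _] := h rT.
  by apply: hd => //; case/andP: rT => a b; rewrite !ltW.
have H1 e : 0 < e -> exists2 d, 0 < d &
    {ae mu, forall rho : R, 0 < rho < T -> `|rho - t| < d ->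
       forall y, `|y - x| < d -> cmod (w1 rho y - g1 t x) <= e}.
  move=> e0; have [d d0 hd] := j1 t x e tT' e0; exists d => //.
  apply: aeS aerate => rho h rT rd y yd; have [_ _ _ ->] := h rT.
  by apply: hd => //; case/andP: rT => a b; rewrite !ltW.
move=> e e0; have [d d0 hd] := k0 H0 e e0; have [d' d'0 hd'] := k1 H1 e e0.
exists (Num.min d d') => [|h y]; first by rewrite lt_min d0.
rewrite !lt_min => /andP[a a'] /andP[b b'].
by split; [exact: hd|exact: hd'].
Qed.

(** The rates [g0], [g1] given by the equation extend to jointly continuous
    functions, so [u0] and [u1] have these as time derivatives in the
    classical sense; along its characteristic the transport terms of each
    combination cancel. *)
Lemma solution_characteristics t x : 0 < t < T ->
  cdiff (fun s => p (t + s) (x + s)) 0 (- 'i * Np t x) /\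
  cdiff (fun s => q (t + s) (x - s)) 0 (- 'i * Nm t x).
Proof.
move=> tT; have tT' : 0 <= t <= T by case/andP: tT => a b; rewrite !ltW.
have [H0 H1] := solution_Hb tT'.
split=> e e0; have e4 : 0 < e / 4 by rewrite divr_gt0.
  have [d d0 hd] := rates x tT e4.
  have [d1 d10 hd1] := cdiff_hderiv x hr H0 e4.
  have [d2 d20 hd2] := cdiff_hderiv x hr H1 e4.
  exists (Num.min d (Num.min d1 d2)) => [|h]; first by rewrite !lt_min d0 d10.
  rewrite !lt_min => /andP[a /andP[a1 a2]].
  have ax : `|x + h - x| < d by rewrite [x + h]addrC addrK.
  have [k0 k1] := hd h (x + h) a ax.
  have k2 := hd1 _ a1; have k3 := hd2 _ a2.
  rewrite /p !add0r !addr0.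
  rewrite (transport_add _ _ (u0 t (x + h)) (u1 t (x + h)) _ _
    (hderiv (u0 t) x) (hderiv (u1 t) x) (Np t x) (Nm t x)).
  exact: (cmod4 k0 k1 k2 k3).1.
have [d d0 hd] := rates x tT e4.
have [d1 d10 hd1] := cdiff_hderiv x hr H0 e4.
have [d2 d20 hd2] := cdiff_hderiv x hr H1 e4.
exists (Num.min d (Num.min d1 d2)) => [|h]; first by rewrite !lt_min d0 d10.
rewrite !lt_min => /andP[a /andP[a1 a2]].
have ax : `|x - h - x| < d by rewrite addrAC subrr sub0r normrN.
have [k0 k1] := hd h (x - h) a ax.
rewrite -normrN in a1 a2; have k2 := hd1 _ a1; have k3 := hd2 _ a2.
rewrite normrN in k2 k3.
rewrite rmorphN in k2 k3.
rewrite /q !add0r !addr0 !subr0.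
rewrite (transport_sub _ _ (u0 t (x - h)) (u1 t (x - h)) _ _
  (hderiv (u0 t) x) (hderiv (u1 t) x) (Np t x) (Nm t x)).
exact: (cmod4 k0 k1 k2 k3).2.
Qed.

Lemma solution_lip_joint : exists K, forall t t' x x',
  0 <= t <= T -> 0 <= t' <= T ->
  cmod (u0 t x - u0 t' x') <= K * (`|t - t'| + `|x - x'|) /\
  cmod (u1 t x - u1 t' x') <= K * (`|t - t'| + `|x - x'|).
Proof.
have [K K0 hK] := solution_lip.
pose K' := sup_const r * (2 * B).
have K'0 : 0 <= K' by rewrite mulr_ge0 ?sup_const_ge0// mulr_ge0.
have sp (f : R -> C) x x' : Hb (r + 1) B f -> cmod (f x - f x') <= K' * `|x - x'|.
  move=> hf; have := Hb_sup x' hr (Hb_shift_sub (x - x') hr hf).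
  rewrite /shift (_ : x' + (x - x') = x); last by ring.
  move=> k; apply: le_trans k _.
  by rewrite /K' le_eqVlt; apply/orP; left; apply/eqP; ring.
have ad (a b c : R) : a <= K * b -> forall d, d <= K' * c -> 0 <= b -> 0 <= c ->
    a + d <= (K + K') * (b + c).
  move=> h1 d h2 b0 c0; rewrite mulrDl !mulrDr.
  have := mulr_ge0 K0 c0; have := mulr_ge0 K'0 b0; lra.
exists (K + K') => t t' x x' tT t'T.
have [k0 k1] := hK t t' x tT t'T; have [H0 H1] := solution_Hb t'T.
split.
  have -> : u0 t x - u0 t' x' = (u0 t x - u0 t' x) + (u0 t' x - u0 t' x') by ring.
  by apply: le_trans (cmodD _ _) _; exact: (ad _ _ _ k0 _ (sp _ x x' H0)).
have -> : u1 t x - u1 t' x' = (u1 t x - u1 t' x) + (u1 t' x - u1 t' x') by ring.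
by apply: le_trans (cmodD _ _) _; exact: (ad _ _ _ k1 _ (sp _ x x' H1)).
Qed.

End Solution.
End Characteristics.

(** * The two problems in characteristic variables *)

Section Problems.
Variable R : realType.
Local Notation C := R[i].
Variable lambda : R.

Definition Phi1 (h : R) (e : expr R var3) : expr R var3 :=
  Mult (fun l => phi1 ('i * h%:C * l%:~R)) e.

Let P : expr R var3 := Var vp.
Let Q : expr R var3 := Var vq.
Let VV : expr R var3 := Var vv.
Let sq (e : expr R var3) := Mul e (Conj e).

(** The symbol of [dxx_inv]. *)
Definition Linv (l : int) : C := if l == 0 then 0 else - (l%:~R ^- 2).

(** The rate of the component [vp]; exchanging [vp] and [vq] gives that of the
    other. The cubic terms are those of [F], since [|phi_1| ^ 2 - |phi_2| ^ 2]
    is the real part of the product of [p] and the conjugate of [q]. *)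
Definition rate_ext : expr R var3 :=
  Add (Add Q (Mul VV P))
      (Scale (lambda%:C / 2) (Add (Mul P (sq Q)) (Mul (Conj P) (Mul Q Q)))).

(** The potential solves the Poisson equation with density half of [|p| ^ 2 +
    |q| ^ 2], and is part of the rate. *)
Definition rate_DP : expr R var3 :=
  Add (Add Q (Scale (- 2^-1) (Mul P (Mult Linv (Add (sq P) (sq Q))))))
      (Scale (lambda%:C / 2) (Add (Mul P (sq Q)) (Mul (Conj P) (Mul Q Q)))).

(** The average over a step of the rate when the component [vq] and the
    potential drift past the frozen component [vp], at relative speeds [2] and
    [1]. *)
Definition mean_ext (a : R) : expr R var3 :=
  Add (Add (Phi1 (2 * a) Q) (Mul (Phi1 a VV) P))
      (Scale (lambda%:C / 2)
        (Add (Mul P (Phi1 (2 * a) (sq Q))) (Mul (Conj P) (Phi1 (2 * a) (Mul Q Q))))).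

Definition mean_DP (a : R) : expr R var3 :=
  Add (Add (Phi1 (2 * a) Q)
      (Scale (- 2^-1) (Mul P (Mult Linv (Add (sq P) (Phi1 (2 * a) (sq Q)))))))
      (Scale (lambda%:C / 2)
        (Add (Mul P (Phi1 (2 * a) (sq Q))) (Mul (Conj P) (Phi1 (2 * a) (Mul Q Q))))).

Lemma Linv_le1 l : cmod (Linv l) <= 1.
Proof.
rewrite /Linv; case: eqVneq => [_|l0]; first by rewrite cmod0.
rewrite cmodN intrC -rmorphXn -fmorphV cmod_real ger0_norm ?invr_ge0 ?sqr_ge0//.
rewrite invf_le1 ?exprn_even_gt0 ?intr_eq0//.
rewrite -[leRHS]real_normK ?num_real// expr_ge1// -intr_norm ler1z.
by rewrite -gtz0_ge1 normr_gt0.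
Qed.

Ltac wf_tac := match goal with
  | |- True => exact: I
  | |- context [phi1 _] => exact: phi1_symbol_le1
  | |- context [Linv _] => exact: Linv_le1
  end.

Lemma wf_rate_ext : wf rate_ext. Proof. by []. Qed.
Lemma wf_rate_DP : wf rate_DP. Proof. by rewrite /=; do ![split|move=> l]; wf_tac. Qed.
Lemma wf_mean_ext a : wf (mean_ext a).
Proof. by rewrite /=; do ![split|move=> l]; wf_tac. Qed.
Lemma wf_mean_DP a : wf (mean_DP a).
Proof. by rewrite /=; do ![split|move=> l]; wf_tac. Qed.

Let dPhi1 r A (f : R -> C) (c sg s x : R) : 2^-1 < r -> Hb r A f ->
  cdiff (fun s0 => s0%:C * phi1_op (c * (sg * s0)) f x) s (shift (c * (sg * s)) f x).
Proof.
move=> hr hf; rewrite /shift mulrA.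
by apply: cdiff_ext (cdiff_phi1_op (c * sg) x s hr hf) => y; rewrite mulrA.
Qed.

Lemma eval_mean_ext a (p q V : R -> C) x : eval (env3 p q V) (mean_ext a) x =
  phi1_op (2 * a) q x + phi1_op a V x * p x + lambda%:C / 2 *
   (p x * phi1_op (2 * a) (fun y => q y * (q y)^*) x +
    (p x)^* * phi1_op (2 * a) (fun y => q y * q y) x).
Proof. by []. Qed.

Lemma eval_mean_DP a (p q V : R -> C) x : eval (env3 p q V) (mean_DP a) x =
  phi1_op (2 * a) q x + - 2^-1 *
   (p x * fmult Linv (fun y => p y * (p y)^* +
     phi1_op (2 * a) (fun y => q y * (q y)^*) y) x) + lambda%:C / 2 *
   (p x * phi1_op (2 * a) (fun y => q y * (q y)^*) x +
    (p x)^* * phi1_op (2 * a) (fun y => q y * q y) x).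
Proof. by []. Qed.

Lemma eval_rate_ext (p q V : R -> C) x : eval (env3 p q V) rate_ext x =
  q x + V x * p x + lambda%:C / 2 *
   (p x * (q x * (q x)^*) + (p x)^* * (q x * q x)).
Proof. by []. Qed.

Lemma eval_rate_DP (p q V : R -> C) x : eval (env3 p q V) rate_DP x =
  q x + - 2^-1 *
   (p x * fmult Linv (fun y => p y * (p y)^* + q y * (q y)^*) x) + lambda%:C / 2 *
   (p x * (q x * (q x)^*) + (p x)^* * (q x * q x)).
Proof. by []. Qed.

Section Derivatives.
Variables (r A : R) (p q V : R -> C) (sg s x : R).
Hypotheses (hr : 2^-1 < r) (hp : Hb r A p) (hq : Hb r A q) (hV : Hb r A V).
Let qs := shift (2 * (sg * s)) q.

Let dq : cdiff (fun s0 => s0%:C * phi1_op (2 * (sg * s0)) q x) s (qs x).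
Proof. exact: dPhi1 hr hq. Qed.

Let dcubic : cdiff (fun s0 => s0%:C * (lambda%:C / 2 *
    (p x * phi1_op (2 * (sg * s0)) (fun y => q y * (q y)^*) x +
     (p x)^* * phi1_op (2 * (sg * s0)) (fun y => q y * q y) x))) s
  (lambda%:C / 2 * (p x * (qs x * (qs x)^*) + (p x)^* * (qs x * qs x))).
Proof.
have k1 := cdiffZ (lambda%:C / 2 * p x) (dPhi1 2 sg s x hr (HbM hr hq (HbJ hq))).
have k2 := cdiffZ (lambda%:C / 2 * (p x)^*) (dPhi1 2 sg s x hr (HbM hr hq hq)).
have -> : lambda%:C / 2 * (p x * (qs x * (qs x)^*) + (p x)^* * (qs x * qs x)) =
  lambda%:C / 2 * p x * (qs x * (qs x)^*) + lambda%:C / 2 * (p x)^* * (qs x * qs x) by ring.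
apply: cdiff_ext (cdiffD k1 k2) => y; move: (p x) => P0.
move: (phi1_op _ _ x) (phi1_op _ _ x) => a b. ring.
Qed.

Lemma mean_ext_deriv :
  cdiff (fun s0 => s0%:C * eval (env3 p q V) (mean_ext (sg * s0)) x) s
    (eval (env3 p (shift (2 * (sg * s)) q) (shift (sg * s) V)) rate_ext x).
Proof.
have k0 := dPhi1 1 sg s x hr hV; rewrite mul1r in k0.
have k := cdiffZ (p x) (cdiff_ext (fun y => congr1 (fun z => y%:C * phi1_op z V x)
  (mul1r (sg * y))) k0).
rewrite eval_rate_ext -/(qs x) [shift (sg * s) V x * p x]mulrC.
apply: cdiff_ext (cdiffD (cdiffD dq k) dcubic) => y; rewrite eval_mean_ext.
move: (p x) => P0.
move: (phi1_op _ _ x) (phi1_op _ _ x) (phi1_op _ _ x) (phi1_op _ _ x) => a b c d.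
ring.
Qed.

(** The inverse Laplacian commutes with the drift of [|q| ^ 2]. *)
Lemma mean_DP_deriv :
  cdiff (fun s0 => s0%:C * eval (env3 p q V) (mean_DP (sg * s0)) x) s
    (eval (env3 p (shift (2 * (sg * s)) q) (shift (sg * s) V)) rate_DP x).
Proof.
have hqq := HbM hr hq (HbJ hq); have hpp := HbM hr hp (HbJ hp).
have k1 := cdiffZ (- 2^-1 * p x) (dPhi1 2 sg s x hr (Hb_fmult hr Linv_le1 hqq)).
have k2 := cdiffZ (- 2^-1 * p x * fmult Linv (fun y => p y * (p y)^*) x) (cdiff_real s).
have -> : eval (env3 p (shift (2 * (sg * s)) q) (shift (sg * s) V)) rate_DP x =
  qs x + (- 2^-1 * p x * shift (2 * (sg * s)) (fmult Linv (fun y => q y * (q y)^*)) x +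
   - 2^-1 * p x * fmult Linv (fun y => p y * (p y)^*) x * 1) +
  lambda%:C / 2 * (p x * (qs x * (qs x)^*) + (p x)^* * (qs x * qs x)).
  have hs := Hb_shift (2 * (sg * s)) hr hqq.
  rewrite eval_rate_DP (fmultD hr Linv_le1 hpp hs) -(fmult_shift _ hr Linv_le1 hqq) -/(qs x).
  move: (fmult _ _ x) (fmult _ _ x) (p x) (qs x) => a b c d; ring.
apply: cdiff_ext (cdiffD (cdiffD dq (cdiffD k1 k2)) dcubic) => y.
have hs := Hb_phi1_op (2 * (sg * y)) hr hqq.
have e : fmult Linv (phi1_op (2 * (sg * y)) (fun y => q y * (q y)^*)) =
    phi1_op (2 * (sg * y)) (fmult Linv (fun y => q y * (q y)^*)).
  exact: (fmultC hr Linv_le1 (phi1_symbol_le1 _) hqq).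
rewrite eval_mean_DP (fmultD hr Linv_le1 hpp hs) e.
move: (p x) => P0; move: (fmult _ _ x) => L0.
move: (phi1_op _ _ x) (phi1_op _ _ x) (phi1_op _ _ x) (phi1_op _ _ x) => a b c d.
ring.
Qed.

End Derivatives.
End Problems.

(** * The schemes in characteristic variables *)

Local Opaque exp_op phi1_op.

Section Schemes.
Variable R : realType.
Local Notation C := R[i].
Local Notation torus_fun := (R -> R[i]).
Local Notation spinor_fun := (R -> 'cV[R[i]]_2).
Variable lambda : R.

Lemma mx2_mul0 (a b c d : C) (v : 'cV[C]_2) : (mx2 a b c d *m v) 0 0 = a * v 0 0 + b * v 1 0.
Proof. by rewrite !mxE !big_ord_recl big_ord0 addr0 !mxE /=; congr (_ + _ * v _ _); apply/val_inj. Qed.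

Lemma mx2_mul1 (a b c d : C) (v : 'cV[C]_2) : (mx2 a b c d *m v) 1 0 = c * v 0 0 + d * v 1 0.
Proof. by rewrite !mxE !big_ord_recl big_ord0 addr0 !mxE /=; congr (_ + _ * v _ _); apply/val_inj. Qed.

Lemma vec2_0 (a b : C) : vec2 a b 0 0 = a. Proof. by rewrite mxE. Qed.
Lemma vec2_1 (a b : C) : vec2 a b 1 0 = b. Proof. by rewrite mxE. Qed.

Lemma scale_entry (z : C) (v : 'cV[C]_2) j : (z *: v) j 0 = z * v j 0.
Proof. by rewrite mxE. Qed.
Lemma add_entry (v w : 'cV[C]_2) j : (v + w) j 0 = v j 0 + w j 0.
Proof. by rewrite mxE. Qed.
Lemma opp_entry (v : 'cV[C]_2) j : (- v) j 0 = - v j 0.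
Proof. by rewrite mxE. Qed.

Lemma ord2 (j : 'I_2) : {j = 0} + {j = 1}.
Proof. by case: j => [[|[|?]]] // ?; [left|right]; apply: val_inj. Qed.

Definition entryE := (scale_entry, add_entry, opp_entry).

(** The coordinates in the eigenbasis of [alpha]: these components travel
    along the characteristics. *)
Definition plus (Phi : spinor_fun) : torus_fun := fun x => Phi x 0 0 + Phi x 1 0.
Definition minus (Phi : spinor_fun) : torus_fun := fun x => Phi x 0 0 - Phi x 1 0.

Lemma sqabsE (z : C) : sqabs z = z * z^*.
Proof. by rewrite /sqabs normCK. Qed.

Lemma i_ImE (z : C) : 'i * (complex.Im z)%:C = (z - z^*) / 2.
Proof.
have -> : z - z^* = 'i * (complex.Im z)%:C + 'i * (complex.Im z)%:C.
  by apply: eq_ReIm; rewrite !ReImE; ring.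
by field.
Qed.

Lemma scalemul_entry (a : C) (M : 'M[C]_2) (v : 'cV[C]_2) j :
  ((a *: M) *m v) j 0 = a * (M *m v) j 0.
Proof. by rewrite -scalemxAl scale_entry. Qed.

Lemma lift2_entry (A : torus_fun -> torus_fun) (Psi : spinor_fun) x j :
  lift2 A Psi x j 0 = A (cpt Psi j) x.
Proof. by rewrite mxE. Qed.

Lemma Pip0 (v : 'cV[C]_2) : (Pip R *m v) 0 0 = 2^-1 * (v 0 0 + v 1 0).
Proof. by rewrite /Pip -scalemxAl scale_entry mx2_mul0; ring. Qed.
Lemma Pip1 (v : 'cV[C]_2) : (Pip R *m v) 1 0 = 2^-1 * (v 0 0 + v 1 0).
Proof. by rewrite /Pip -scalemxAl scale_entry mx2_mul1; ring. Qed.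
Lemma Pim0 (v : 'cV[C]_2) : (Pim R *m v) 0 0 = 2^-1 * (v 0 0 - v 1 0).
Proof. by rewrite /Pim -scalemxAl scale_entry mx2_mul0; ring. Qed.
Lemma Pim1 (v : 'cV[C]_2) : (Pim R *m v) 1 0 = - 2^-1 * (v 0 0 - v 1 0).
Proof. by rewrite /Pim -scalemxAl scale_entry mx2_mul1; ring. Qed.
Lemma beta0 (v : 'cV[C]_2) : (beta R *m v) 0 0 = v 0 0.
Proof. by rewrite mx2_mul0; ring. Qed.
Lemma beta1 (v : 'cV[C]_2) : (beta R *m v) 1 0 = - v 1 0.
Proof. by rewrite mx2_mul1; ring. Qed.

Lemma Pip_cpt (Phi : spinor_fun) j :
  cpt (fun y => Pip R *m Phi y) j = fun y => 2^-1 * plus Phi y.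
Proof. by apply/funext => y; case: (ord2 j) => ->; [exact: Pip0|exact: Pip1]. Qed.

Lemma Pim_cpt0 (Phi : spinor_fun) :
  cpt (fun y => Pim R *m Phi y) 0 = fun y => 2^-1 * minus Phi y.
Proof. by apply/funext => y; exact: Pim0. Qed.

Lemma Pim_cpt1 (Phi : spinor_fun) :
  cpt (fun y => Pim R *m Phi y) 1 = fun y => - 2^-1 * minus Phi y.
Proof. by apply/funext => y; exact: Pim1. Qed.

Lemma exp_opZ (r A h : R) (c : C) (u : torus_fun) x : 2^-1 < r -> Hb r A u ->
  exp_op h (fun y => c * u y) x = c * shift h u x.
Proof. by move=> hr hu; rewrite (exp_opE h hr (HbZ c hu)). Qed.

Lemma phi1_opZ (r A h : R) (c : C) (u : torus_fun) x : 2^-1 < r -> Hb r A u ->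
  phi1_op h (fun y => c * u y) x = c * phi1_op h u x.
Proof.
move=> hr hu; exact: (congr1 (fun f => f x) (fmultZ c hr (phi1_symbol_le1 h) hu)).
Qed.

Lemma exp_alpha_comp (r A B h : R) (Phi : spinor_fun) x : 2^-1 < r ->
  Hb r A (plus Phi) -> Hb r B (minus Phi) ->
  plus (exp_alpha h Phi) x = shift h (plus Phi) x /\
  minus (exp_alpha h Phi) x = shift (- h) (minus Phi) x.
Proof.
move=> hr hp hm.
have P j : lift2 (exp_op h) (fun y => Pip R *m Phi y) x j 0 = 2^-1 * shift h (plus Phi) x.
  by rewrite lift2_entry Pip_cpt (exp_opZ _ _ _ hr hp).
have M0 : lift2 (exp_op (- h)) (fun y => Pim R *m Phi y) x 0 0 = 2^-1 * shift (- h) (minus Phi) x.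
  by rewrite lift2_entry Pim_cpt0 (exp_opZ _ _ _ hr hm).
have M1 : lift2 (exp_op (- h)) (fun y => Pim R *m Phi y) x 1 0 = - 2^-1 * shift (- h) (minus Phi) x.
  by rewrite lift2_entry Pim_cpt1 (exp_opZ _ _ _ hr hm).
have E0 : exp_alpha h Phi x 0 0 = _ := etrans (add_entry _ _ _) (f_equal2 +%R (P 0) M0).
have E1 : exp_alpha h Phi x 1 0 = _ := etrans (add_entry _ _ _) (f_equal2 +%R (P 1) M1).
rewrite {1}/plus {1}/minus E0 E1.
by move: (shift _ _ x) (shift _ _ x) => a b; split; field.
Qed.

Section Comp.
Variables (r A tau : R) (Phi : spinor_fun).
Hypotheses (hr : 2^-1 < r).
Let p := plus Phi.
Let q := minus Phi.
Hypotheses (hp : Hb r A p) (hq : Hb r A q).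

Lemma I1_comp x : plus (I1 tau Phi) x = tau%:C * phi1_op (2 * tau) q x /\
  minus (I1 tau Phi) x = tau%:C * phi1_op (- (2 * tau)) p x.
Proof.
have e j : cpt (fun y => beta R *m Pim R *m Phi y) j = fun y => 2^-1 * q y.
  apply/funext => y; rewrite /cpt -mulmxA.
  by case: (ord2 j) => ->; [rewrite beta0 Pim0|rewrite beta1 Pim1 mulNr opprK].
have f0 : cpt (fun y => beta R *m Pip R *m Phi y) 0 = fun y => 2^-1 * p y.
  by apply/funext => y; rewrite /cpt -mulmxA beta0 Pip0.
have f1 : cpt (fun y => beta R *m Pip R *m Phi y) 1 = fun y => - 2^-1 * p y.
  by apply/funext => y; rewrite /cpt -mulmxA beta1 Pip1 mulNr.
have M j : lift2 (phi1_op (2 * tau)) (fun y => beta R *m Pim R *m Phi y) x j 0 =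
    2^-1 * phi1_op (2 * tau) q x.
  by rewrite lift2_entry e (phi1_opZ _ _ _ hr hq).
have P0 : lift2 (phi1_op (- (2 * tau))) (fun y => beta R *m Pip R *m Phi y) x 0 0 =
    2^-1 * phi1_op (- (2 * tau)) p x.
  by rewrite lift2_entry f0 (phi1_opZ _ _ _ hr hp).
have P1 : lift2 (phi1_op (- (2 * tau))) (fun y => beta R *m Pip R *m Phi y) x 1 0 =
    - 2^-1 * phi1_op (- (2 * tau)) p x.
  by rewrite lift2_entry f1 (phi1_opZ _ _ _ hr hp).
have E0 : I1 tau Phi x 0 0 = _ := etrans (scale_entry _ _ _) (congr1 _
  (etrans (add_entry _ _ _) (f_equal2 +%R (M 0) P0))).
have E1 : I1 tau Phi x 1 0 = _ := etrans (scale_entry _ _ _) (congr1 _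
  (etrans (add_entry _ _ _) (f_equal2 +%R (M 1) P1))).
rewrite /plus /minus E0 E1.
by move: (phi1_op _ _ x) (phi1_op _ _ x) => a b; split; field.
Qed.

Lemma I2_ext_comp (V : R -> R) x :
  plus (I2_ext tau Phi V) x = tau%:C * (phi1_op tau (fun y => (V y)%:C) x * p x) /\
  minus (I2_ext tau Phi V) x = tau%:C * (phi1_op (- tau) (fun y => (V y)%:C) x * q x).
Proof.
have alg0 (a b u w : C) : a * (2^-1 * u) + b * (2^-1 * w) = (a * u + b * w) / 2.
  by field.
have alg1 (a b u w : C) : a * (2^-1 * u) + b * (- 2^-1 * w) = (a * u - b * w) / 2.
  by field.
have PM0 (a b : C) (v : 'cV[C]_2) : ((a *: Pip R + b *: Pim R) *m v) 0 0 =
    (a * (v 0 0 + v 1 0) + b * (v 0 0 - v 1 0)) / 2.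
  have -> : ((a *: Pip R + b *: Pim R) *m v) 0 0 =
      a * (Pip R *m v) 0 0 + b * (Pim R *m v) 0 0.
    by rewrite mulmxDl add_entry; exact: f_equal2 (scalemul_entry _ _ _ _) (scalemul_entry _ _ _ _).
  exact: (etrans (f_equal2 _ (congr1 _ (Pip0 v)) (congr1 _ (Pim0 v))) (alg0 _ _ _ _)).
have PM1 (a b : C) (v : 'cV[C]_2) : ((a *: Pip R + b *: Pim R) *m v) 1 0 =
    (a * (v 0 0 + v 1 0) - b * (v 0 0 - v 1 0)) / 2.
  have -> : ((a *: Pip R + b *: Pim R) *m v) 1 0 =
      a * (Pip R *m v) 1 0 + b * (Pim R *m v) 1 0.
    by rewrite mulmxDl add_entry; exact: f_equal2 (scalemul_entry _ _ _ _) (scalemul_entry _ _ _ _).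
  exact: (etrans (f_equal2 _ (congr1 _ (Pip1 v)) (congr1 _ (Pim1 v))) (alg1 _ _ _ _)).
have E0 : I2_ext tau Phi V x 0 0 = tau%:C * (((phi1_op tau (fun y => (V y)%:C) x *
    (Phi x 0 0 + Phi x 1 0)) + phi1_op (- tau) (fun y => (V y)%:C) x *
    (Phi x 0 0 - Phi x 1 0)) / 2).
  by rewrite /I2_ext scale_entry PM0.
have E1 : I2_ext tau Phi V x 1 0 = tau%:C * (((phi1_op tau (fun y => (V y)%:C) x *
    (Phi x 0 0 + Phi x 1 0)) - phi1_op (- tau) (fun y => (V y)%:C) x *
    (Phi x 0 0 - Phi x 1 0)) / 2).
  by rewrite /I2_ext scale_entry PM1.
rewrite /plus /minus E0 E1 /p /q /plus /minus.
by move: (phi1_op _ _ x) (phi1_op _ _ x) => a b; split; field.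
Qed.

Lemma I3_comp x :
  plus (I3 lambda tau Phi) x = tau%:C * (lambda%:C / 2 *
   (p x * phi1_op (2 * tau) (fun y => q y * (q y)^*) x +
    (p x)^* * phi1_op (2 * tau) (fun y => q y * q y) x)) /\
  minus (I3 lambda tau Phi) x = tau%:C * (lambda%:C / 2 *
   (q x * phi1_op (- (2 * tau)) (fun y => p y * (p y)^*) x +
    (q x)^* * phi1_op (- (2 * tau)) (fun y => p y * p y) x)).
Proof.
have E0 : I3 lambda tau Phi x 0 0 = (tau * lambda)%:C / 4 *
    (((p x)^* * phi1_op (2 * tau) (fun y => q y ^+ 2) x +
       p x * phi1_op (2 * tau) (fun y => sqabs (q y)) x) +
     (q x * phi1_op (- (2 * tau)) (fun y => sqabs (p y)) x +
       (q x)^* * phi1_op (- (2 * tau)) (fun y => p y ^+ 2) x)).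
  by rewrite /I3 scale_entry vec2_0.
have E1 : I3 lambda tau Phi x 1 0 = (tau * lambda)%:C / 4 *
    (((p x)^* * phi1_op (2 * tau) (fun y => q y ^+ 2) x +
       p x * phi1_op (2 * tau) (fun y => sqabs (q y)) x) -
     (q x * phi1_op (- (2 * tau)) (fun y => sqabs (p y)) x +
       (q x)^* * phi1_op (- (2 * tau)) (fun y => p y ^+ 2) x)).
  by rewrite /I3 scale_entry vec2_1.
have e (u : torus_fun) : (fun y => sqabs (u y)) = fun y => u y * (u y)^*.
  by apply/funext => y; rewrite sqabsE.
rewrite /plus /minus E0 E1 (e p) (e q) rmorphM /=.
move: (p x) (q x) => P0 Q0.
move: (phi1_op _ _ x) (phi1_op _ _ x) (phi1_op _ _ x) (phi1_op _ _ x) => a b c d.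
by split; field.
Qed.

Lemma I2_DP_comp x :
  plus (I2_DP tau Phi) x = tau%:C * (- 2^-1 * (p x * fmult (@Linv R)
    (fun y => p y * (p y)^* + phi1_op (2 * tau) (fun y => q y * (q y)^*) y) x)) /\
  minus (I2_DP tau Phi) x = tau%:C * (- 2^-1 * (q x * fmult (@Linv R)
    (fun y => q y * (q y)^* + phi1_op (- (2 * tau)) (fun y => p y * (p y)^*) y) x)).
Proof.
have E0 : I2_DP tau Phi x 0 0 = - (tau%:C / 4) *
   (p x * fmult (@Linv R) (fun y => phi1_op (2 * tau) (fun z => sqabs (q z)) y + sqabs (p y)) x +
    q x * fmult (@Linv R) (fun y => phi1_op (- (2 * tau)) (fun z => sqabs (p z)) y + sqabs (q y)) x).
  by rewrite /I2_DP scale_entry vec2_0.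
have E1 : I2_DP tau Phi x 1 0 = - (tau%:C / 4) *
   (p x * fmult (@Linv R) (fun y => phi1_op (2 * tau) (fun z => sqabs (q z)) y + sqabs (p y)) x -
    q x * fmult (@Linv R) (fun y => phi1_op (- (2 * tau)) (fun z => sqabs (p z)) y + sqabs (q y)) x).
  by rewrite /I2_DP scale_entry vec2_1.
have e (u : torus_fun) : (fun y => sqabs (u y)) = fun y => u y * (u y)^*.
  by apply/funext => y; rewrite sqabsE.
have e2 h (u v : torus_fun) : (fun y => phi1_op h (fun z => sqabs (u z)) y + sqabs (v y)) =
    (fun y => v y * (v y)^* + phi1_op h (fun y => u y * (u y)^*) y).
  by apply/funext => y; rewrite sqabsE e addrC.
have alg (t P a Q b a' b' z0 z1 : C) : z0 = - (t / 4) * (P * a + Q * b) ->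
    z1 = - (t / 4) * (P * a - Q * b) -> a = a' -> b = b' ->
    z0 + z1 = t * (- 2^-1 * (P * a')) /\ z0 - z1 = t * (- 2^-1 * (Q * b')).
  by move=> -> -> -> ->; split; field.
exact: (alg _ _ _ _ _ _ _ _ _ E0 E1
  (congr1 (fun f => fmult (@Linv R) f x) (e2 _ q p))
  (congr1 (fun f => fmult (@Linv R) f x) (e2 _ p q))).
Qed.

Lemma Theta_comp (I2 : spinor_fun) (Wp Wm : torus_fun) (B B' : R) :
  Hb r B Wp -> Hb r B' Wm ->
  (forall x, plus (I1 tau Phi) x + plus I2 x + plus (I3 lambda tau Phi) x = tau%:C * Wp x) ->
  (forall x, minus (I1 tau Phi) x + minus I2 x + minus (I3 lambda tau Phi) x = tau%:C * Wm x) ->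
  forall x,
  plus (Theta lambda tau Phi I2) x = shift (- tau) p x - 'i * (tau%:C * shift (- tau) Wp x) /\
  minus (Theta lambda tau Phi I2) x = shift tau q x - 'i * (tau%:C * shift tau Wm x).
Proof.
move=> hWp hWm ep em x.
pose J : spinor_fun := fun y => I1 tau Phi y + I2 y + I3 lambda tau Phi y.
have Jp : plus J = fun x => tau%:C * Wp x.
  apply/funext => y; rewrite -ep /plus /J !add_entry.
  move: (I1 _ _ _ 0 0) (I1 _ _ _ 1 0) (I2 _ 0 0) (I2 _ 1 0) (I3 _ _ _ _ 0 0) (I3 _ _ _ _ 1 0).
  by move=> ? ? ? ? ? ?; ring.
have Jm : minus J = fun x => tau%:C * Wm x.
  apply/funext => y; rewrite -em /minus /J !add_entry.
  move: (I1 _ _ _ 0 0) (I1 _ _ _ 1 0) (I2 _ 0 0) (I2 _ 1 0) (I3 _ _ _ _ 0 0) (I3 _ _ _ _ 1 0).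
  by move=> ? ? ? ? ? ?; ring.
have hJp := HbZ tau%:C hWp; rewrite -Jp in hJp.
have hJm := HbZ tau%:C hWm; rewrite -Jm in hJm.
have [a1 a2] := exp_alpha_comp (- tau) x hr hp hq.
have [b1 b2] := exp_alpha_comp (- tau) x hr hJp hJm.
rewrite opprK in a2 b2; rewrite Jp in b1; rewrite Jm in b2.
have E j : Theta lambda tau Phi I2 x j 0 = exp_alpha (- tau) Phi x j 0 - 'i * exp_alpha (- tau) J x j 0.
  exact: (etrans (add_entry _ _ _) (congr1 (fun z => _ + z)
    (etrans (opp_entry _ _) (congr1 -%R (scale_entry _ _ _))))).
have alg (z0 z1 u0 u1 v0 v1 s t : C) : z0 = u0 - 'i * v0 -> z1 = u1 - 'i * v1 ->
    (u0 + u1 = s -> v0 + v1 = t -> z0 + z1 = s - 'i * t) /\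
    (u0 - u1 = s -> v0 - v1 = t -> z0 - z1 = s - 'i * t).
  by move=> -> ->; split=> <- <-; ring.
split; [exact: ((alg _ _ _ _ _ _ _ _ (E 0) (E 1)).1 a1 b1)|
        exact: ((alg _ _ _ _ _ _ _ _ (E 0) (E 1)).2 a2 b2)].
Qed.

Lemma nonlin_comp (V : torus_fun) x :
  plus (nonlin lambda V Phi) x = q x + V x * p x + lambda%:C / 2 *
    (p x * (q x * (q x)^*) + (p x)^* * (q x * q x)) /\
  minus (nonlin lambda V Phi) x = p x + V x * q x + lambda%:C / 2 *
    (q x * (p x * (p x)^*) + (q x)^* * (p x * p x)).
Proof.
have E0 : nonlin lambda V Phi x 0 0 = Phi x 0 0 + V x * Phi x 0 0 +
    lambda%:C * (Phi x 0 0 * (Phi x 0 0)^* - Phi x 1 0 * (Phi x 1 0)^*) * Phi x 0 0.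
  by rewrite /nonlin /Fnl /beta_form !entryE beta0 2!sqabsE.
have E1 : nonlin lambda V Phi x 1 0 = - Phi x 1 0 + V x * Phi x 1 0 +
    lambda%:C * (Phi x 0 0 * (Phi x 0 0)^* - Phi x 1 0 * (Phi x 1 0)^*) * - Phi x 1 0.
  by rewrite /nonlin /Fnl /beta_form !entryE beta1 2!sqabsE.
rewrite {1}/plus {1}/minus E0 E1 /p /q /plus /minus 2!rmorphD rmorphN /=.
move: (Phi x 0 0) (Phi x 1 0) (V x) => a b v.
by move: (a^*) (b^*) => a' b'; split; field.
Qed.

(** The derivative of the rate in the direction of the velocities [- i n], [-
    i m] of the two components, times [i]; the potential is held fixed at its
    value [v]. *)
Definition dcorr (v P Q n m : C) : C :=
  m + v * n + lambda%:C / 2 *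
    (n * (Q * Q^*) + P * (m * Q^* - Q * m^*) + (P^* * (2 * (m * Q)) - n^* * (Q * Q))).

(** The terms of the scheme with [G] are, in these variables, the derivative
    of the rate: the imaginary part recombines the conjugates. *)
Lemma correction_comp (G : spinor_fun) (v : C) x :
  plus (fun x => - ((tau ^+ 2 / 2)%:C *: (beta R *m G x + v *: G x)) +
     F_correction lambda tau Phi G x) x =
    - ((tau ^+ 2 / 2)%:C * dcorr v (p x) (q x) (plus G x) (minus G x)) /\
  minus (fun x => - ((tau ^+ 2 / 2)%:C *: (beta R *m G x + v *: G x)) +
     F_correction lambda tau Phi G x) x =
    - ((tau ^+ 2 / 2)%:C * dcorr v (q x) (p x) (minus G x) (plus G x)).
Proof.
pose Z := Phi x 0 0 * (G x 0 0)^* + (Phi x 1 0)^* * G x 1 0.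
pose bf := Phi x 0 0 * (Phi x 0 0)^* - Phi x 1 0 * (Phi x 1 0)^*.
pose W : spinor_fun := fun x => - ((tau ^+ 2 / 2)%:C *: (beta R *m G x + v *: G x)) +
     F_correction lambda tau Phi G x.
have E0 : W x 0 0 = - ((tau ^+ 2 / 2)%:C * (G x 0 0 + v * G x 0 0)) +
   (- ((lambda * tau ^+ 2 / 2)%:C * bf) * G x 0 0 +
    ('i * (lambda * tau ^+ 2)%:C * (complex.Im Z)%:C) * Phi x 0 0).
  by rewrite /W /F_correction /beta_form !entryE !beta0 2!sqabsE.
have E1 : W x 1 0 = - ((tau ^+ 2 / 2)%:C * (- G x 1 0 + v * G x 1 0)) +
   (- ((lambda * tau ^+ 2 / 2)%:C * bf) * - G x 1 0 +
    ('i * (lambda * tau ^+ 2)%:C * (complex.Im Z)%:C) * - Phi x 1 0).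
  by rewrite /W /F_correction /beta_form !entryE !beta1 2!sqabsE.
have iZ c : 'i * c * (complex.Im Z)%:C = c * ((Z - Z^*) / 2).
  by rewrite -i_ImE; ring.
have cZ : Z^* = (Phi x 0 0)^* * G x 0 0 + Phi x 1 0 * (G x 1 0)^*.
  by rewrite /Z rmorphD 2!rmorphM /= 2!conjCK.
have t2 : (tau ^+ 2 / 2)%:C = (tau ^+ 2)%:C / 2 :> C by rewrite rmorphM /= fmorphV /= rmorph_nat.
have l2 : (lambda * tau ^+ 2 / 2)%:C = lambda%:C * ((tau ^+ 2)%:C / 2) :> C.
  by rewrite -mulrA rmorphM /= t2.
have l1 : (lambda * tau ^+ 2)%:C = lambda%:C * (tau ^+ 2)%:C :> C by rewrite rmorphM.
rewrite -/W /p /q /plus /minus E0 E1 !iZ cZ l2 l1 t2 /dcorr /bf /Z.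
rewrite 4!rmorphD 2!rmorphN /=.
move: (Phi x 0 0) (Phi x 1 0) (G x 0 0) (G x 1 0) => a b g h.
move: (a^*) (b^*) (g^*) (h^*) (lambda%:C) ((tau ^+ 2)%:C) => a' b' g' h' l t.
by split; field.
Qed.

End Comp.
End Schemes.

Section SchemeSteps.
Variable R : realType.
Local Notation C := R[i].
Local Notation torus_fun := (R -> R[i]).
Local Notation spinor_fun := (R -> 'cV[R[i]]_2).
Variable lambda : R.

Let ii : 'i * 'i = -1 :> C. Proof. by rewrite -expr2 sqr_i. Qed.
Let conj_Ni (z : C) : (- 'i * z)^* = 'i * z^*.
Proof. by apply: eq_ReIm; rewrite !ReImE; ring. Qed.

Let alg_ext (l v P Q P' Q' n m n' m' : C) :
  'i * (- 'i * m + (0 * v * P + v * (- 'i * n)) + l *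
    ((- 'i * n) * (Q * Q') + P * ((- 'i * m) * Q' + Q * ('i * m')) +
     (('i * n') * (Q * Q) + P' * ((- 'i * m) * Q + Q * (- 'i * m))))) =
  m + v * n + l * (n * (Q * Q') + P * (m * Q' - Q * m') + (P' * (2 * (m * Q)) - n' * (Q * Q))).
Proof.
set X := RHS; have -> : X = - (-1 * X) by ring.
by rewrite -ii /X; ring.
Qed.

Lemma eval_corr_ext (p q V : torus_fun) x :
  eval (env3 p q V) (corr (rate_ext lambda)) x =
  dcorr lambda (V x) (p x) (q x) (eval (env3 p q V) (rate_ext lambda) x)
    (eval (env3 q p V) (rate_ext lambda) x).
Proof.
rewrite eval_corr.
move: (eval (env3 p q V) _) (eval (env3 q p V) _) => n m.
have -> : eval (env2 (env3 p q V) (env3 (fun y => - 'i * n y) (fun y => - 'i * m y)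
    (fun y => 0 * V y))) (dexpr (rate_ext lambda)) x =
  - 'i * m x + (0 * V x * p x + V x * (- 'i * n x)) + lambda%:C / 2 *
    ((- 'i * n x) * (q x * (q x)^*) +
       p x * ((- 'i * m x) * (q x)^* + q x * (- 'i * m x)^*) +
     ((- 'i * n x)^* * (q x * q x) +
       (p x)^* * ((- 'i * m x) * q x + q x * (- 'i * m x)))) by [].
by rewrite 2!conj_Ni alg_ext.
Qed.

(** The potential of the Poisson equation contributes to the correction both
    its value and its derivative through the density. *)
Lemma eval_corr_DP (p q V : torus_fun) x :
  eval (env3 p q V) (corr (rate_DP lambda)) x =
  dcorr lambda (- 2^-1 * fmult (@Linv R) (fun y => p y * (p y)^* + q y * (q y)^*) x) (p x) (q x)
    (eval (env3 p q V) (rate_DP lambda) x) (eval (env3 q p V) (rate_DP lambda) x) +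
  'i * (- 2^-1 * (p x * fmult (@Linv R) (eval (env2 (env3 p q V)
     (env3 (fun y => - 'i * eval (env3 p q V) (rate_DP lambda) y)
       (fun y => - 'i * eval (env3 q p V) (rate_DP lambda) y) (fun y => 0 * V y)))
     (dexpr (Add (Mul (Var vp) (Conj (Var vp))) (Mul (Var vq) (Conj (Var vq)))))) x)).
Proof.
rewrite eval_corr.
move: (eval (env3 p q V) _) (eval (env3 q p V) _) => n m.
set L := fmult _ _ x; set D := fmult _ _ x.
have -> : eval (env2 (env3 p q V) (env3 (fun y => - 'i * n y) (fun y => - 'i * m y)
    (fun y => 0 * V y))) (dexpr (rate_DP lambda)) x =
  - 'i * m x + - 2^-1 * ((- 'i * n x) * L + p x * D) + lambda%:C / 2 *
    ((- 'i * n x) * (q x * (q x)^*) +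
       p x * ((- 'i * m x) * (q x)^* + q x * (- 'i * m x)^*) +
     ((- 'i * n x)^* * (q x * q x) +
       (p x)^* * ((- 'i * m x) * q x + q x * (- 'i * m x)))) by [].
rewrite 2!conj_Ni /dcorr -(alg_ext (lambda%:C / 2)).
move: (p x) (q x) ((p x)^*) ((q x)^*) ((n x)^*) ((m x)^*) (n x) (m x) => *; ring.
Qed.

Lemma plus_add (F A B : spinor_fun) x : F x = A x + B x -> plus F x = plus A x + plus B x.
Proof. by move=> e; rewrite /plus e !add_entry addrACA. Qed.

Lemma minus_add (F A B : spinor_fun) x : F x = A x + B x -> minus F x = minus A x + minus B x.
Proof. by move=> e; rewrite /minus e !add_entry opprD addrACA. Qed.

Section Steps.
Variables (r A tau : R) (Phi : spinor_fun).
Hypotheses (hr : 2^-1 < r).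
Let p := plus Phi.
Let q := minus Phi.
Hypotheses (hp : Hb r A p) (hq : Hb r A q).

Let step_plus E E1 (V : torus_fun) x : step E E1 1 tau p q V x =
  shift (- tau) p x - 'i * (tau%:C * shift (- tau) (eval (env3 p q V) (E1 tau)) x) -
  (tau ^+ 2 / 2)%:C * eval (env3 p q V) (corr E) x.
Proof. by rewrite /step mul1r. Qed.

Let step_minus E E1 (V : torus_fun) x : step E E1 (-1) tau q p V x =
  shift tau q x - 'i * (tau%:C * shift tau (eval (env3 q p V) (E1 (- tau))) x) -
  (tau ^+ 2 / 2)%:C * eval (env3 q p V) (corr E) x.
Proof. by rewrite /step mulN1r opprK. Qed.

Let sum3 (a b c d e f t : C) : a = t * d -> b = t * e -> c = t * f ->
  a + b + c = t * (d + e + f).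
Proof. by move=> -> -> ->; rewrite !mulrDr. Qed.

Lemma ULI2_ext_stepE (V : R -> R) : Hb r A (fun x => (V x)%:C) ->
  plus (ULI2_ext_step lambda tau Phi V) =
    step (rate_ext lambda) (mean_ext lambda) 1 tau p q (fun x => (V x)%:C) /\
  minus (ULI2_ext_step lambda tau Phi V) =
    step (rate_ext lambda) (mean_ext lambda) (-1) tau q p (fun x => (V x)%:C).
Proof.
set Vc : torus_fun := fun x => (V x)%:C => hV.
have hWp := Hb_eval hr (wf_mean_ext lambda tau) (fun i => Hb_env3 i hp hq hV).
have hWm := Hb_eval hr (wf_mean_ext lambda (- tau)) (fun i => Hb_env3 i hq hp hV).
have ep x : plus (I1 tau Phi) x + plus (I2_ext tau Phi V) x + plus (I3 lambda tau Phi) x =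
    tau%:C * eval (env3 p q Vc) (mean_ext lambda tau) x.
  rewrite eval_mean_ext.
  exact: sum3 (I1_comp tau hr hp hq x).1 (I2_ext_comp _ _ _ _).1 (I3_comp _ _ _ _).1.
have em x : minus (I1 tau Phi) x + minus (I2_ext tau Phi V) x + minus (I3 lambda tau Phi) x =
    tau%:C * eval (env3 q p Vc) (mean_ext lambda (- tau)) x.
  rewrite eval_mean_ext mulrN.
  exact: sum3 (I1_comp tau hr hp hq x).2 (I2_ext_comp _ _ _ _).2 (I3_comp _ _ _ _).2.
pose G := nonlin lambda Vc Phi.
have gp : plus G = eval (env3 p q Vc) (rate_ext lambda).
  by apply/funext => x; rewrite eval_rate_ext; exact: (nonlin_comp _ _ _ _).1.
have gm : minus G = eval (env3 q p Vc) (rate_ext lambda).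
  by apply/funext => x; rewrite eval_rate_ext; exact: (nonlin_comp _ _ _ _).2.
have split_step x : ULI2_ext_step lambda tau Phi V x =
    Theta lambda tau Phi (I2_ext tau Phi V) x +
    (fun y => - ((tau ^+ 2 / 2)%:C *: (beta R *m G y + Vc x *: G y)) +
       F_correction lambda tau Phi G y) x.
  by rewrite addrA.
have T x := Theta_comp hr hp hq hWp hWm ep em x.
split; apply/funext => x.
  apply: (etrans (plus_add (split_step x))); rewrite step_plus eval_corr_ext -gp -gm.
  exact: f_equal2 (T x).1 (correction_comp _ _ _ _ _ _).1.
apply: (etrans (minus_add (split_step x))); rewrite step_minus eval_corr_ext -gp -gm.
exact: f_equal2 (T x).2 (correction_comp _ _ _ _ _ _).2.
Qed.

Let V_DP_E x : V_DP Phi x =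
  - 2^-1 * fmult (@Linv R) (fun y => p y * (p y)^* + q y * (q y)^*) x.
Proof.
have h := HbD (HbM hr hp (HbJ hp)) (HbM hr hq (HbJ hq)).
have e : (fun y => density (Phi y)) = fun y => 2^-1 * (p y * (p y)^* + q y * (q y)^*).
  apply/funext => y; rewrite /density !sqabsE /p /q /plus /minus 2!rmorphD rmorphN /=.
  by move: (Phi y 0 0) (Phi y 1 0) => a b; move: (a^*) (b^*) => a' b'; field.
rewrite /V_DP /dxx_inv e (fmultZ _ hr (@Linv_le1 R) h); ring.
Qed.

Lemma nonlin_DP_comp : plus (nonlin lambda (V_DP Phi) Phi) = eval (env3 p q (fun=> 0)) (rate_DP lambda) /\
  minus (nonlin lambda (V_DP Phi) Phi) = eval (env3 q p (fun=> 0)) (rate_DP lambda).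
Proof.
have alg (L P : C) : - 2^-1 * L * P = - 2^-1 * (P * L) by ring.
split; apply/funext => x; rewrite eval_rate_DP.
  have [-> _] := nonlin_comp lambda Phi (V_DP Phi) x.
  by rewrite V_DP_E alg.
have [_ ->] := nonlin_comp lambda Phi (V_DP Phi) x.
rewrite V_DP_E alg.
have -> : (fun y => q y * (q y)^* + p y * (p y)^*) = (fun y => p y * (p y)^* + q y * (q y)^*).
  by apply/funext => y; rewrite addrC.
by [].
Qed.

Let density_rate (n m : torus_fun) (y : R) : C :=
  ((- 'i * n y) * (p y)^* + p y * (- 'i * n y)^*) +
  ((- 'i * m y) * (q y)^* + q y * (- 'i * m y)^*).

(** The argument of [dxx_inv] in the last term of the scheme is, up to a
    constant, the derivative of the density in the direction of the rates. *)
Let density_rateE (G : spinor_fun) y :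
  (complex.Im (Phi y 0 0 * (G y 0 0)^* - (Phi y 1 0)^* * G y 1 0))%:C =
  - 4^-1 * density_rate (plus G) (minus G) y.
Proof.
pose W := Phi y 0 0 * (G y 0 0)^* - (Phi y 1 0)^* * G y 1 0.
have cW : W^* = (Phi y 0 0)^* * G y 0 0 - Phi y 1 0 * (G y 1 0)^*.
  by rewrite /W rmorphB 2!rmorphM /= 2!conjCK.
have -> : (complex.Im W)%:C = - (-1 * (complex.Im W)%:C) by ring.
rewrite -ii -mulrA i_ImE cW /W /density_rate 2!conj_Ni /p /q /plus /minus.
rewrite 4!rmorphD 2!rmorphN /=.
move: (Phi y 0 0) (Phi y 1 0) (G y 0 0) (G y 1 0) => a b g h.
move: (a^*) (b^*) (g^*) (h^*) => a' b' g' h'.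
by field.
Qed.

Let step_algebra (th b f g P : 'cV[C]_2) (t d k : C) :
  th - t *: b + f + (t * d) *: g - k *: P =
  th + (- (t *: (b + (- d) *: g)) + f + (- k) *: P).
Proof.
rewrite scalerDr scalerA mulrN !scaleNr opprD opprK !addrA; congr (_ - _).
exact: addrAC.
Qed.

Lemma ULI2_DP_stepE :
  plus (ULI2_DP_step lambda tau Phi) =
    step (rate_DP lambda) (mean_DP lambda) 1 tau p q (fun=> 0) /\
  minus (ULI2_DP_step lambda tau Phi) =
    step (rate_DP lambda) (mean_DP lambda) (-1) tau q p (fun=> 0).
Proof.
pose Vc : torus_fun := fun=> 0.
have hV : Hb r A Vc by exact: (Hb_le (Hb_ge0 hp) (Hb0 r)).
have hWp := Hb_eval hr (wf_mean_DP lambda tau) (fun i => Hb_env3 i hp hq hV).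
have hWm := Hb_eval hr (wf_mean_DP lambda (- tau)) (fun i => Hb_env3 i hq hp hV).
have ep x : plus (I1 tau Phi) x + plus (I2_DP tau Phi) x + plus (I3 lambda tau Phi) x =
    tau%:C * eval (env3 p q Vc) (mean_DP lambda tau) x.
  rewrite eval_mean_DP.
  exact: sum3 (I1_comp tau hr hp hq x).1 (I2_DP_comp _ _ _).1 (I3_comp _ _ _ _).1.
have em x : minus (I1 tau Phi) x + minus (I2_DP tau Phi) x + minus (I3 lambda tau Phi) x =
    tau%:C * eval (env3 q p Vc) (mean_DP lambda (- tau)) x.
  rewrite eval_mean_DP mulrN.
  exact: sum3 (I1_comp tau hr hp hq x).2 (I2_DP_comp _ _ _).2 (I3_comp _ _ _ _).2.
pose G := nonlin lambda (V_DP Phi) Phi.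
have [gp gm] := nonlin_DP_comp; rewrite -/G in gp gm.
have hgp := Hb_eval hr (wf_rate_DP lambda) (fun i => Hb_env3 i hp hq hV).
have hgm := Hb_eval hr (wf_rate_DP lambda) (fun i => Hb_env3 i hq hp hV).
rewrite -gp in hgp; rewrite -gm in hgm.
have hpi := HbZ (- 'i) hgp; have hmi := HbZ (- 'i) hgm.
have hD := HbD (HbD (HbM hr hpi (HbJ hp)) (HbM hr hp (HbJ hpi)))
  (HbD (HbM hr hmi (HbJ hq)) (HbM hr hq (HbJ hmi))).
pose D := density_rate (plus G) (minus G).
pose kappa x := 'i * (tau ^+ 2)%:C * dxx_inv (fun y =>
    (complex.Im (Phi y 0 0 * (G y 0 0)^* - (Phi y 1 0)^* * G y 1 0))%:C) x.
have kE x : kappa x = 'i * (tau ^+ 2)%:C * (- 4^-1 * fmult (@Linv R) D x).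
  rewrite /kappa (funext (density_rateE G)) -/D.
  exact: (congr1 (fun f => _ * f x) (fmultZ (- 4^-1) hr (@Linv_le1 R) hD)).
have split_step x : ULI2_DP_step lambda tau Phi x =
    Theta lambda tau Phi (I2_DP tau Phi) x +
    (fun y => (fun y => - ((tau ^+ 2 / 2)%:C *: (beta R *m G y + V_DP Phi x *: G y)) +
       F_correction lambda tau Phi G y) y + - kappa x *: Phi y) x.
  exact: step_algebra.
pose W x : spinor_fun := fun y =>
  - ((tau ^+ 2 / 2)%:C *: (beta R *m G y + V_DP Phi x *: G y)) + F_correction lambda tau Phi G y.
pose K x : spinor_fun := fun y => - kappa x *: Phi y.
have T x := Theta_comp hr hp hq hWp hWm ep em x.
have comm : (fun y => q y * (q y)^* + p y * (p y)^*) = (fun y => p y * (p y)^* + q y * (q y)^*).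
  by apply/funext => y; rewrite addrC.
have alg (P a L : C) : - ((tau ^+ 2 / 2)%:C * a) + - ('i * (tau ^+ 2)%:C * (- 4^-1 * L)) * P =
    - ((tau ^+ 2 / 2)%:C * (a + 'i * (- 2^-1 * (P * L)))).
  have -> : (tau ^+ 2 / 2)%:C = (tau ^+ 2)%:C / 2 :> C by rewrite rmorphM /= fmorphV /= rmorph_nat.
  by move: ((tau ^+ 2)%:C) => t; field.
have scp x k : plus (fun y => k *: Phi y) x = k * p x by rewrite /plus !entryE -mulrDr.
have scm x k : minus (fun y => k *: Phi y) x = k * q x by rewrite /minus !entryE -mulrBr.
split; apply/funext => x.
  apply: (etrans (plus_add (split_step x))); rewrite step_plus eval_corr_DP.
  rewrite -V_DP_E -gp -gm -alg.
  apply: (f_equal2 +%R (T x).1); apply: (etrans (@plus_add (fun y => W x y + K x y) (W x) (K x) x (erefl _))).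
  apply: (f_equal2 +%R (correction_comp _ _ _ _ _ _).1).
  exact: (etrans (scp x (- kappa x)) (congr1 (fun z => - z * p x) (kE x))).
apply: (etrans (minus_add (split_step x))); rewrite step_minus eval_corr_DP comm.
rewrite -V_DP_E -gp -gm -alg.
apply: (f_equal2 +%R (T x).2); apply: (etrans (@minus_add (fun y => W x y + K x y) (W x) (K x) x (erefl _))).
apply: (f_equal2 +%R (correction_comp _ _ _ _ _ _).2).
apply: (etrans (scm x (- kappa x)) (etrans (congr1 (fun z => - z * q x) (kE x)) _)).
have Dc : D = (fun y =>
    ((- 'i * minus G y) * (q y)^* + q y * (- 'i * minus G y)^*) +
    ((- 'i * plus G y) * (p y)^* + p y * (- 'i * plus G y)^*)) by apply/funext => y; rewrite /D /density_rate addrC.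
by rewrite Dc.
Qed.

End Steps.

End SchemeSteps.

(** * Smooth potentials *)

Section Smooth.
Variable R : realType.
Local Notation C := R[i].
Local Notation mu := (@lebesgue_measure R).
Local Notation Re := complex.Re.
Local Notation Im := complex.Im.

Lemma cdiff_ccont (f d : R -> C) : (forall x, cdiff f x (d x)) -> ccontinuous f.
Proof.
move=> fd; split=> x; apply: differentiable_continuous; apply/derivable1_diffP;
  by have /cdiffP[] := fd x => h1 h2; apply: ex_derive.
Qed.

Lemma cdiffM (f g : R -> C) (x : R) (d e : C) : cdiff f x d -> cdiff g x e ->
  cdiff (fun y => f y * g y) x (d * g x + f x * e).
Proof.
move=> /cdiffP[f1 f2] /cdiffP[g1 g2]; apply/cdiffP; split.
- have h := is_deriveB (is_deriveM f1 g1) (is_deriveM f2 g2).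
  rewrite (_ : (fun y => Re (f y * g y)) = (fun y => Re (f y)) * (fun y => Re (g y)) -
    (fun y => Im (f y)) * (fun y => Im (g y))); last by apply/funext => y; rewrite Re_M.
  by apply: is_derive_eq h _; rewrite !ReImE /GRing.scale /=; ring.
- have h := is_deriveD (is_deriveM f1 g2) (is_deriveM f2 g1).
  rewrite (_ : (fun y => Im (f y * g y)) = (fun y => Re (f y)) * (fun y => Im (g y)) +
    (fun y => Im (f y)) * (fun y => Re (g y))); last by apply/funext => y; rewrite Im_M.
  by apply: is_derive_eq h _; rewrite !ReImE /GRing.scale /=; ring.
Qed.

Lemma mean_deriv (U u : R -> C) : (forall x, cdiff U x (u x)) -> ccontinuous u ->
  U (2 * pi) = U 0 -> mean u = 0.
Proof.
move=> dU [u1 u2] per.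
have d1 (x : R) : is_derive x 1 (fun x => Re (U x)) (Re (u x)) by have /cdiffP[] := dU x.
have d2 (x : R) : is_derive x 1 (fun x => Im (U x)) (Im (u x)) by have /cdiffP[] := dU x.
apply: eq_ReIm; rewrite ?Re_mean ?Im_mean.
  by rewrite (Rint_FTC u1 d1) per subrr mulr0.
by rewrite (Rint_FTC u2 d2) per subrr mulr0.
Qed.

(** All derivatives at once; the class is stable under [f - f''], which
    [smooth_decay] exploits. *)
Definition smooth (f : R -> C) := exists F : nat -> R -> C,
  [/\ F 0%N = f, forall n, periodic2pi (F n) & forall n x, cdiff (F n) x (F n.+1 x)].

Lemma fcoef_bounded (f : R -> C) : ccontinuous f -> exists K, forall l, cmod (fcoef f l) <= K.
Proof.
move=> cf; have [c1 c2] := cf.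
have cn : {within `[0, 2 * pi], continuous (fun x => Re (f x) ^+ 2 + Im (f x) ^+ 2)}.
  apply: continuous_subspaceT => x.
  have k1 := c1 x; have k2 := c2 x.
  exact: (cvgD (cvgM k1 k1) (cvgM k2 k2)).
have [c _ hc] := EVT_max (ltW (twopi_gt0 R)) cn.
exists (2 * cmod (f c)) => l.
have H : {ae mu, forall x : R, 0 < x < 2 * pi -> cmod (f x * mode (- l) x - 0) <= cmod (f c)}.
  apply: aeW => x /andP[x0 x1]; rewrite subr0 cmodM cmod_mode mulr1.
  by rewrite ler_wsqrtr// hc// in_itv/= !ltW.
have := cint_ae_near (ltW (twopi_gt0 R)) H; rewrite mulr0 !subr0 => h.
rewrite fcoefE meanE cmodM cmod_real ger0_norm ?invr_ge0 ?(ltW (twopi_gt0 R))//.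
rewrite ler_pdivrMl ?twopi_gt0//.
by rewrite [leRHS]mulrC.
Qed.

Lemma fcoef_deriv (f g : R -> C) l : periodic2pi f -> (forall x, cdiff f x (g x)) ->
  ccontinuous g -> fcoef g l = 'i * l%:~R * fcoef f l.
Proof.
move=> pf fd cg; have cf := cdiff_ccont fd.
have cm := @ccont_mode R (- l).
have H : mean (fun x => g x * mode (- l) x + - ('i * l%:~R) * (f x * mode (- l) x)) = 0.
  apply: (@mean_deriv (fun x => f x * mode (- l) x)).
  - move=> x; have := cdiffM (fd x) (cdiff_mode (- l) x).
    have -> // : f x * ('i%R * (- l)%:~R * mode (- l) x) = - ('i * l%:~R) * (f x * mode (- l) x).
    by rewrite rmorphN /=; ring.
  - exact: (ccontD (ccontM cg cm) (ccontZ _ (ccontM cf cm))).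
  - have h := pf 0; have h' := @mode_period R (- l) 0; rewrite !add0r in h h'.
    by rewrite h h'.
have e := meanD (ccontM cg cm) (ccontZ (- ('i * l%:~R)) (ccontM cf cm)).
rewrite H (meanZ _ (ccontM cf cm)) in e.
rewrite !fcoefE; move/eqP: e; rewrite eq_sym addr_eq0 => /eqP ->; ring.
Qed.

(** The coefficients of [f - f''] are those of [f] times [1 + l ^ 2], so that
    the induction needs no binomial expansion. *)
Lemma smooth_decay (m : nat) (f : R -> C) : smooth f ->
  exists K, forall l, (1 + (l%:~R : R) ^+ 2) ^+ m * cmod (fcoef f l) <= K.
Proof.
elim: m f => [|m ih] f sf; have [F [F0 pF dF]] := sf.
  have [K hK] := fcoef_bounded (cdiff_ccont (dF 0%N)).
  by exists K => l; rewrite expr0 mul1r -F0.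
have sg : smooth (fun x => F 0%N x - F 2 x).
  exists (fun n x => F n x - F n.+2 x); split=> // n x; first by rewrite !pF.
  exact: cdiffB (dF _ _) (dF _ _).
have [K hK] := ih _ sg; exists K => l.
have c n := cdiff_ccont (dF n).
have := hK l; rewrite (fcoefB _ (c 0%N) (c 2%N)).
rewrite (fcoef_deriv l (pF 1%N) (dF 1%N) (c 2%N)) (fcoef_deriv l (pF 0%N) (dF 0%N) (c 1%N)).
have -> : fcoef (F 0%N) l - 'i * l%:~R * ('i * l%:~R * fcoef (F 0%N) l) =
    (1 + (l%:~R : R) ^+ 2)%:C * fcoef f l.
  have i2 : 'i * 'i = -1 :> C by rewrite -expr2 sqr_i.
  rewrite F0 intrC rmorphD rmorphXn /= rmorph1.
  transitivity ((1 - ('i * 'i) * (l%:~R : R)%:C ^+ 2) * fcoef f l); first by ring.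
  by rewrite i2 mulN1r opprK.
rewrite cmodM cmod_real ger0_norm ?(ltW (wbase_gt0 _ _))//.
by rewrite mulrA -exprSr.
Qed.

Lemma smooth_Hb (s : R) (f : R -> C) : smooth f -> exists2 B, 0 <= B & Hb s B f.
Proof.
move=> sf; have [F [F0 pF dF]] := sf.
pose m := Num.bound (s + 1).
have hm : s + 1 <= 2 * m%:R.
  apply: le_trans (ler_norm _) _; apply: le_trans (ltW (archi_boundP (normr_ge0 _))) _.
  rewrite (_ : Num.bound `|s + 1| = m) ?ler_peMl ?ler1n//.
  by rewrite /m /Num.bound normr_id.
have [K hK] := smooth_decay m sf.
have K0 : 0 <= K.
  apply: le_trans (hK 0); apply: mulr_ge0 (cmod_ge0 _).
  exact/exprn_ge0/ltW/wbase_gt0.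
have h1 : (2^-1 : R) < 1 by lra.
have pt l : wh s l * cmod (fcoef f l) <= K * wh (-1) l.
  have -> : s = -1 + (s + 1) by ring.
  rewrite whD -mulrA [leRHS]mulrC; apply: (ler_wpM2l (wh_ge0 _ _)).
  apply: le_trans (hK l); apply: (ler_wpM2r (cmod_ge0 _)).
  apply: le_trans (wh_le l hm) _.
  by rewrite /wh mulrC mulKf// powR_mulrn// ltW// wbase_gt0.
have k1 := sup_const_ge1 h1; have k0 := sup_const_ge0 h1.
exists (K * sup_const 1); first by rewrite mulr_ge0.
split; [by rewrite -F0|by rewrite -F0; exact: cdiff_ccont (dF 0%N)|split].
  by rewrite mulr_ge0.
move=> t ut; apply: le_trans (_ : n2 t (fun l => K * wh (-1) l) <= _).
  by apply: n2_le => l _; rewrite ger0_norm// mulr_ge0 ?wh_ge0 ?cmod_ge0.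
rewrite n2Z//; apply: (ler_wpM2l K0); rewrite n2_leP//.
apply: le_trans (sup_const_sum h1 ut) _.
by rewrite expr2; nra.
Qed.

Lemma smooth_potential_smooth (V : R -> R) : smooth_potential V ->
  smooth (fun x => (V x)%:C).
Proof.
move=> [pV dV]; exists (fun n x => (derive1n n V x)%:C).
have D n (x : R) : cdiff (fun x => (derive1n n V x)%:C) x (derive1n n.+1 V x)%:C.
  apply/cdiffP; split; last exact: is_derive_cst.
  by rewrite derive1nS derive1E; apply: derivableP; exact: dV.
split=> //; elim=> [|n ih] x; first by rewrite derive1n0 pV.
have h : cdiff (fun x => (derive1n n V x)%:C) (2 * pi + x) (derive1n n.+1 V (x + 2 * pi))%:C.
  by rewrite addrC; exact: D.
rewrite -(cderiv_eq (D n x)); apply/esym/cderiv_eq.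
by apply: cdiff_ext (cdiff_shift_arg h) => y; rewrite addrC ih.
Qed.

End Smooth.

(** * Convergence *)

Section Convergence.
Variable R : realType.
Local Notation C := R[i].
Local Notation mu := (@lebesgue_measure R).
Local Notation torus_fun := (R -> R[i]).
Local Notation spinor_fun := (R -> 'cV[R[i]]_2).

Lemma solve_i (a b c : C) : 'i * a = - ('i * b) + c -> a = - b - 'i * c.
Proof.
have i2 : 'i * 'i = -1 :> C by rewrite -expr2 sqr_i.
move=> e; transitivity (- 'i * ('i * a)); first by rewrite mulrA mulNr i2 opprK mul1r.
rewrite e; transitivity (('i * 'i) * b - 'i * c); first by ring.
by rewrite i2 mulN1r.
Qed.

(** The absolute value makes the radius nonnegative by construction. *)
Lemma Linf_ae (T s : R) (Psi : R -> spinor_fun) : in_Linf T s Psi ->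
  {ae mu, forall t : R, 0 < t < T ->
    forall j, Hb s `|fine (Linf_norm T s Psi)| (cpt (Psi t) j)}.
Proof.
move=> [_ H1 H2].
have ub : (Linf_norm T s Psi <= `|fine (Linf_norm T s Psi)|%:E)%E.
  move: H2; case: (Linf_norm T s Psi) => [x| |] //= _; last by rewrite leNye.
  by rewrite lee_fin ler_norm.
have := ess_sup_ge mu (fun t : R => if 0 < t < T then Hnorm2 s (Psi t) else 0%E).
move=> H3; apply: aeS2 H3 H1 => t h k tT j.
apply: Hb_of_Hnorm2 (k tT) (normr_ge0 _) _.
by apply: le_trans ub; move: h; rewrite tT.
Qed.

Lemma alpha0 (v : 'cV[C]_2) : (alpha R *m v) 0 0 = v 1 0.
Proof. by rewrite mx2_mul0; ring. Qed.
Lemma alpha1 (v : 'cV[C]_2) : (alpha R *m v) 1 0 = v 0 0.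
Proof. by rewrite mx2_mul1; ring. Qed.

Lemma dx_entry (Psi : spinor_fun) x j : dx Psi x j 0 = cderiv (cpt Psi j) x.
Proof. by rewrite mxE. Qed.

Section Scheme.
Variables (lambda r BV : R) (E : expr R var3) (E1 : R -> expr R var3) (V : torus_fun).
Variables (Vt : spinor_fun -> torus_fun) (stp : R -> spinor_fun -> spinor_fun).
Hypotheses (hr : 2^-1 < r) (wE : wf E) (wE1 : forall a, wf (E1 a)).
Hypothesis lipE1 : forall a A : R, lip_const r (E1 a) A = lip_const r (E1 0) A.
Hypothesis dE1 : forall (A : R) (p q V : torus_fun) (sg s x : R),
  Hb r A p -> Hb r A q -> Hb r A V ->
  cdiff (fun s0 => s0%:C * eval (env3 p q V) (E1 (sg * s0)) x) s
    (eval (env3 p (shift (2 * (sg * s)) q) (shift (sg * s) V)) E x).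
Hypotheses (BV0 : 0 <= BV) (HV : Hb (r + 1) BV V).
Hypothesis nonlinE : forall (Phi : spinor_fun) (A : R),
  Hb r A (plus Phi) -> Hb r A (minus Phi) ->
  plus (nonlin lambda (Vt Phi) Phi) = eval (env3 (plus Phi) (minus Phi) V) E /\
  minus (nonlin lambda (Vt Phi) Phi) = eval (env3 (minus Phi) (plus Phi) V) E.
Hypothesis stpE : forall (tau : R) (Phi : spinor_fun) (A : R),
  Hb r A (plus Phi) -> Hb r A (minus Phi) ->
  plus (stp tau Phi) = step E E1 1 tau (plus Phi) (minus Phi) V /\
  minus (stp tau Phi) = step E E1 (-1) tau (minus Phi) (plus Phi) V.

Let rr1 : r <= r + 1. Proof. by rewrite lerDl. Qed.

Section Solution.
Variables (T : R) (Phi0 : spinor_fun) (Phi dPhi : R -> spinor_fun).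
Hypotheses (T0 : 0 < T).
Hypothesis sol : is_solution lambda T (fun t => Vt (Phi t)) Phi0 Phi dPhi.
Hypothesis reg : in_Linf T (r + 1) Phi.
Let M := fine (Linf_norm T (r + 1) Phi).
Let u (j : 'I_2) t x := Phi t x j 0.
Let w (j : 'I_2) t x := dPhi t x j 0.

Let inc j s t x : 0 <= s -> s <= t -> t <= T ->
  u j t x - u j s x = cint `[s, t] (fun rho => w j rho x).
Proof. by move=> s0 st tT; case: sol => _ _ h _; exact: h. Qed.

Let aeH : {ae mu, forall t : R, 0 < t < T ->
  Hb (r + 1) `|M| (u 0 t) /\ Hb (r + 1) `|M| (u 1 t)}.
Proof. by apply: aeS (Linf_ae reg) => t h tT; split; [exact: h tT 0|exact: h tT 1]. Qed.

Let half_sum (a b : C) : a = ((a + b) + (a - b)) / 2. Proof. by field. Qed.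
Let half_diff (a b : C) : b = ((a + b) - (a - b)) / 2. Proof. by field. Qed.

Let aeq : {ae mu, forall t : R, 0 < t < T -> forall x,
  w 0 t x = - cderiv (u 1 t) x - 'i * ((eval (env3 (plus (Phi t)) (minus (Phi t)) V) E x +
    eval (env3 (minus (Phi t)) (plus (Phi t)) V) E x) / 2) /\
  w 1 t x = - cderiv (u 0 t) x - 'i * ((eval (env3 (plus (Phi t)) (minus (Phi t)) V) E x -
    eval (env3 (minus (Phi t)) (plus (Phi t)) V) E x) / 2)}.
Proof.
case: sol => _ _ _ eqn; apply: aeS2 eqn aeH => t e h tT x.
have [h0 h1] := h tT; have hx := e tT x.
have hp := HbD (Hb_lower rr1 h0) (Hb_lower rr1 h1).
have hm := HbB (Hb_lower rr1 h0) (Hb_lower rr1 h1).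
have [Np Nm] := nonlinE hp hm.
have entry j : 'i * w j t x = - ('i * (alpha R *m dx (Phi t) x) j 0) + nonlin lambda (Vt (Phi t)) (Phi t) x j 0.
  have := congr1 (fun v : 'cV[C]_2 => v j 0) hx.
  by rewrite !entryE.
rewrite -Np -Nm /plus /minus -half_sum -half_diff.
split; apply: solve_i; rewrite entry.
  by rewrite alpha0 dx_entry.
by rewrite alpha1 dx_entry.
Qed.

Let eq0 : {ae mu, forall t : R, 0 < t < T -> forall x,
  w 0 t x = - cderiv (u 1 t) x - 'i * ((eval (env3 (plus (Phi t)) (minus (Phi t)) V) E x +
    eval (env3 (minus (Phi t)) (plus (Phi t)) V) E x) / 2)}.
Proof. by apply: aeS aeq => t h tT x; have [] := h tT x. Qed.

Let eq1 : {ae mu, forall t : R, 0 < t < T -> forall x,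
  w 1 t x = - cderiv (u 0 t) x - 'i * ((eval (env3 (plus (Phi t)) (minus (Phi t)) V) E x -
    eval (env3 (minus (Phi t)) (plus (Phi t)) V) E x) / 2)}.
Proof. by apply: aeS aeq => t h tT x; have [] := h tT x. Qed.

Let solH t : 0 <= t <= T -> Hb (r + 1) `|M| (u 0 t) /\ Hb (r + 1) `|M| (u 1 t).
Proof. exact: (solution_Hb hr T0 (normr_ge0 M) BV0 wE HV (inc 0) (inc 1) aeH eq0 eq1). Qed.

Lemma solution_plus_Hb t : 0 <= t <= T ->
  Hb (r + 1) (`|M| + `|M|) (plus (Phi t)) /\ Hb (r + 1) (`|M| + `|M|) (minus (Phi t)).
Proof. by move=> /solH[h0 h1]; split; [exact: HbD h0 h1|exact: HbB h0 h1]. Qed.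

Lemma solution_plus_lip : exists K, forall t t' x x', 0 <= t <= T -> 0 <= t' <= T ->
  cmod (plus (Phi t) x - plus (Phi t') x') <= K * (`|t - t'| + `|x - x'|) /\
  cmod (minus (Phi t) x - minus (Phi t') x') <= K * (`|t - t'| + `|x - x'|).
Proof.
have [K hK] := solution_lip_joint hr T0 (normr_ge0 M) BV0 wE HV (inc 0) (inc 1) aeH eq0 eq1.
have alg (a b a' b' : C) c : cmod (a - a') <= K * c -> cmod (b - b') <= K * c ->
    cmod (a + b - (a' + b')) <= 2 * K * c /\ cmod (a - b - (a' - b')) <= 2 * K * c.
  move=> h1 h2; rewrite -mulrA mulr_natl mulr2n; split.
    rewrite (_ : _ - _ = (a - a') + (b - b')); last by ring.
    exact: le_trans (cmodD _ _) (lerD h1 h2).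
  rewrite (_ : _ - (_ - _) = (a - a') - (b - b')); last by ring.
  exact: le_trans (cmodB _ _) (lerD h1 h2).
by exists (2 * K) => t t' x x' tT t'T; have [h1 h2] := hK t t' x x' tT t'T; exact: alg.
Qed.

Lemma solution_plus_cdiff t x : 0 < t < T ->
  cdiff (fun s => plus (Phi (t + s)) (x + s)) 0
    (- 'i * eval (env3 (plus (Phi t)) (minus (Phi t)) V) E x) /\
  cdiff (fun s => minus (Phi (t + s)) (x - s)) 0
    (- 'i * eval (env3 (minus (Phi t)) (plus (Phi t)) V) E x).
Proof.
exact: (solution_characteristics hr T0 (normr_ge0 M) BV0 wE HV (inc 0) (inc 1) aeH eq0 eq1).
Qed.

End Solution.
Definition iterates (tau : R) (Phi0 : spinor_fun) (n : nat) : spinor_fun :=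
  iter n (stp tau) Phi0.

Lemma err_bound (Psi : spinor_fun) (d : R) : Hb r d (plus Psi) -> Hb r d (minus Psi) ->
  in_Hs2 r Psi /\ (Hnorm2 r Psi <= (d + d)%:E)%E.
Proof.
move=> hp hm; have half : cmod (2^-1 : C) = 2^-1.
  have -> : 2^-1 = (2^-1 : R)%:C :> C by rewrite fmorphV /= rmorph_nat.
  by rewrite cmod_real ger0_norm.
have dd : cmod (2^-1 : C) * (d + d) = d by rewrite half; field.
have h0 := HbZ 2^-1 (HbD hp hm); have h1 := HbZ 2^-1 (HbB hp hm); rewrite dd in h0 h1.
apply: Hnorm2_Hb.
  by apply: Hb_ext h0 => x; rewrite /cpt /plus /minus; field.
by apply: Hb_ext h1 => x; rewrite /cpt /plus /minus; field.
Qed.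

Lemma error_estimate (M : R) : exists K L : R, [/\ 0 <= K, 0 <= L &
  forall (T : R) (Phi0 : spinor_fun) (Phi dPhi : R -> spinor_fun),
    0 < T -> is_solution lambda T (fun t => Vt (Phi t)) Phi0 Phi dPhi ->
    in_Linf T (r + 1) Phi -> fine (Linf_norm T (r + 1) Phi) = M ->
    forall (tau : R) (n : nat), 0 < tau -> tau <= 1 ->
      K * tau ^+ 2 * (T * expR (L * T)) <= 1 -> n%:R * tau <= T ->
      let err := Phi (n%:R * tau) - iterates tau Phi0 n in
      in_Hs2 r err /\ (Hnorm2 r err <= (2 * K * (T * expR (L * T)) * tau ^+ 2)%:E)%E].
Proof.
have [K [L [K0 L0 H]]] := global_error hr wE wE1 lipE1 dE1
  (addr_ge0 (normr_ge0 M) (normr_ge0 M)) BV0 HV.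
exists K, L; split=> // T Phi0 Phi dPhi T0 sol reg eM tau n tau0 tau1 small nT err.
have SH := solution_plus_Hb T0 sol reg; rewrite eM in SH.
have [L1 SL] := solution_plus_lip T0 sol reg.
have SC := solution_plus_cdiff T0 sol reg.
have e0 : Phi 0 = Phi0 by case: sol.
have [hp hm] := H tau T (fun t => plus (Phi t)) (fun t => minus (Phi t))
  (fun n => plus (iterates tau Phi0 n)) (fun n => minus (iterates tau Phi0 n))
  tau0 tau1 small (fun t tT => (SH t tT).1) (fun t tT => (SH t tT).2)
  (ex_intro _ L1 (fun t t' x x' tT t'T => (SL t t' x x' tT t'T).1))
  (ex_intro _ L1 (fun t t' x x' tT t'T => (SL t t' x x' tT t'T).2))
  (fun x t tT => (SC t x tT).1) (fun x t tT => (SC t x tT).2)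
  (congr1 (@plus R) (esym e0)) (congr1 (@minus R) (esym e0))
  (fun n A hp hm => stpE tau hp hm) n nT.
have nt0 : 0 <= n%:R * tau by rewrite mulr_ge0 ?ler0n ?ltW.
have dle : K * tau ^+ 2 * (n%:R * tau * expR (L * (n%:R * tau))) <=
    K * tau ^+ 2 * (T * expR (L * T)).
  apply: ler_wpM2l; first by rewrite mulr_ge0 ?sqr_ge0.
  by apply: ler_pM; rewrite ?expR_ge0// ler_expR ler_wpM2l.
have -> : 2 * K * (T * expR (L * T)) * tau ^+ 2 =
    K * tau ^+ 2 * (T * expR (L * T)) + K * tau ^+ 2 * (T * expR (L * T)) by ring.
apply: err_bound; [apply: Hb_le dle _|apply: Hb_le dle _].
  by apply: Hb_ext hp => x; rewrite /plus !mxE; ring.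
by apply: Hb_ext hm => x; rewrite /minus !mxE; ring.
Qed.

(** The constants are chosen as functions of the bound of the solution; [tau0]
    makes the global error at most one, as required by the stability argument.
    *)
Lemma scheme_converges : exists tau0 C : R -> R -> R -> R,
  (forall M M' T, 0 < tau0 M M' T /\ 0 < C M M' T) /\
  forall (T : R) (Phi0 : spinor_fun) (Phi dPhi : R -> spinor_fun),
    0 < T ->
    is_solution lambda T (fun t => Vt (Phi t)) Phi0 Phi dPhi ->
    in_Linf T (r + 1) Phi ->
    in_Linf T r dPhi ->
    let M := fine (Linf_norm T (r + 1) Phi) in
    let M' := fine (Linf_norm T r dPhi) in
    forall (tau : R) (n : nat),
      0 < tau -> tau <= tau0 M M' T -> n%:R * tau <= T ->
      let err := Phi (n%:R * tau) - iterates tau Phi0 n in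
      in_Hs2 r err /\ (Hnorm2 r err <= (C M M' T * tau ^+ 2)%:E)%E.
Proof.
have [K HK] := choice error_estimate; have [L HL] := choice HK.
pose rho (M T : R) : R := `|T| * expR (L M * `|T|).
have K0 (M : R) : 0 <= K M by case: (HL M).
have rho0 (M T : R) : 0 <= rho M T by rewrite mulr_ge0 ?expR_ge0.
pose Ct (M M0 T : R) : R := 2 * K M * rho M T + 1.
have C0 (M M0 T : R) : 0 < Ct M M0 T by rewrite ltr_wpDl// mulr_ge0 ?rho0// mulr_ge0.
pose t0 (M M0 T : R) : R := Num.min 1 (Ct M M0 T)^-1.
exists t0, Ct; split=> [M M' T|]; first by rewrite lt_min ltr01 invr_gt0 !C0.
move=> T Phi0 Phi dPhi T0 sol reg _ M M' tau n tau0 tauC nT err.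
have [_ _ HM] := HL M.
move: tauC; rewrite le_min => /andP[tau1 tauC].
have CT : tau * Ct M M' T <= 1 by rewrite -ler_pdivlMr// div1r.
have rhoE : T * expR (L M * T) = rho M T by rewrite /rho gtr0_norm.
(* Since [tau <= 1], a first-order smallness of [tau] is enough. *)
have tau2 : tau ^+ 2 <= tau by rewrite expr2 ler_piMl// ltW.
have KR : 0 <= K M * rho M T by rewrite mulr_ge0.
have small : K M * tau ^+ 2 * (T * expR (L M * T)) <= 1.
  rewrite rhoE mulrAC; apply: le_trans CT; apply: le_trans (_ : K M * rho M T * tau <= _).
    exact: ler_wpM2l KR _ _ tau2.
  by rewrite mulrC ler_pM2l// /Ct -mulrA mulr_natl mulr2n; lra.
have [h1 h2] := HM T Phi0 Phi dPhi T0 sol reg erefl tau n tau0 tau1 small nT.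
split=> //; apply: le_trans h2 _; rewrite lee_fin rhoE.
by apply: ler_wpM2r; rewrite ?sqr_ge0// lerDl.
Qed.

End Scheme.
End Convergence.

Theorem theorem4p1 (R : realType) (lambda r : R) (hr : 2^-1 < r) :
  (exists tau0 C : R -> R -> R -> R,
    (forall M M' T, 0 < tau0 M M' T /\ 0 < C M M' T) /\
    forall (T : R) (Phi0 : R -> 'cV[R[i]]_2) (Phi dPhi : R -> R -> 'cV[R[i]]_2),
      0 < T ->
      is_DP_solution lambda T Phi0 Phi dPhi ->
      in_Linf T (r + 1) Phi ->
      in_Linf T r dPhi ->
      let M := fine (Linf_norm T (r + 1) Phi) in
      let M' := fine (Linf_norm T r dPhi) in
      forall (tau : R) (n : nat),
        0 < tau -> tau <= tau0 M M' T -> n%:R * tau <= T ->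
        let err := Phi (n%:R * tau) - ULI2_DP lambda tau Phi0 n in
        in_Hs2 r err /\ (Hnorm2 r err <= (C M M' T * tau ^+ 2)%:E)%E)
  /\
  (forall V : R -> R, smooth_potential V ->
   exists tau0 C : R -> R -> R -> R,
    (forall M M' T, 0 < tau0 M M' T /\ 0 < C M M' T) /\
    forall (T : R) (Phi0 : R -> 'cV[R[i]]_2) (Phi dPhi : R -> R -> 'cV[R[i]]_2),
      0 < T ->
      is_NDE_solution lambda T V Phi0 Phi dPhi ->
      in_Linf T (r + 1) Phi ->
      in_Linf T r dPhi ->
      let M := fine (Linf_norm T (r + 1) Phi) in
      let M' := fine (Linf_norm T r dPhi) in
      forall (tau : R) (n : nat),
        0 < tau -> tau <= tau0 M M' T -> n%:R * tau <= T ->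
        let err := Phi (n%:R * tau) - ULI2_ext lambda tau V Phi0 n in
        in_Hs2 r err /\ (Hnorm2 r err <= (C M M' T * tau ^+ 2)%:E)%E).
Proof.
split=> [|V smV].
  exact: (scheme_converges (stp := ULI2_DP_step lambda) (Vt := @V_DP R) hr
    (wf_rate_DP lambda) (wf_mean_DP lambda) (fun a A => erefl)
    (fun A p q V sg s x hp hq hV => mean_DP_deriv lambda V sg s x hr hp hq)
    (lexx 0) (Hb0 (r + 1))
    (fun Phi A hp hq => nonlin_DP_comp lambda hr hp hq)
    (fun tau Phi A hp hq => ULI2_DP_stepE lambda tau hr hp hq)).
have [B B0 HB] := smooth_Hb (r + 1) (smooth_potential_smooth smV).
have HrB : Hb r B (fun x => (V x)%:C) by apply: Hb_lower HB; rewrite lerDl.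
have nonlinE Phi A : Hb r A (plus Phi) -> Hb r A (minus Phi) ->
    plus (nonlin lambda (fun x => (V x)%:C) Phi) =
      eval (env3 (plus Phi) (minus Phi) (fun x => (V x)%:C)) (rate_ext lambda) /\
    minus (nonlin lambda (fun x => (V x)%:C) Phi) =
      eval (env3 (minus Phi) (plus Phi) (fun x => (V x)%:C)) (rate_ext lambda).
  by split; apply/funext => x; rewrite eval_rate_ext;
    [exact: (nonlin_comp _ _ _ _).1|exact: (nonlin_comp _ _ _ _).2].
have stpE tau Phi A : Hb r A (plus Phi) -> Hb r A (minus Phi) ->
    plus (ULI2_ext_step lambda tau Phi V) = step (rate_ext lambda) (mean_ext lambda) 1
      tau (plus Phi) (minus Phi) (fun x => (V x)%:C) /\
    minus (ULI2_ext_step lambda tau Phi V) = step (rate_ext lambda) (mean_ext lambda) (-1)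
      tau (minus Phi) (plus Phi) (fun x => (V x)%:C).
  move=> hp hq; have a1 : A <= A + B by rewrite lerDl.
  have a2 : B <= A + B by rewrite lerDr (Hb_ge0 hp).
  exact: (ULI2_ext_stepE lambda tau hr (Hb_le a1 hp) (Hb_le a1 hq) (Hb_le a2 HrB)).
exact: (scheme_converges (stp := fun tau Phi => ULI2_ext_step lambda tau Phi V)
  (Vt := fun _ x => (V x)%:C) hr
  (wf_rate_ext lambda) (wf_mean_ext lambda) (fun a A => erefl)
  (fun A p q V sg s x hp hq hV => mean_ext_deriv lambda p sg s x hr hq hV)
  B0 HB nonlinE stpE).
Qed.
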